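(* For every $p$ with $1<p<\infty$, the group $\mathrm{Sp}(2,\mathbb{R})$ does not have the $p$-approximation property ($p$-AP).
   Context: $\mathrm{Sp}(2,\mathbb{R})=\{g\in M_4(\mathbb{R}): g^tJg=J\}$ with $J=\begin{pmatrix}0&I_2\\-I_2&0\end{pmatrix}$ (real $4\times4$ symplectic matrices). Let $G$ be a locally compact group with a left Haar measure, $1<p<\infty$, $p'$ with $\frac1p+\frac1{p'}=1$. $\lambda_p(s)f(t)=f(s^{-1}t)$ is the left regular representation on $L_p(G)$. The Figà-Talamanca–Herz algebra $A_p(G)$ is the image of the map $\Lambda_p:L_{p'}(G)\hat\otimes L_p(G)\to C_0(G)$ (projective tensor product), $\Lambda_p(g\otimes f)(s)=\langle g,\lambda_p(s)f\rangle=\int_G g(t)f(s^{-1}t)\,dt$, with the quotient norm of $L_{p'}(G)\hat\otimes L_p(G)/\ker\Lambda_p$. $SQ_p$ is the class of (complex) Banach spaces that are quotients of closed subspaces (equivalently, subspaces of quotients) of $L_p$ spaces. $M_{p\text{-}cb}(G)$ is the space of functions $\varphi:G\to\mathbb{C}$ for which there exist $E\in SQ_p$ and continuous bounded maps $\alpha:G\to E$, $\beta:G\to E^*$ with $\varphi(st^{-1})=\langle\beta(s),\alpha(t)\rangle$ for all $s,t\in G$; its norm is the infimum of $\sup_t\|\alpha(t)\|\,\sup_s\|\beta(s)\|$ over all such $E,\alpha,\beta$. There are contractive inclusions $A_p(G)\hookrightarrow M_{p\text{-}cb}(G)\hookrightarrow C_b(G)$. $L_1(G)$ embeds in $M_{p\text{-}cb}(G)^*$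 via $\langle f,\varphi\rangle=\int_G f\varphi$, and $Q_{p\text{-}cb}(G)$ denotes its norm closure in $M_{p\text{-}cb}(G)^*$; one has $M_{p\text{-}cb}(G)=Q_{p\text{-}cb}(G)^*$. $G$ has the $p$-AP if there is a net $(\varphi_i)$ in $A_p(G)$ such that $\varphi_i\to1$ in the weak* topology $\sigma(M_{p\text{-}cb}(G),Q_{p\text{-}cb}(G))$. *)

(* Defs.v *)
From HB Require Import structures.
From mathcomp Require Import all_boot all_order all_algebra.
From mathcomp Require Import complex.
From mathcomp Require Import all_classical all_reals all_analysis.

Set Implicit Arguments.
Unset Strict Implicit.
Unset Printing Implicit Defensive.

Import Order.TTheory GRing.Theory Num.Theory.
Import numFieldNormedType.Exports.

Local Open Scope classical_set_scope.
Local Open Scope ring_scope.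

HB.mixin Record isLCGroup G of Group G & Topological G := {
  mulg_continuous : continuous (fun x : G * G => (x.1 * x.2)%g) ;
  invg_continuous : continuous (fun x : G => x^-1%g) ;
  lcgroup_hausdorff : hausdorff_space G ;
  lcgroup_locally_compact : locally_compact [set: G] }.

(* The base point plays no role; it is there because the measurable types of
   the library are pointed. *)
#[short(type="lcGroupType")]
HB.structure Definition LCGroup :=
  {G of Group G & PointedTopological G & isLCGroup G}.

Definition borel (G : ptopologicalType) := g_sigma_algebraType (@open G).

Definition left_haar (R : realType) (G : lcGroupType)
    (mu : {measure set (borel G) -> \bar R}) : Prop :=
  [/\ mu [set: borel G] != 0%E,
      forall (s : G) (A : set (borel G)), measurable A ->
        mu [set (s * t)%g | t in A] = mu A,
      forall K : set G, compact K -> (mu K < +oo)%E,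
      forall A : set (borel G), measurable A ->
        mu A = ereal_inf [set mu U | U in [set U : set G | open U /\ A `<=` U]]
    & forall U : set G, open U ->
        mu U = ereal_sup
                 [set mu K | K in [set K : set G | compact K /\ K `<=` U]] ].

(* Norms over [R[i]] take their (real) values in [R[i]]. *)
Definition rnorm (R : realType) (E : normedZmodType R[i]) (x : E) : R :=
  complex.Re `|x|.

Section ComplexLp.
Context (R : realType) d (T : measurableType d).
Variable mu : {measure set T -> \bar R}.
Implicit Types (p q : R) (f g : T -> R[i]).

Definition cmeasurable f : Prop :=
  measurable_fun setT (fun x => complex.Re (f x)) /\
  measurable_fun setT (fun x => complex.Im (f x)).

Definition cintegral f : R[i] :=
  Complex (\int[mu]_x complex.Re (f x)) (\int[mu]_x complex.Im (f x)).

Definition eLpnorm p f : \bar R := Lnorm mu p%:E (fun x => (rnorm (f x))%:E).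

(* Elements of [L_p] are represented by functions, not by classes modulo
   almost everywhere equality. *)
Definition Lp p : set (T -> R[i]) :=
  [set f | cmeasurable f /\ (eLpnorm p f < +oo)%E].

Definition Lpnorm p f : R := fine (eLpnorm p f).

Definition Lp_closed_subspace p (X : set (T -> R[i])) : Prop :=
  [/\ X `<=` Lp p,
      X (fun=> 0),
      forall (a : R[i]) f g, X f -> X g -> X (fun x => a * f x + g x)
    & forall f, Lp p f ->
        (forall e : R, 0 < e ->
           exists2 g, X g & Lpnorm p (fun x => f x - g x) < e) ->
        X f].

(* A sequence [:: (g_1, f_1); ...; (g_n, f_n)] represents the tensor
   g_1 (x) f_1 + ... + g_n (x) f_n. *)
Definition tensors q p : set (seq ((T -> R[i]) * (T -> R[i]))) :=
  [set u : seq ((T -> R[i]) * (T -> R[i])) |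
     forall x, x \in u -> Lp q x.1 /\ Lp p x.2].

Definition Lp_bilinear q p (B : (T -> R[i]) -> (T -> R[i]) -> R[i]) : Prop :=
  [/\ forall (a : R[i]) g g' f, Lp q g -> Lp q g' -> Lp p f ->
        B (fun x => a * g x + g' x) f = a * B g f + B g' f,
      forall (a : R[i]) g f f', Lp q g -> Lp p f -> Lp p f' ->
        B g (fun x => a * f x + f' x) = a * B g f + B g f'
    & forall g g' f f', Lp q g -> Lp q g' -> Lp p f -> Lp p f' ->
        {ae mu, forall x, g x = g' x} -> {ae mu, forall x, f x = f' x} ->
        B g f = B g' f'].

(* Two representatives define the same element of the algebraic tensor product
   when all bilinear forms agree on them (universal property). *)
Definition tensor_eq q p (u v : seq ((T -> R[i]) * (T -> R[i]))) : Prop :=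
  forall B, Lp_bilinear q p B ->
    \sum_(x <- u) B x.1 x.2 = \sum_(x <- v) B x.1 x.2.

Definition projnorm q p (u : seq ((T -> R[i]) * (T -> R[i]))) : R :=
  inf [set \sum_(x <- v) Lpnorm q x.1 * Lpnorm p x.2
      | v in [set v | tensors q p v /\ tensor_eq q p v u]].

Definition tensor_sub (u v : seq ((T -> R[i]) * (T -> R[i]))) :=
  u ++ [seq ((fun t => - x.1 t), x.2) | x <- v].

(* The elements of the completed tensor product are represented by the Cauchy
   sequences of the projective norm. *)
Definition proj_cauchy q p (u : nat -> seq ((T -> R[i]) * (T -> R[i]))) :
    Prop :=
  (forall n, tensors q p (u n)) /\
  forall e : R, 0 < e -> exists N, forall m n, (N <= m)%N -> (N <= n)%N ->
    projnorm q p (tensor_sub (u m) (u n)) < e.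

End ComplexLp.

Section FigaTalamancaHerz.
Context (R : realType) (G : lcGroupType).
Variables (mu : {measure set (borel G) -> \bar R}) (p : R).

Definition conj_exponent : R := (1 - p^-1)^-1.

Definition lambda (s : G) (f : G -> R[i]) : G -> R[i] :=
  fun t => f (s^-1 * t)%g.

Definition Lambda (u : seq ((G -> R[i]) * (G -> R[i]))) (s : G) : R[i] :=
  \sum_(x <- u) cintegral mu (fun t => x.1 t * lambda s x.2 t).

(* The image of the completion under the continuous extension of [Lambda]:
   limits in C_0(G), that is, uniform limits, of the images of the Cauchy
   sequences of tensors. *)
Definition Ap : set (G -> R[i]) :=
  [set phi | exists2 u, proj_cauchy mu conj_exponent p u &
     forall e : R, 0 < e -> exists N, forall n, (N <= n)%N ->
       forall s, rnorm (Lambda (u n) s - phi s) < e].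

End FigaTalamancaHerz.

(* [E] is isometrically isomorphic to the quotient [X / Y], for closed
   subspaces [Y] and [X] of an [L_p] space with [Y] included in [X]; the
   isomorphism is given as a map [j] on [X] that induces it. *)
Definition SQ (R : realType) (p : R) (E : completeNormedModType R[i]) : Prop :=
  exists (d : measure_display) (T : measurableType d)
    (mu : {measure set T -> \bar R}) (X Y : set (T -> R[i]))
    (j : (T -> R[i]) -> E),
    [/\ [/\ Lp_closed_subspace mu p X, Lp_closed_subspace mu p Y & Y `<=` X],
        forall (a : R[i]) f g, X f -> X g ->
          j (fun x => a * f x + g x) = a *: j f + j g,
        forall x : E, exists2 f, X f & j f = x
      & forall f, X f ->
          rnorm (j f) = inf [set Lpnorm mu p (fun x => f x - g x) | g in Y]].

Section Dual.
Context (R : realType) (E : completeNormedModType R[i]).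

Definition banach_dual : set (E -> R[i]) :=
  [set l | scalar l /\ continuous (l : E -> R[i]^o)].

Definition dualnorm (l : E -> R[i]) : R :=
  sup [set rnorm (l x) | x in [set x : E | rnorm x <= 1]].

End Dual.

Section Mpcb.
Context (R : realType) (G : lcGroupType).
Variable p : R.

Definition Mpcb_factor (phi : G -> R[i]) (E : completeNormedModType R[i])
    (alpha : G -> E) (beta : G -> E -> R[i]) : Prop :=
  [/\ SQ p E,
      continuous alpha /\ has_ubound (range (fun t => rnorm (alpha t))),
      forall s, banach_dual (beta s),
      (forall (s : G) (e : R), 0 < e ->
         \forall s' \near s, dualnorm (fun x => beta s' x - beta s x) < e) /\
      has_ubound (range (fun s => dualnorm (beta s)))
    & forall s t, phi (s * t^-1)%g = beta s (alpha t)].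

Definition Mpcb : set (G -> R[i]) :=
  [set phi | exists (E : completeNormedModType R[i]) (alpha : G -> E)
     (beta : G -> E -> R[i]), Mpcb_factor phi alpha beta].

Definition Mpcb_norm (phi : G -> R[i]) : R :=
  inf [set c | exists (E : completeNormedModType R[i]) (alpha : G -> E)
    (beta : G -> E -> R[i]), Mpcb_factor phi alpha beta /\
    c = sup (range (fun t => rnorm (alpha t))) *
        sup (range (fun s => dualnorm (beta s)))].

(* Functionals on [Mpcb] are represented by maps defined on all functions, of
   which only the values on [Mpcb] matter. *)
Definition Mpcb_dual : set ((G -> R[i]) -> R[i]) :=
  [set Phi |
     (forall (a : R[i]) phi psi, Mpcb phi -> Mpcb psi ->
        Phi (fun x => a * phi x + psi x) = a * Phi phi + Phi psi) /\
     (exists c : R, forall phi, Mpcb phi ->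
        rnorm (Phi phi) <= c * Mpcb_norm phi)].

Definition Mpcb_dualnorm (Phi : (G -> R[i]) -> R[i]) : R :=
  sup [set rnorm (Phi phi)
      | phi in [set phi | Mpcb phi /\ Mpcb_norm phi <= 1]].

Variable mu : {measure set (borel G) -> \bar R}.

Definition Qpcb : set ((G -> R[i]) -> R[i]) :=
  [set Phi | Mpcb_dual Phi /\
     forall e : R, 0 < e -> exists2 f : G -> R[i], Lp mu 1 f &
       Mpcb_dualnorm
         (fun phi => Phi phi - cintegral mu (fun t => f t * phi t)) < e].

End Mpcb.

Definition directed (I : Type) (le : I -> I -> Prop) : Prop :=
  [/\ inhabited I, forall i, le i i,
      forall i j k, le i j -> le j k -> le i k
    & forall i j, exists2 k, le i k & le j k].

Definition net_filter (I : Type) (le : I -> I -> Prop) : set_system I :=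
  filter_from [set: I] (fun i => [set j | le i j]).

Definition p_AP (R : realType) (G : lcGroupType)
    (mu : {measure set (borel G) -> \bar R}) (p : R) : Prop :=
  exists (I : Type) (le : I -> I -> Prop) (phi : I -> G -> R[i]),
    [/\ directed le,
        forall i, Ap mu p (phi i)
      & forall Phi, Qpcb p mu Phi ->
          (fun i => Phi (phi i) : R[i]^o) @ net_filter le
            --> (Phi (fun=> 1) : R[i]^o)].

Section Symplectic.
Context (R : realType).

Definition symJ : 'M[R]_(2 + 2) := block_mx 0 1%:M (- 1%:M) 0.

Definition Sp2 : Type :=
  set_type [set g : 'M[R]_(2 + 2) | g^T *m symJ *m g = symJ].

HB.instance Definition _ := Topological.on Sp2.

Definition Sp2_mx (g : Sp2) : 'M[R]_(2 + 2) := set_val g.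

Lemma Sp2P (g : Sp2) : (Sp2_mx g)^T *m symJ *m Sp2_mx g = symJ.
Proof. by case: g => m hm; exact: set_mem hm. Qed.

Definition mkSp2 (m : 'M[R]_(2 + 2)) (hm : m^T *m symJ *m m = symJ) : Sp2 :=
  exist _ m (mem_set hm).

Lemma Sp2_inj : injective Sp2_mx.
Proof. exact: val_inj. Qed.

Lemma symJJ : symJ *m symJ = - 1%:M.
Proof.
rewrite /symJ mulmx_block !mul0mx !mulmx0 !addr0 !add0r mulmx1 mul1mx.
by rewrite [in RHS](@scalar_mx_block _ 2 2) opp_block_mx !oppr0.
Qed.

Definition Sp2_inv_mx (g : Sp2) : 'M[R]_(2 + 2) :=
  (- symJ) *m (Sp2_mx g)^T *m symJ.

Lemma Sp2_inv_mxl g : Sp2_inv_mx g *m Sp2_mx g = 1%:M.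
Proof.
by rewrite /Sp2_inv_mx !mulNmx -!mulmxA (mulmxA _^T) Sp2P symJJ opprK.
Qed.

Lemma Sp2_inv_mxr g : Sp2_mx g *m Sp2_inv_mx g = 1%:M.
Proof. exact/mulmx1C/Sp2_inv_mxl. Qed.

Lemma Sp2_one_subproof : (1%:M)^T *m symJ *m 1%:M = symJ.
Proof. by rewrite trmx1 mulmx1 mul1mx. Qed.

Lemma Sp2_mul_subproof (g h : Sp2) :
  (Sp2_mx g *m Sp2_mx h)^T *m symJ *m (Sp2_mx g *m Sp2_mx h) = symJ.
Proof.
have -> : (Sp2_mx g *m Sp2_mx h)^T *m symJ *m (Sp2_mx g *m Sp2_mx h) =
    (Sp2_mx h)^T *m ((Sp2_mx g)^T *m symJ *m Sp2_mx g) *m Sp2_mx h.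
  by rewrite trmx_mul !mulmxA.
by rewrite !Sp2P.
Qed.

Lemma Sp2_inv_subproof (g : Sp2) :
  (Sp2_inv_mx g)^T *m symJ *m Sp2_inv_mx g = symJ.
Proof.
move: (Sp2_inv_mx g) (Sp2_inv_mxr g) => k hk.
rewrite -{1}(Sp2P g) !mulmxA -trmx_mul hk trmx1 mul1mx -mulmxA.
by rewrite hk mulmx1.
Qed.

Definition Sp2_one : Sp2 := mkSp2 Sp2_one_subproof.
Definition Sp2_mul (g h : Sp2) : Sp2 := mkSp2 (Sp2_mul_subproof g h).
Definition Sp2_inv (g : Sp2) : Sp2 := mkSp2 (Sp2_inv_subproof g).

Lemma Sp2_mulA : associative Sp2_mul.
Proof. by move=> x y z; apply: Sp2_inj; exact: mulmxA. Qed.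
Lemma Sp2_mul1 : left_id Sp2_one Sp2_mul.
Proof. by move=> x; apply: Sp2_inj; exact: mul1mx. Qed.
Lemma Sp2_1mul : right_id Sp2_one Sp2_mul.
Proof. by move=> x; apply: Sp2_inj; exact: mulmx1. Qed.
Lemma Sp2_mulV : left_inverse Sp2_one Sp2_inv Sp2_mul.
Proof. by move=> x; apply: Sp2_inj; exact: Sp2_inv_mxl. Qed.
Lemma Sp2_Vmul : right_inverse Sp2_one Sp2_inv Sp2_mul.
Proof. by move=> x; apply: Sp2_inj; exact: Sp2_inv_mxr. Qed.

HB.instance Definition _ :=
  isGroup.Build Sp2 Sp2_mulA Sp2_mul1 Sp2_1mul Sp2_mulV Sp2_Vmul.
HB.instance Definition _ := isPointed.Build Sp2 Sp2_one.

Lemma mx_continuousP (U : topologicalType) m n (F : U -> 'M[R]_(m, n)) :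
  (forall i j, continuous (fun x => F x i j : R)) -> continuous F.
Proof.
move=> cF x A [P nP sPA]; rewrite /= nbhs_simpl/=.
apply: (filterS (P := fun y => forall i j, P i j (F y i j))).
  by move=> y Py; exact: sPA.
apply: filter_forall => i; apply: filter_forall => j.
exact: (cF i j x _ (nP i j)).
Qed.

Lemma mulmx_cont (U : topologicalType) m n q (F : U -> 'M[R]_(m, n))
    (H : U -> 'M[R]_(n, q)) :
  continuous F -> continuous H -> continuous (fun x => F x *m H x).
Proof.
move=> cF cH; apply: mx_continuousP => i j.
have -> : (fun x => (F x *m H x) i j) = (fun x => \sum_k F x i k * H x k j).
  by apply/funext => x; rewrite mxE.
apply: continuous_big; first exact: add_continuous.
move=> k _ x; apply: cvgM.
- exact: (continuous_comp (cF x) (@coord_continuous _ _ _ i k (F x))).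
- exact: (continuous_comp (cH x) (@coord_continuous _ _ _ k j (H x))).
Qed.

Lemma trmx_cont (U : topologicalType) m n (F : U -> 'M[R]_(m, n)) :
  continuous F -> continuous (fun x => (F x)^T).
Proof.
move=> cF; apply: mx_continuousP => i j.
have -> : (fun x => (F x)^T i j) = (fun x => F x j i).
  by apply/funext => y; rewrite mxE.
move=> x; exact: (continuous_comp (cF x) (@coord_continuous _ _ _ j i (F x))).
Qed.

Lemma Sp2_mx_cont : continuous (Sp2_mx : Sp2 -> 'M[R]_(2 + 2)).
Proof. exact: initial_continuous. Qed.

Lemma Sp2_continuousP (U : topologicalType) (F : U -> Sp2) :
  continuous (fun x => Sp2_mx (F x)) -> continuous F.
Proof.
move=> cF x A [_ [[B oB <-] BFx sBA]]; rewrite /= nbhs_simpl/=.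
have h : nbhs x ((fun x => Sp2_mx (F x)) @^-1` B).
  exact: (cF x B (open_nbhs_nbhs (conj oB BFx))).
by apply: filterS h => y By; exact: sBA.
Qed.

Lemma Sp2_mul_cont : continuous (fun x : Sp2 * Sp2 => (x.1 * x.2)%g).
Proof.
apply: Sp2_continuousP; apply: mulmx_cont => x.
- exact: (continuous_comp cvg_fst (@Sp2_mx_cont x.1)).
- exact: (continuous_comp cvg_snd (@Sp2_mx_cont x.2)).
Qed.

Lemma Sp2_inv_cont : continuous (fun x : Sp2 => x^-1%g).
Proof.
apply: Sp2_continuousP; apply: mulmx_cont; last exact: cst_continuous.
apply: mulmx_cont; first exact: cst_continuous.
exact/trmx_cont/Sp2_mx_cont.
Qed.

Lemma Sp2_hausdorff : hausdorff_space Sp2.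
Proof.
move=> x y clxy; apply: Sp2_inj; apply: (@norm_hausdorff _ 'M[R]_(2 + 2)).
move=> A B nA nB.
have [z [Az Bz]] := clxy _ _ (Sp2_mx_cont nA) (Sp2_mx_cont nB).
by exists (Sp2_mx z).
Qed.

Lemma Sp2_closed : closed [set g : 'M[R]_(2 + 2) | g^T *m symJ *m g = symJ].
Proof.
have h : continuous (fun g : 'M[R]_(2 + 2) => g^T *m symJ *m g).
  apply: mulmx_cont; last by move=> x; exact: cvg_id.
  apply: mulmx_cont; last exact: cst_continuous.
  by apply: trmx_cont => x; exact: cvg_id.
rewrite (_ : mkset _ = (fun g => g^T *m symJ *m g) @^-1` [set symJ]) //.
apply: closed_comp.
  move=> x _; exact: h.
apply: accessible_closed_set1; apply: hausdorff_accessible.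
exact: (@norm_hausdorff _ 'M[R]_(2 + 2)).
Qed.

Lemma mx_box_compact m n (c : R) :
  compact [set M : 'M[R]_(m, n) | forall i j, M i j \in `[(- c), c]].
Proof.
have cv : compact [set v : 'rV[R]_(m * n) |
    forall i, [set` `[(- c), c]] (v ord0 i)].
  by apply: (@rV_compact R _ (fun=> [set` `[(- c), c]])) => i; exact: segment_compact.
rewrite (_ : mkset _ = [set vec_mx v | v in
    [set v : 'rV[R]_(m * n) | forall i, [set` `[(- c), c]] (v ord0 i)]]).
  apply: continuous_compact => //; apply: continuous_subspaceT.
  apply: mx_continuousP => i j.
  have -> : (fun v : 'rV[R]_(m * n) => vec_mx v i j) =
            (fun v => v ord0 (mxvec_index i j)) by apply/funext => v; rewrite mxE.
  exact: coord_continuous.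
apply/seteqP; split => M /=.
- move=> hM; exists (mxvec M); last exact: mxvecK.
  by move=> k; case/mxvec_indexP: k => i j; rewrite mxvecE; exact: hM.
- by case=> v hv <- i j; rewrite mxE; exact: hv.
Qed.

Lemma Sp2_locally_compact : locally_compact [set: Sp2].
Proof.
move=> x _; rewrite withinET.
pose c : R := `|Sp2_mx x| + 1.
pose K := [set M : 'M[R]_(2 + 2) | forall i j, M i j \in `[(- c), c]].
have cK : compact K by exact: mx_box_compact.
have clK : closed K by apply: compact_closed => //; exact: norm_hausdorff.
have nK : nbhs (Sp2_mx x) K.
  apply/nbhs_ballP; exists 1 => //= M [_ xM] i j.
  have := xM i j; rewrite /ball_/= => h.
  have h1 : `|Sp2_mx x i j| <= `|Sp2_mx x|.
    rewrite [leRHS](_ : _ = mx_norm (Sp2_mx x)) // mx_normrE.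
    exact: (le_bigmax _ (fun ij => `|Sp2_mx x ij.1 ij.2|) (i, j)).
  rewrite in_itv/= -ler_norml /c.
  rewrite -[M i j](subKr (Sp2_mx x i j)).
  by apply: (le_trans (ler_normB _ _)); rewrite lerD// ltW.
exists (Sp2_mx @^-1` K); first exact: (Sp2_mx_cont nK).
split; last by apply: closed_comp => // y _; exact: Sp2_mx_cont.
move=> F PF FK.
have cKS : compact (K `&` [set g : 'M[R]_(2 + 2) | g^T *m symJ *m g = symJ]).
  by apply: compact_closedI => //; exact: Sp2_closed.
have FKS : F (Sp2_mx @^-1` (K `&`
    [set g : 'M[R]_(2 + 2) | g^T *m symJ *m g = symJ])).
  by apply: (@filterS _ F _ _ _ _ FK) => z Kz; split; [exact: Kz|exact: Sp2P].
have [y [[Ky Sy] cly]] := cKS (Sp2_mx @ F) (fmap_proper_filter _ PF) FKS.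
exists (mkSp2 Sy); split => // A B FA [_ [[V oV <-] Vy sVB]].
have FA' : F (Sp2_mx @^-1` (Sp2_mx @` A)).
  by apply: (@filterS _ F _ _ _ _ FA) => a Aa; exists a.
have [z [[a Aa <-] Vz]] := cly _ V FA' (open_nbhs_nbhs (conj oV Vy)).
by exists a; split => //; exact: sVB.
Qed.

HB.instance Definition _ := isLCGroup.Build Sp2
  Sp2_mul_cont Sp2_inv_cont Sp2_hausdorff Sp2_locally_compact.

End Symplectic.

(* Main.v *)
(* Write a p-completely bounded multiplier as [phi (s t^-1) = <beta s, alpha t>]
   with values in a space of class SQ_p. A real matrix [T] with a small Gram
   matrix has small norm on l_p, by interpolation between l_2 (Schur test) and
   l_1, l_oo, hence also on vectors of an SQ_p space; so the sums
   [\sum_(i, j) T i j * phi (s_i t_j^-1)] are small.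

   Let [f, p, q, l] be one-parameter groups of unipotents with commutators
   [[f, l]] in [q p] and [[f, q]] in [p], all the other pairs commuting. A
   suitable [T], the difference of two partial transports along the group law,
   shows that the mean of [phi] over long products [f p q l] hardly changes when
   the factor [q] is dropped, and therefore when the range of its mean is
   changed. Applied to consecutive root groups [e0, ..., e5] of Sp(2,R), this
   makes the successive means over [e0 e1 e2 e3 e4 e5], with ranges
   [1, 2^8k, 2^10k, 2^14k, 2^6k, 1], a Cauchy sequence in the dual of the
   multipliers. Its limit maps 1 to 1; it kills the functions that vanish at
   infinity, because the mean over [e4] leaves every compact set. After a
   convolution that replaces the point masses by densities, the limit belongs to
   the predual, and it separates 1 from the Figa-Talamanca-Herz algebra. *)

Require Import Defs.
From mathcomp Require Import all_boot all_order all_algebra.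
From mathcomp Require Import complex.
From mathcomp Require Import all_classical all_reals all_analysis.
From mathcomp Require Import measurable_realfun.
From mathcomp Require Import ring lra zify.

Set Implicit Arguments.
Unset Strict Implicit.
Unset Printing Implicit Defensive.

Import Order.TTheory GRing.Theory Num.Theory.
Import numFieldNormedType.Exports.

Local Open Scope classical_set_scope.
Local Open Scope ring_scope.

(** * Interpolation for matrices with a small Gram matrix *)

(** A mean hardly sees an inserted factor [q] because the group law reproduces it. Moving [f x] past
    [l a] creates [q (a x) p (a x^2)]. For two values [a <> a'], shifting [x] by [d / (a - a')]
    changes the relative [q] component by exactly [d], and the relative [p] component by the
    commutator of [f x] with [q d], up to a constant that the mean over [p] absorbs. So any two rows
    of [T] with different [a] are nearly orthogonal. All this takes place between integer exponents,
    and the Gram matrix is estimated by counting. No orthogonality is left in an SQ_p space.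
    Interpolation turns the saving in l_2 into a power of it whose exponent tends to 0 as [p] tends
    to 1 or to infinity, but stays positive; any positive power makes the changes of range summable.
    The convolution has a second purpose: it gives all continuous functions with the same bound one
    modulus of continuity, so that Riemann sums converge uniformly on the unit ball of the
    multipliers. *)

Lemma le_of_eq (R : numDomainType) (x y : R) : x = y -> x <= y.
Proof. by move->. Qed.

Lemma powRDp (R : realType) (x r s : R) :
  0 < x -> x `^ (r + s) = x `^ r * x `^ s.
Proof. by move=> x0; rewrite powRD// (gt_eqF x0) implybT. Qed.

Lemma far_levels (x y : int) :
  ~~ [|| x == y, x - 1 == y | x + 1 == y] -> (x + 2 <= y) || (y + 2 <= x).
Proof. by lia. Qed.

Section Interpolation.
Context (R : realType) (I J : finType) (T : I -> J -> R).

(** The left side is the quadratic form of the Gram matrix at [g]. This matrix is symmetric, so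
    [2 |g i g i'| <= g i ^ 2 + g i' ^ 2] leaves only its row sums. *)
Lemma schur_test (sigma : R) (g : I -> R) :
  (forall i, \sum_i' `|\sum_j T i j * T i' j| <= sigma) ->
  \sum_j (\sum_i T i j * g i) ^+ 2 <= sigma * \sum_i g i ^+ 2.
Proof.
move=> gram.
have -> : \sum_j (\sum_i T i j * g i) ^+ 2 =
    \sum_i \sum_i' (\sum_j T i j * T i' j) * (g i * g i').
  under eq_bigr => j _ do rewrite expr2 mulr_suml.
  rewrite exchange_big; apply: eq_bigr => i _.
  under eq_bigr => j _ do rewrite mulr_sumr.
  rewrite exchange_big; apply: eq_bigr => i' _.
  by rewrite mulr_suml; apply: eq_bigr => j _; ring.
pose G i i' := `|\sum_j T i j * T i' j|.
have Gsym i i' : G i i' = G i' i.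
  by rewrite /G; congr `|_|; apply: eq_bigr => j _; rewrite mulrC.
apply: (@le_trans _ _ (\sum_i \sum_i' (2^-1 * (G i i' * g i ^+ 2) +
                                      2^-1 * (G i i' * g i' ^+ 2)))).
  apply: ler_sum => i _; apply: ler_sum => i' _.
  apply: le_trans (ler_norm _) _; rewrite normrM -/(G i i').
  rewrite -mulrDr -mulrDr mulrCA ler_wpM2l ?normr_ge0// normrM.
  have := sqr_ge0 (`|g i| - `|g i'|).
  rewrite sqrrB !real_normK ?num_real//; lra.
have E : \sum_i \sum_i' 2^-1 * (G i i' * g i' ^+ 2) =
    \sum_i \sum_i' 2^-1 * (G i i' * g i ^+ 2).
  by rewrite exchange_big; apply: eq_bigr => i _; apply: eq_bigr => i' _;
    rewrite Gsym.
under eq_bigr => i _ do rewrite big_split.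
have half (x : R) : 2^-1 * x + 2^-1 * x = x by lra.
rewrite big_split E -big_split mulr_sumr; apply: ler_sum => i _ /=.
rewrite -big_split /=.
under eq_bigr => i' _ do rewrite half.
by rewrite -mulr_suml ler_wpM2r ?sqr_ge0//; exact: gram.
Qed.

(** Keeping the entries whose row and column have equal levels gives a block matrix. On one block it
    acts as [T] on a [g] cut off to that level, so the Schur test for the whole [T] applies, and the
    weight is constant there. *)
Lemma level_block (sigma : R) (g : I -> R) (lv : J -> int) (lv' : I -> int)
    (y : int -> R) :
  (forall i, \sum_i' `|\sum_j T i j * T i' j| <= sigma) ->
  0 <= sigma -> (forall k, 0 <= y k) ->
  \sum_j y (lv j) * (\sum_(i | lv' i == lv j) T i j * g i) ^+ 2 <=
  sigma * \sum_i y (lv' i) * g i ^+ 2.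
Proof.
move=> gram s0 y0.
(* Levels range over all integers, so the blocks are indexed by one chosen column in each class of
   equal level. *)
pose rep j := odflt j [pick j' | lv j' == lv j].
have lrep j : lv (rep j) = lv j.
  by rewrite /rep; case: pickP => [j' /eqP //|/(_ j)]; rewrite eqxx.
have erep j j' : lv j = lv j' -> rep j = rep j'.
  move=> e; rewrite /rep e; case: pickP => [//|/(_ j')]; by rewrite eqxx.
rewrite (partition_big rep (fun r => rep r == r)) /=; last first.
  by move=> j _; apply/eqP/erep.
apply: (@le_trans _ _ (\sum_(r | rep r == r)
    sigma * (y (lv r) * \sum_(i | lv' i == lv r) g i ^+ 2))).
  apply: ler_sum => r /eqP rr.
  pose gr i := if lv' i == lv r then g i else 0.
  have -> : \sum_(i | lv' i == lv r) g i ^+ 2 = \sum_i gr i ^+ 2.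
    rewrite big_mkcond; apply: eq_bigr => i _; rewrite /gr.
    by case: ifP; rewrite ?expr0n.
  rewrite mulrCA; apply: le_trans (ler_wpM2l (y0 _) (schur_test gr gram)).
  rewrite mulr_sumr big_mkcond; apply: ler_sum => j _.
  case: ifP => [/eqP rj|_]; last by rewrite mulr_ge0// sqr_ge0.
  have -> : lv j = lv r by rewrite -rj lrep.
  apply: le_of_eq; congr (_ * _ ^+ 2); rewrite big_mkcond; apply: eq_bigr => i _.
  by rewrite /gr; case: ifP; rewrite ?mulr0.
rewrite -mulr_sumr ler_wpM2l//.
under [leLHS]eq_bigr => r _ do rewrite mulr_sumr big_mkcond.
rewrite exchange_big; apply: ler_sum => i _ /=.
have tpos : 0 <= y (lv' i) * g i ^+ 2 by rewrite mulr_ge0// sqr_ge0.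
case: (pickP (fun r => (rep r == r) && (lv' i == lv r))) => [r0 /andP[r0r /eqP e]|no].
  rewrite (bigD1 r0)//= e eqxx big1 ?addr0//.
  move=> r /andP[/eqP rr rr0]; case: ifP => // /eqP e'.
  by move: rr0; rewrite -rr -(eqP r0r) (erep r r0) ?eqxx// -e'.
rewrite big1// => r rr; have := no r; rewrite rr /= => ->.
by [].
Qed.

(** The first two terms come from the levels at least two apart, where [a] and [b] differ by a
    factor [N ^+ 2] or more, the last one from the three neighbouring diagonals. *)
Definition interp_const (N t1 t2 : R) : R :=
  (N ^+ 2) `^ (- t2) + (N ^+ 2) `^ (- t1) + 3 / (2 * N).

(* Decompose along the levels [M^k, M^(k+1)) of [a] and [b], with [M = N^2]: far
   levels are controlled by the row and column sums, the three neighbouring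
   diagonals by the Schur test. *)
Lemma interpolation_bilinear (kappa N t1 t2 : R) (a : J -> R) (b : I -> R)
    (f : J -> R) (g : I -> R) :
  0 < kappa -> 1 < N -> 0 < t1 -> 0 < t2 -> t1 + t2 = 1 ->
  (forall i, \sum_j `|T i j| <= 1) -> (forall j, \sum_i `|T i j| <= kappa) ->
  (forall i, \sum_i' `|\sum_j T i j * T i' j| <= kappa / N ^+ 8) ->
  (forall j, 0 <= a j) -> (forall i, 0 <= b i) ->
  (forall j, `|f j| <= a j `^ t1) -> (forall i, `|g i| <= b i `^ t2) ->
  `|\sum_i \sum_j T i j * g i * f j| <=
  interp_const N t1 t2 * (kappa * \sum_j a j + \sum_i b i).
Proof.
move=> k0 N1 t10 t20 t12 rowT colT gram a0 b0 fa gb.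
have N0 : 0 < N by lra.
set M := N ^+ 2.
have M1 : 1 < M by rewrite /M expr2; nra.
have M0 : 0 < M by lra.
pose lev (x : R) : int := Num.floor (ln x / ln M).
have lnM : 0 < ln M by rewrite ln_gt0.
have levP x : 0 < x -> M `^ (lev x)%:~R <= x < M `^ ((lev x)%:~R + 1).
  move=> x0.
  have ex : x = M `^ (ln x / ln M).
    by rewrite /powR gt_eqF// divfK ?gt_eqF// lnK.
  have /andP[h1 h2] := floor_itv (ln x / ln M).
  rewrite [X in _ <= X < _]ex; apply/andP; split.
    by rewrite ler_powR// ltW.
  rewrite /powR gt_eqF// ltr_expR ltr_pM2r//.
  by move: h2; rewrite intrD.
pose la j := lev (a j); pose lb i := lev (b i).
pose X i j := T i j * g i * f j.
pose near i j := [|| lb i == la j, lb i - 1 == la j | lb i + 1 == la j].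
pose B e := \sum_j \sum_(i | lb i + e == la j) X i j.
have split_sum : \sum_i \sum_j X i j = B 0 + B (-1) + B 1 +
    \sum_i \sum_(j | ~~ near i j) X i j.
  have -> : B 0 + B (-1) + B 1 = \sum_i \sum_(j | near i j) X i j.
    have Be e : B e = \sum_i \sum_j if lb i + e == la j then X i j else 0.
      rewrite /B exchange_big; apply: eq_bigr => j _.
      by rewrite -big_mkcond.
    rewrite !Be -!big_split; apply: eq_bigr => i _ /=.
    rewrite -!big_split [RHS]big_mkcond; apply: eq_bigr => j _ /=.
    rewrite /near addr0.
    case: (lb i =P la j) => /= [e1|n1].
      case: eqP => [|_]; first by lia.
      by case: eqP => [|_]; [lia|rewrite !addr0].
    case: (lb i - 1 =P la j) => /= [e2|n2].
      by case: eqP => [|_]; [lia|rewrite addr0 add0r].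
    by case: eqP => _; rewrite !add0r.
  rewrite -big_split; apply: eq_bigr => i _ /=.
  by rewrite (bigID (near i)).
have [A0 Bs0] : 0 <= \sum_j a j /\ 0 <= \sum_i b i.
  by split; apply: sumr_ge0.
have far : `|\sum_i \sum_(j | ~~ near i j) X i j| <=
    (M `^ (- t2) + M `^ (- t1)) * (kappa * \sum_j a j + \sum_i b i).
  apply: (@le_trans _ _ (\sum_i \sum_j (M `^ (- t2) * (`|T i j| * a j) +
                                       M `^ (- t1) * (`|T i j| * b i)))).
    apply: le_trans (ler_norm_sum _ _ _) _; apply: ler_sum => i _.
    apply: le_trans (ler_norm_sum _ _ _) _; rewrite big_mkcond.
    apply: ler_sum => j _.
    have p0 x y : 0 <= x -> 0 <= M `^ y * (`|T i j| * x).
      by move=> x0; rewrite !mulr_ge0// powR_ge0.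
    case: ifP => [nn|_]; last by rewrite addr_ge0 ?p0.
    have Xle : `|X i j| <= `|T i j| * (b i `^ t2 * a j `^ t1).
      by rewrite /X !normrM -mulrA ler_wpM2l// ler_pM.
    have [a_0|an0] := eqVneq (a j) 0.
      apply: le_trans Xle _; rewrite a_0 powR0 ?gt_eqF// !mulr0 add0r.
      exact: p0.
    have [b_0|bn0] := eqVneq (b i) 0.
      apply: le_trans Xle _; rewrite b_0 powR0 ?gt_eqF// mul0r !mulr0 addr0.
      exact: p0.
    have ap : 0 < a j by rewrite lt_neqAle eq_sym an0 a0.
    have bp : 0 < b i by rewrite lt_neqAle eq_sym bn0 b0.
    have /andP[a1 a2] := levP _ ap; have /andP[b1 b2] := levP _ bp.
    have Mle (x y : int) : x <= y -> M `^ x%:~R <= M `^ y%:~R.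
      by move=> xy; rewrite ler_powR ?ler_int// ltW.
    (* The gain on far levels: if [x] is smaller than [y] by a factor [M], then [x ^ s] is smaller
       than [y ^ s] by a factor [M ^ s]. *)
    have small x y s t : 0 < x -> 0 < y -> 0 < s -> s + t = 1 -> x * M <= y ->
        x `^ s * y `^ t <= M `^ (- s) * y.
      move=> x0 y0 s0 st xy.
      have -> : M `^ (- s) * y = M `^ (- s) * y `^ s * y `^ t.
        rewrite -mulrA -powRD ?st ?powRr1 ?(ltW y0)//.
        by rewrite (gt_eqF y0) implybT.
      rewrite ler_wpM2r ?powR_ge0//.
      rewrite powRN ler_pdivlMl ?powR_gt0// -powRM ?(ltW M0) ?(ltW x0)//.
      apply: ge0_ler_powR; rewrite ?nnegrE ?(mulr_ge0 (ltW M0)) ?(ltW x0) ?(ltW y0)//.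
      - exact: ltW.
      - by rewrite mulrC.
    have : (lb i + 2 <= la j) || (la j + 2 <= lb i).
      exact: far_levels.
    case/orP => h.
    - apply: (@le_trans _ _ (M `^ (- t2) * (`|T i j| * a j))); last first.
        by rewrite lerDl p0.
      apply: le_trans Xle _; rewrite [leRHS]mulrCA ler_wpM2l//.
      apply: small => //; first by rewrite addrC.
      have := Mle _ _ h; rewrite intrD => h'.
      apply: le_trans (le_trans h' a1).
      have -> : (lb i)%:~R + 2%:~R = ((lb i)%:~R + 1) + 1 :> R by ring.
      rewrite powRDp// powRr1 ?(ltW M0)//.
      by rewrite ler_wpM2r ?(ltW M0)// ltW.
    - apply: (@le_trans _ _ (M `^ (- t1) * (`|T i j| * b i))); last first.
        by rewrite lerDr p0.
      apply: le_trans Xle _; rewrite [leRHS]mulrCA ler_wpM2l// mulrC.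
      apply: small => //.
      have := Mle _ _ h; rewrite intrD => h'.
      apply: le_trans (le_trans h' b1).
      have -> : (la j)%:~R + 2%:~R = ((la j)%:~R + 1) + 1 :> R by ring.
      rewrite powRDp// powRr1 ?(ltW M0)//.
      by rewrite ler_wpM2r ?(ltW M0)// ltW.
  have e1 : \sum_i \sum_j M `^ (- t2) * (`|T i j| * a j) <=
      M `^ (- t2) * (kappa * \sum_j a j).
    rewrite exchange_big mulr_sumr mulr_sumr; apply: ler_sum => j _ /=.
    by rewrite -mulr_sumr -mulr_suml ler_wpM2l ?powR_ge0// ler_wpM2r.
  have e2 : \sum_i \sum_j M `^ (- t1) * (`|T i j| * b i) <=
      M `^ (- t1) * \sum_i b i.
    rewrite mulr_sumr; apply: ler_sum => i _ /=.
    rewrite -mulr_sumr -mulr_suml ler_wpM2l ?powR_ge0//.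
    by rewrite -[leRHS]mul1r ler_wpM2r.
  under eq_bigr => i _ do rewrite big_split.
  rewrite big_split /=; apply: le_trans (lerD e1 e2) _.
  rewrite mulrDl lerD// ler_wpM2l ?powR_ge0// ?lerDl ?lerDr//.
  by rewrite mulr_ge0// ltW.
have block e : -1 <= e <= 1 -> `|B e| <=
    1 / (2 * N) * (kappa * \sum_j a j + \sum_i b i).
  (* As [t1 + t2 = 1], the squares have exponents [2 t1 = 1 + gam] and [2 t2 = 1 - gam]. The excess
     powers [a ^ gam] and [b ^ (- gam)] are constant on a level up to the factor [M], because
     [|gam| < 1]. *)
  move=> he; set gam := t1 - t2.
  have gam1 : -1 < gam < 1 by rewrite /gam; lra.
  have lpow (x y z : R) : x <= y -> 0 < z -> z * M `^ x <= z * M `^ y.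
    by move=> xy z0; rewrite ler_wpM2l ?(ltW z0)// ler_powR// ltW.
  have f2 j : f j ^+ 2 <= a j * (M `^ ((la j)%:~R * gam) * M).
    apply: (@le_trans _ _ ((a j `^ t1) ^+ 2)).
      by rewrite -real_normK ?num_real// ler_sqr ?nnegrE ?powR_ge0.
    have [->|an0] := eqVneq (a j) 0.
      by rewrite powR0 ?gt_eqF// expr0n /= mul0r.
    have ap : 0 < a j by rewrite lt_neqAle eq_sym an0 a0.
    have /andP[a1 a2] := levP _ ap.
    have -> : (a j `^ t1) ^+ 2 = a j * a j `^ gam.
      rewrite expr2 -powRDp//.
      rewrite -[X in _ = X * _]powRr1 ?(ltW ap)// -powRDp//.
      by congr (_ `^ _); rewrite /gam; lra.
    rewrite ler_wpM2l ?(ltW ap)//.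
    have [g0|g0] := leP 0 gam.
      apply: (@le_trans _ _ ((M `^ ((la j)%:~R + 1)) `^ gam)).
        by rewrite ge0_ler_powR ?nnegrE ?powR_ge0 ?(ltW ap)// ltW.
      rewrite -powRrM -[X in _ <= _ * X]powRr1 ?(ltW M0)//.
      rewrite -powRDp// ler_powR ?(ltW M1)//.
      by rewrite mulrDl mul1r lerD2l; lra.
    apply: (@le_trans _ _ ((M `^ (la j)%:~R) `^ gam)).
      have -> : gam = - (- gam) by ring.
      rewrite !(powRN _ (- gam)) lef_pV2 ?posrE ?powR_gt0//.
      by rewrite ge0_ler_powR ?nnegrE ?powR_ge0 ?(ltW ap)//; lra.
    by rewrite -powRrM ler_peMr ?powR_ge0// ltW.
  have g2 i : g i ^+ 2 <= b i * (M `^ (- ((lb i)%:~R * gam)) * M).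
    apply: (@le_trans _ _ ((b i `^ t2) ^+ 2)).
      by rewrite -real_normK ?num_real// ler_sqr ?nnegrE ?powR_ge0.
    have [->|bn0] := eqVneq (b i) 0.
      by rewrite powR0 ?gt_eqF// expr0n /= mul0r.
    have bp : 0 < b i by rewrite lt_neqAle eq_sym bn0 b0.
    have /andP[b1 b2] := levP _ bp.
    have -> : (b i `^ t2) ^+ 2 = b i * b i `^ (- gam).
      rewrite expr2 -powRDp//.
      rewrite -[X in _ = X * _]powRr1 ?(ltW bp)// -powRDp//.
      by congr (_ `^ _); rewrite /gam; lra.
    rewrite ler_wpM2l ?(ltW bp)// -mulrN.
    have [g0|g0] := leP 0 (- gam).
      apply: (@le_trans _ _ ((M `^ ((lb i)%:~R + 1)) `^ (- gam))).
        by rewrite ge0_ler_powR ?nnegrE ?powR_ge0 ?(ltW bp)// ltW.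
      rewrite -powRrM -[X in _ <= _ * X]powRr1 ?(ltW M0)//.
      rewrite -powRDp// ler_powR ?(ltW M1)//.
      by rewrite mulrDl mul1r lerD2l; lra.
    apply: (@le_trans _ _ ((M `^ (lb i)%:~R) `^ (- gam))).
      rewrite !(powRN _ gam) lef_pV2 ?posrE ?powR_gt0//.
      by rewrite ge0_ler_powR ?nnegrE ?powR_ge0 ?(ltW bp)//; lra.
    by rewrite -powRrM ler_peMr ?powR_ge0// ltW.
  (* balances the two halves of [2 u v <= y u^2 + v^2 / y] on every level *)
  pose y (k : int) : R := M `^ (k%:~R * gam) * (N ^+ 3 / kappa).
  have y0 k : 0 < y k by rewrite /y mulr_gt0 ?powR_gt0// divr_gt0 ?exprn_gt0.
  pose u j := \sum_(i | lb i + e == la j) T i j * g i.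
  have -> : B e = \sum_j u j * f j.
    by apply: eq_bigr => j _; rewrite /u mulr_suml.
  apply: (@le_trans _ _ (\sum_j (2^-1 * (y (la j) * u j ^+ 2) +
                                2^-1 * (f j ^+ 2 / y (la j))))).
    apply: le_trans (ler_norm_sum _ _ _) _; apply: ler_sum => j _.
    rewrite normrM -mulrDr ler_pdivlMl// .
    have yj := y0 (la j).
    rewrite -(ler_pM2l yj) mulrDr mulrCA [X in _ + X]mulrC divfK ?gt_eqF//.
    have := sqr_ge0 (y (la j) * `|u j| - `|f j|).
    rewrite sqrrB exprMn !real_normK ?num_real//; nra.
  have gram0 : 0 <= kappa / N ^+ 8 by rewrite divr_ge0 ?exprn_ge0 ?(ltW k0) ?(ltW N0).
  (* Origin of the exponent 8: the weight [y] costs [N ^ 3], the bound of [g] and the shift of the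
     level by [e] cost [M = N ^ 2] each, and a factor [1 / N] has to remain. *)
  have h1 : \sum_j y (la j) * u j ^+ 2 <= 1 / N * \sum_i b i.
    apply: (@le_trans _ _ (kappa / N ^+ 8 * \sum_i y (lb i + e) * g i ^+ 2)).
      exact: (@level_block _ g la (fun i => lb i + e) y gram gram0
               (fun k => ltW (y0 k))).
    rewrite mulr_sumr mulr_sumr; apply: ler_sum => i _.
    apply: (@le_trans _ _ (kappa / N ^+ 8 * (y (lb i + e) *
        (b i * (M `^ (- ((lb i)%:~R * gam)) * M))))).
      by rewrite ler_wpM2l// ler_wpM2l ?(ltW (y0 _)).
    have -> : kappa / N ^+ 8 * (y (lb i + e) *
        (b i * (M `^ (- ((lb i)%:~R * gam)) * M))) =
        b i * (N ^- 3 * (M `^ ((lb i + e)%:~R * gam) * M `^ (- ((lb i)%:~R * gam)))).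
      rewrite /y /M; field; rewrite -/M; lra.
    rewrite mulrC ler_wpM2r//.
    rewrite -powRDp//.
    apply: (@le_trans _ _ (N ^- 3 * M)).
      rewrite ler_wpM2l ?invr_ge0 ?exprn_ge0 ?(ltW N0)//.
      rewrite -[leRHS]powRr1 ?(ltW M0)// ler_powR ?(ltW M1)//.
      rewrite intrD mulrDl addrAC subrr add0r.
      have : -1 <= (e%:~R : R) <= 1.
        by rewrite -(ler_int R) -[X in _ && X](ler_int R) in he.
      case/andP => he1 he2; nra.
    by rewrite /M; apply: le_of_eq; field; lra.
  have h2 : \sum_j f j ^+ 2 / y (la j) <= 1 / N * (kappa * \sum_j a j).
    rewrite !mulr_sumr; apply: ler_sum => j _.
    apply: (@le_trans _ _ (a j * (M `^ ((la j)%:~R * gam) * M) / y (la j))).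
      by rewrite ler_wpM2r ?invr_ge0 ?(ltW (y0 _)).
    have := powR_gt0 ((la j)%:~R * gam) M0; rewrite /y.
    move: (M `^ _) => z z0; apply: le_of_eq; rewrite /M; field.
    by rewrite !gt_eqF.
  rewrite big_split -!mulr_sumr /=.
  have -> : 1 / (2 * N) = 2^-1 * (1 / N) by field; lra.
  rewrite -mulrDr -mulrA ler_wpM2l ?invr_ge0//.
  by rewrite [leRHS]mulrDr [leRHS]addrC lerD.
rewrite split_sum.
apply: le_trans (ler_normD _ _) _.
have := block 0 isT; have := block (-1) isT; have := block 1 isT.
move=> bb1 bb2 bb3.
have tri : `|B 0 + B (-1) + B 1| <= `|B 0| + `|B (-1)| + `|B 1|.
  by apply: le_trans (ler_normD _ _) _; rewrite lerD2r ler_normD.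
rewrite /interp_const -/M [leRHS]mulrDl [leRHS]addrC lerD//.
apply: le_trans tri _.
have -> : 3 / (2 * N) = 1 / (2 * N) + 1 / (2 * N) + 1 / (2 * N) by field; lra.
by rewrite 2!mulrDl !lerD.
Qed.

Lemma interp_const_gt0 (N t1 t2 : R) : 1 < N -> 0 < interp_const N t1 t2.
Proof.
move=> N1; rewrite /interp_const.
have h : 0 < 3 / (2 * N) by rewrite divr_gt0//; lra.
have := powR_ge0 (N ^+ 2) (- t2); have := powR_ge0 (N ^+ 2) (- t1); lra.
Qed.

(** Duality: the bilinear bound is tested on the vector [g] that norms [h = T f]. *)
Lemma interpolation_lp (kappa N p : R) (f : J -> R) :
  0 < kappa -> 1 < N -> 1 < p ->
  (forall i, \sum_j `|T i j| <= 1) -> (forall j, \sum_i `|T i j| <= kappa) ->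
  (forall i, \sum_i' `|\sum_j T i j * T i' j| <= kappa / N ^+ 8) ->
  \sum_i `|\sum_j T i j * f j| `^ p <=
  (2 * interp_const N p^-1 (1 - p^-1)) `^ p * (kappa * \sum_j `|f j| `^ p).
Proof.
move=> k0 N1 p1 rowT colT gram.
have p0 : 0 < p by lra.
set K := interp_const _ _ _.
have K0 : 0 < K by exact: interp_const_gt0.
have K20 : 0 < 2 * K by rewrite mulr_gt0.
pose h i := \sum_j T i j * f j.
(* With this scale the contribution of [b] to the bilinear bound is exactly half of the left side,
   and is absorbed there. *)
pose tau := (2 * K) `^ (1 - p).
have tau0 : 0 < tau by rewrite powR_gt0.
pose g i := tau * (Num.sg (h i) * `|h i| `^ (p - 1)).
pose b i := (2 * K) `^ (- p) * `|h i| `^ p.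
have pV : 0 < p^-1 < 1 by rewrite invr_gt0 p0 invf_lt1.
have gh i : g i * h i = tau * `|h i| `^ p.
  rewrite /g -mulrA; congr (_ * _); rewrite mulrAC -normrEsg.
  have [->|hn0] := eqVneq (h i) 0; first by rewrite normr0 mul0r powR0 ?(gt_eqF p0).
  rewrite -[X in X * _]powRr1// -powRD; first by congr (_ `^ _); lra.
  by rewrite normr_eq0 hn0 implybT.
have := @interpolation_bilinear kappa N p^-1 (1 - p^-1) (fun j => `|f j| `^ p) b f g
  k0 N1.
have -> : \sum_i \sum_j T i j * g i * f j = tau * \sum_i `|h i| `^ p.
  rewrite mulr_sumr; apply: eq_bigr => i _; rewrite -gh /h mulr_sumr.
  by apply: eq_bigr => j _; ring.
have S0 : 0 <= \sum_i `|h i| `^ p by apply: sumr_ge0 => i _; exact: powR_ge0.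
rewrite ger0_norm ?mulr_ge0 ?(ltW tau0)//.
move=> H.
have {H} : tau * \sum_i `|h i| `^ p <=
    K * (kappa * \sum_j `|f j| `^ p + \sum_i b i).
  apply: H => //; try lra.
  - by move=> i; rewrite mulr_ge0 ?powR_ge0.
  - by move=> j; rewrite -powRrM mulfV ?gt_eqF// powRr1.
  - move=> i; rewrite /b powRM ?powR_ge0// -!powRrM.
    have -> : - p * (1 - p^-1) = 1 - p by field; lra.
    have -> : p * (1 - p^-1) = p - 1 by field; lra.
    rewrite /g normrM (gtr0_norm tau0) ler_wpM2l ?(ltW tau0)//.
    rewrite normrM [X in _ * X]ger0_norm ?powR_ge0// ler_piMl ?powR_ge0//.
    by rewrite normr_sg lern1 leq_b1.
rewrite -mulr_sumr.
have tauE : tau = (2 * K) * (2 * K) `^ (- p).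
  by rewrite /tau powRDp// powRr1// ltW.
have e1 : (2 * K) `^ p * (2 * K) `^ (- p) = 1.
  by rewrite -powRDp// subrr powRr0.
rewrite tauE; move: e1.
have := powR_gt0 p K20; have := powR_gt0 (- p) K20.
move: ((2 * K) `^ p) ((2 * K) `^ (- p)) => x y y0 x0 xy H.
have yx Z : y * (x * Z) = Z by rewrite mulrA [y * x]mulrC xy mul1r.
rewrite -(ler_pM2l y0) yx.
rewrite -(ler_pM2l K0); move: H; move: (\sum_i _) (kappa * _) => S F; nra.
Qed.

End Interpolation.

(** * Twisted kernels and unipotent averages *)

(* The only property of multipliers that is used before the limit functional is
   built: matrices with a Gram matrix smaller by [eta] than the trivial bound gain
   the factor [eta `^ th]. *)
Definition schur (R : realType) (G : groupType) (th C : R) (psi : G -> R) :=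
  forall (I J : finType) (s : I -> G) (t : J -> G) (T : I -> J -> R)
    (r c eta : R),
  0 < r -> 0 < c -> 0 < eta ->
  (forall i, \sum_j `|T i j| <= r) -> (forall j, \sum_i `|T i j| <= c) ->
  (forall i, \sum_i' `|\sum_j T i j * T i' j| <= eta * (r * c)) ->
  c * #|J|%:R <= 2 * (r * #|I|%:R) ->
  `|\sum_i \sum_j T i j * psi (s i * (t j)^-1)%g| <=
    C * eta `^ th * (r * #|I|%:R).

Section Counting.
Context (R : realType).

Lemma sum_delta_le1 (Y : finType) (Z : eqType) (iota : Y -> Z) (z : Z) :
  injective iota -> \sum_y (iota y == z)%:R <= 1 :> R.
Proof.
move=> inj; case: (pickP (fun y => iota y == z)) => [y0 /eqP <-|no].
  rewrite (bigD1 y0)//= eqxx big1 ?addr0// => y yy0.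
  by rewrite (inj_eq inj) (negPf yy0).
by rewrite big1 ?ler01// => y _; rewrite no.
Qed.

Lemma sum_delta (Y : finType) (Z : eqType) (iota : Y -> Z) (y0 : Y) (f : Y -> R) :
  injective iota -> \sum_y (iota y == iota y0)%:R * f y = f y0.
Proof.
move=> inj; rewrite (bigD1 y0)//= eqxx mul1r big1 ?addr0// => y yy0.
by rewrite (inj_eq inj) (negPf yy0) mul0r.
Qed.

(** This bounds a distance in variation between the images of the counting measure of [K] under
    [phi] and [phi']. Good points cancel against their images under [tau]; as many points lie
    outside the image as there are bad points, whence the factor 2. *)
Lemma law_shift (K B : finType) (Z : eqType) (phi phi' : K -> Z) (iota : B -> Z)
    (good : pred K) (tau : K -> K) :
  injective iota -> {in good &, injective tau} ->
  (forall k, good k -> phi' k = phi (tau k)) ->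
  \sum_b `|\sum_k (iota b == phi k)%:R - \sum_k (iota b == phi' k)%:R| <=
  2 * #|[pred k | ~~ good k]|%:R :> R.
Proof.
move=> iinj tinj e.
pose im := [set tau k | k in good]%SET.
have splitb b : \sum_k (iota b == phi k)%:R - \sum_k (iota b == phi' k)%:R =
    \sum_(k | k \notin im) (iota b == phi k)%:R -
    \sum_(k | ~~ good k) (iota b == phi' k)%:R :> R.
  rewrite (bigID (mem im))/= [X in _ - X](bigID good)/=.
  rewrite big_imset//=.
  rewrite (eq_bigr (fun k => (iota b == phi' k)%:R)) => [|k gk]; first by ring.
  by rewrite e.
have cim : #|[pred k | k \notin im]| = #|[pred k | ~~ good k]|.
  have := cardC good; have := cardC (mem im).
  rewrite card_in_imset// => <-  /eqP; rewrite eqn_add2l => /eqP <-.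
  by apply: eq_card => k; rewrite !inE.
apply: (@le_trans _ _ (\sum_b (\sum_(k | k \notin im) (iota b == phi k)%:R +
    \sum_(k | ~~ good k) (iota b == phi' k)%:R))).
  apply: ler_sum => b _; rewrite splitb; apply: le_trans (ler_normB _ _) _.
  by rewrite !ger0_norm// sumr_ge0.
rewrite big_split/= mulrDl mul1r lerD//.
- rewrite exchange_big/= -[in leRHS]cim -sum1_card natr_sum.
  by apply: ler_sum => k _; exact: sum_delta_le1.
- rewrite exchange_big/= -sum1_card natr_sum.
  by apply: ler_sum => k _; exact: sum_delta_le1.
Qed.

Lemma card_shift_out (n : nat) (k : int) :
  (#|[pred j : 'I_n | ~~ (0 <= j%:Z + k < n%:Z)%R]| <= `|k|)%N.
Proof.
have [->|kn0] := eqVneq k 0.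
  by rewrite eq_card0// => j; rewrite !inE addr0 ltz_nat ltn_ord.
pose K := `|k|.-1.
have eK : `|k|%N = K.+1 by rewrite /K; lia.
rewrite eK -[X in (_ <= X)%N]card_ord.
pose f (j : 'I_n) : 'I_K.+1 :=
  inord (if (k < 0)%R then j : nat else (j + `|k| - n)%N).
apply: (@leq_card_in _ _ f) => i j; rewrite !inE => hi hj.
have := ltn_ord i; have := ltn_ord j => li lj.
move/(congr1 (@nat_of_ord _)); rewrite !inordK.
- move=> h; apply: val_inj => /=; move: h; case: ifP; lia.
- by case: ifP; lia.
- by case: ifP; lia.
Qed.

End Counting.

Section TwistedKernel.
Context (R : realType) (m n n' D B1 B2 : nat).

Let O1 := (D + m * n)%N.
Let O2 := (n' + 2 * n * D + m * n * n)%N.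

Local Notation rowT := ('I_m * ('I_B1 * 'I_B2))%type.
Local Notation colT := ('I_n * ('I_(B1 + O1) * 'I_(B2 + O2)))%type.

(** These are the exponents of [Q] and [P] in [unip_reorder], where [x] tells whether the factor
    [Q ^+ D] is present. [O1] and [O2] bound them, so that the truncated subtractions in [twist_col]
    are exact. *)
Let p1 (x : bool) (i : 'I_m) (j : 'I_n) : nat := (x * D + i * j)%N.
Let p2 (x : bool) (i : 'I_m) (j : 'I_n) (v : 'I_n') : nat :=
  (v + x * (2 * j * D) + i * j ^ 2)%N.

Lemma twist_ltn (b B O k : nat) : (b < B)%N -> (b + O - k < B + O)%N.
Proof. by lia. Qed.

Definition twist_col x (i : 'I_m) (b : 'I_B1 * 'I_B2) (j : 'I_n) (v : 'I_n') :
    'I_(B1 + O1) * 'I_(B2 + O2) :=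
  (Ordinal (twist_ltn O1 (p1 x i j) (ltn_ord b.1)),
   Ordinal (twist_ltn O2 (p2 x i j v) (ltn_ord b.2))).

(* Two translates by [x = 0, 1] times [D] of the same transport, spread by [v]
   along the central direction. For [i != i'] the Gram entries nearly cancel:
   a translation by [D] amounts to a shift of [j] by [D / (i - i')], hence the
   divisibility hypothesis on [D]. *)
Definition twist_ker (ib : rowT) (jy : colT) : R :=
  \sum_(v < n') ((jy.2 == twist_col true ib.1 ib.2 jy.1 v)%:R -
                 (jy.2 == twist_col false ib.1 ib.2 jy.1 v)%:R).

Lemma p1_le x i j : (p1 x i j <= O1)%N.
Proof.
rewrite /p1 /O1; have := ltn_ord i; have := ltn_ord j; case: x => /= hj hi; nia.
Qed.

Lemma p2_le x i j v : (p2 x i j v <= O2)%N.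
Proof.
have h1 : (x * (2 * j * D) <= 2 * n * D)%N.
  case: x => //=; by rewrite mul1n leq_mul2r leq_mul2l (ltnW (ltn_ord j)) !orbT.
have h2 : (i * j ^ 2 <= m * n * n)%N.
  by rewrite -mulnA leq_mul ?(ltnW (ltn_ord i))// leq_mul ?(ltnW (ltn_ord j)).
rewrite /p2 /O2; by apply: leq_add => //; apply: leq_add => //; exact: ltnW.
Qed.

Let iota (b : 'I_B1 * 'I_B2) : int * int := (b.1%:Z, b.2%:Z).

Lemma iota_inj : injective iota.
Proof. by move=> [a b] [a' b'] [] /= /val_inj -> /val_inj ->. Qed.

(** The position [b'] from which row [i'] reaches the same column as row [i] from [b]. It lives in
    pairs of integers, where translations meet no range condition. *)
Let phi x x' i i' (b : 'I_B1 * 'I_B2) (k : 'I_n * 'I_n' * 'I_n') : int * int :=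
  (b.1%:Z - (p1 x i k.1.1)%:Z + (p1 x' i' k.1.1)%:Z,
   b.2%:Z - (p2 x i k.1.1 k.1.2)%:Z + (p2 x' i' k.1.1 k.2)%:Z).

Lemma twist_col_eq x x' i i' (b b' : 'I_B1 * 'I_B2) j v v' :
  (twist_col x i b j v == twist_col x' i' b' j v') =
  (iota b' == phi x x' i i' b (j, v, v')).
Proof.
rewrite /twist_col /iota /phi !xpair_eqE -!val_eqE /=.
have := p1_le x i j; have := p1_le x' i' j.
have := p2_le x i j v; have := p2_le x' i' j v'.
move: (p1 _ _ _) (p1 _ _ _) (p2 _ _ _ _) (p2 _ _ _ _) => a a' c c' h1 h2 h3 h4.
by congr (_ && _); apply/eqP/eqP; lia.
Qed.

Lemma twist_col_inj x i j v : injective (fun b => twist_col x i b j v).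
Proof.
move=> b b' /eqP; rewrite twist_col_eq => /eqP e; apply: iota_inj; rewrite e.
by rewrite /phi /iota /= !subrK.
Qed.

Lemma norm_delta_diff (u v : bool) : `|u%:R - v%:R| <= u%:R + v%:R :> R.
Proof. by apply: le_trans (ler_normB _ _) _; rewrite !normr_nat. Qed.

Lemma twist_ker_le ib jy : `|twist_ker ib jy| <=
  \sum_(v < n') ((jy.2 == twist_col true ib.1 ib.2 jy.1 v)%:R +
                 (jy.2 == twist_col false ib.1 ib.2 jy.1 v)%:R).
Proof.
apply: le_trans (ler_norm_sum _ _ _) _; apply: ler_sum => v _.
exact: norm_delta_diff.
Qed.

Lemma twist_row ib : \sum_jy `|twist_ker ib jy| <= 2 * (n * n')%:R.
Proof.
apply: le_trans (ler_sum _ (fun jy _ => twist_ker_le ib jy)) _.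
rewrite -(pair_bigA _ (fun j y => \sum_(v < n')
  ((y == twist_col true ib.1 ib.2 j v)%:R +
   (y == twist_col false ib.1 ib.2 j v)%:R)))/=.
apply: (@le_trans _ _ (\sum_(j < n) \sum_(v < n') 2)); last first.
  by rewrite !sumr_const !card_ord -mulrnA mulnC mulr_natr.
apply: ler_sum => j _; rewrite exchange_big; apply: ler_sum => v _ /=.
rewrite big_split /=.
by rewrite (_ : 2 = 1 + 1)// lerD//; apply: (@sum_delta_le1 _ _ _ id) => ?.
Qed.

Lemma twist_col_sum (i : 'I_m) jy :
  \sum_b `|twist_ker (i, b) jy| <= 2 * n'%:R.
Proof.
apply: le_trans (ler_sum _ (fun b _ => twist_ker_le (i, b) jy)) _.
rewrite exchange_big /=.
apply: (@le_trans _ _ (\sum_(v < n') 2)); last first.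
  by rewrite sumr_const card_ord mulr_natr.
apply: ler_sum => v _; rewrite big_split /=.
rewrite (_ : 2 = 1 + 1)// lerD//.
- under eq_bigr => b _ do rewrite eq_sym.
  exact: (sum_delta_le1 _ _ (@twist_col_inj true i jy.1 v)).
- under eq_bigr => b _ do rewrite eq_sym.
  exact: (sum_delta_le1 _ _ (@twist_col_inj false i jy.1 v)).
Qed.

Lemma twist_colsum jy : \sum_ib `|twist_ker ib jy| <= 2 * (m * n')%:R.
Proof.
rewrite -(pair_bigA _ (fun i b => `|twist_ker (i, b) jy|))/=.
apply: le_trans (ler_sum _ (fun i _ => twist_col_sum i jy)) _.
by rewrite sumr_const card_ord natrM -[_ *+ m]mulr_natl mulrCA.
Qed.

(** A product of two indicators tells whether two transports meet, so a Gram entry counts the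
    parameters [(j, v, v')] with signs: it is an alternating sum of four laws on the positions
    [b']. *)
Lemma twist_gramE i b i' b' :
  \sum_jy twist_ker (i, b) jy * twist_ker (i', b') jy =
  \sum_k ((iota b' == phi true true i i' b k)%:R
        - (iota b' == phi true false i i' b k)%:R
        - (iota b' == phi false true i i' b k)%:R
        + (iota b' == phi false false i i' b k)%:R).
Proof.
rewrite -(pair_bigA _ (fun j y => twist_ker (i, b) (j, y) * twist_ker (i', b') (j, y)))/=.
rewrite -(pair_bigA _ (fun jv v' =>
  ((iota b' == phi true true i i' b (jv, v'))%:R
        - (iota b' == phi true false i i' b (jv, v'))%:R
        - (iota b' == phi false true i i' b (jv, v'))%:R
        + (iota b' == phi false false i i' b (jv, v'))%:R)))/=.
rewrite -(pair_bigA _ (fun j v => \sum_v'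
  ((iota b' == phi true true i i' b (j, v, v'))%:R
        - (iota b' == phi true false i i' b (j, v, v'))%:R
        - (iota b' == phi false true i i' b (j, v, v'))%:R
        + (iota b' == phi false false i i' b (j, v, v'))%:R)))/=.
apply: eq_bigr => j _; rewrite /twist_ker /=.
under eq_bigr => y _ do rewrite mulr_suml.
rewrite exchange_big; apply: eq_bigr => v _ /=.
under eq_bigr => y _ do rewrite mulr_sumr.
rewrite exchange_big; apply: eq_bigr => v' _ /=.
have s x x' : \sum_y (y == twist_col x i b j v)%:R *
    (y == twist_col x' i' b' j v')%:R =
    (iota b' == phi x x' i i' b (j, v, v'))%:R :> R.
  by rewrite -twist_col_eq (@sum_delta _ _ _ id _ (fun y => (y == _)%:R)).
rewrite -!s -!sumrB -big_split /=; apply: eq_bigr => y _; ring.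
Qed.

(** The shift leaves the range for at most [|kk|] values of [j] and [|l|] values of [v]; the bound
    counts the parameters lost in this way. *)
Lemma twist_law_shift (kk l : int) (i i' : 'I_m) (b : 'I_B1 * 'I_B2)
    (psi : 'I_n * 'I_n' * 'I_n' -> int * int) :
  (forall (j j2 : 'I_n) (v v2 v' : 'I_n'), j2%:Z = j%:Z + kk ->
     v2%:Z = v%:Z - l -> psi (j, v, v') = phi false false i i' b (j2, v2, v')) ->
  \sum_b' `|\sum_k (iota b' == phi false false i i' b k)%:R -
            \sum_k (iota b' == psi k)%:R| <=
  2 * (`|kk| * n' ^ 2 + n * `|l| * n')%:R :> R.
Proof.
move=> h.
pose gj (j : 'I_n) := (0 <= j%:Z + kk < n%:Z)%R.
pose gv (v : 'I_n') := (0 <= v%:Z - l < n'%:Z)%R.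
pose good (k : 'I_n * 'I_n' * 'I_n') := gj k.1.1 && gv k.1.2.
pose tau (k : 'I_n * 'I_n' * 'I_n') : 'I_n * 'I_n' * 'I_n' :=
  ((insubd k.1.1 (absz (k.1.1%:Z + kk)), insubd k.1.2 (absz (k.1.2%:Z - l))), k.2).
have tau1 j : gj j -> (insubd j (absz (j%:Z + kk)) : 'I_n)%:Z = j%:Z + kk.
  by move=> g; rewrite val_insubd ifT; move: g; rewrite /gj; lia.
have tau2 v : gv v -> (insubd v (absz (v%:Z - l)) : 'I_n')%:Z = v%:Z - l.
  by move=> g; rewrite val_insubd ifT; move: g; rewrite /gv; lia.
apply: le_trans (law_shift (good := good) (tau := tau) _ _ _ _) _.
- exact: iota_inj.
- move=> [[j v] w] [[j' v'] w'] /andP[/= g1 g2] /andP[/= g1' g2'].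
  case=> /(congr1 (fun x : 'I_n => x%:Z)); rewrite tau1// tau1// => e1.
  move=> /(congr1 (fun x : 'I_n' => x%:Z)); rewrite tau2// tau2// => e2 ->.
  have -> : j = j' by apply: val_inj => /=; lia.
  by have -> : v = v' by apply: val_inj => /=; lia.
- move=> [[j v] w] /andP[/= g1 g2]; apply: h; [exact: tau1|exact: tau2].
rewrite ler_wpM2l// ler_nat.
pose b1 := [pred j | ~~ gj j]; pose b2 := [pred v | ~~ gv v].
pose U := [predX [predX b1 & 'I_n'] & 'I_n'].
pose W := [predX [predX 'I_n & b2] & 'I_n'].
have -> : #|[pred k | ~~ good k]| = #|[predU U & W]|.
  apply: eq_card => -[[j v] w]; rewrite !inE /=.
  by rewrite /good /= negb_and !andbT.
apply: (@leq_trans (#|U| + #|W|)%N); first by rewrite -cardUI leq_addr.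
rewrite !cardX /= !card_ord.
have h1 : (#|b1| <= `|kk|)%N by exact: card_shift_out.
have h2 : (#|b2| <= `|l|)%N.
  apply: leq_trans (card_shift_out n' (- l)) _; by rewrite abszN.
rewrite expnS expn1 mulnA.
by apply: leq_add; rewrite leq_mul2r ?leq_mul2l ?leq_mul2r ?h1 ?h2 !orbT.
Qed.

Hypothesis dvdD : forall i, (0 < i < m)%N -> (i %| D)%N.

(** Let [kk = D / (i - i')]. Since [(i - i') (2 j kk + kk ^ 2) = 2 j D + kk D], shifting [j] by [kk]
    reproduces both displacements [D] and [2 j D] of the translated transport, except for the
    constant [kk D], which a shift of [v] compensates. The four laws agree up to boundary effects,
    and their signs cancel. *)
Lemma twist_gram_off (i i' : 'I_m) b : i != i' ->
  \sum_b' `|\sum_jy twist_ker (i, b) jy * twist_ker (i', b') jy| <=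
  4 * (D * n' ^ 2 + n * D ^ 2 * n')%:R :> R.
Proof.
move=> ii'.
have [kk [kkD kkle]] : exists kk : int,
    D%:Z = kk * (i%:Z - i'%:Z) /\ (`|kk| <= D)%N.
  have dle d q : (0 < d)%N -> D = (q * d)%N -> (q <= D)%N.
    by move=> d0 ->; rewrite leq_pmulr.
  case: (ltngtP i i') => [lt|lt|/val_inj e]; last by rewrite e eqxx in ii'.
  - have /dvdnP[q qD] : (i' - i %| D)%N.
      by apply: dvdD; rewrite subn_gt0 lt /= (leq_ltn_trans (leq_subr _ _)).
    exists (- q%:Z); split; last by rewrite abszN /= (dle (i' - i)%N)// subn_gt0.
    by rewrite [LHS](congr1 Posz qD) PoszM -subzn ?(ltnW lt)// mulNr -mulrN opprB.
  - have /dvdnP[q qD] : (i - i' %| D)%N.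
      by apply: dvdD; rewrite subn_gt0 lt /= (leq_ltn_trans (leq_subr _ _)).
    exists q%:Z; split; last by rewrite /= (dle (i - i')%N)// subn_gt0.
    by rewrite [LHS](congr1 Posz qD) PoszM -subzn ?(ltnW lt).
(* Translating both rows changes nothing, so it remains to compare each of the two mixed laws with
   the untranslated one. *)
have e11 b' k : (iota b' == phi true true i i' b k) =
    (iota b' == phi false false i i' b k).
  congr (_ == _); rewrite /phi /p1 /p2 !mul1n !mul0n !add0n !addn0.
  by congr (_, _); rewrite !PoszD; ring.
have sh kk' psi : `|kk'|%N = `|kk|%N -> (forall (j j2 : 'I_n) (v v2 v' : 'I_n'),
     j2%:Z = j%:Z + kk' -> v2%:Z = v%:Z - kk * D%:Z ->
     psi (j, v, v') = phi false false i i' b (j2, v2, v')) ->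
    \sum_b' `|\sum_k (iota b' == phi false false i i' b k)%:R -
              \sum_k (iota b' == psi k)%:R| <=
    2 * (D * n' ^ 2 + n * D ^ 2 * n')%:R :> R.
  move=> ekk h; apply: le_trans (twist_law_shift h) _.
  rewrite ler_wpM2l// ler_nat ekk abszM /=.
  by apply: leq_add; rewrite leq_mul// leq_mul// expnS expn1 leq_mul.
have h1 := @sh kk (phi true false i i' b) erefl.
have h2 := @sh (- kk) (phi false true i i' b) (abszN _).
apply: (@le_trans _ _ (2 * (D * n' ^ 2 + n * D ^ 2 * n')%:R +
                       2 * (D * n' ^ 2 + n * D ^ 2 * n')%:R)); last first.
  by apply: le_of_eq; rewrite -mulrDl -natrD.
apply: le_trans (lerD (h1 _) (h2 _)).
- rewrite -big_split; apply: ler_sum => b' _ /=.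
  apply: le_trans (ler_normD _ _); apply: le_of_eq.
  rewrite twist_gramE -!sumrB -big_split; congr (`|_|); apply: eq_bigr => k _ /=.
  by rewrite e11; ring.
- move=> j j2 v v2 v' ej ev; rewrite /phi /p1 /p2 /= !mul1n !mul0n !add0n !addn0.
  by rewrite -!mulnn !PoszD !PoszM ej ev kkD; congr (_, _); ring.
- move=> j j2 v v2 v' ej ev; rewrite /phi /p1 /p2 /= !mul1n !mul0n !add0n !addn0.
  by rewrite -!mulnn !PoszD !PoszM ej ev kkD; congr (_, _); ring.
Qed.

(** [1 / m] is the share of the pairs with [i = i'], where nothing cancels. The other two terms are
    the proportions of [j] and of [v] lost to shifts by at most [D] and [D ^ 2]. *)
Definition twist_eta : R := m%:R^-1 + D%:R / n%:R + (D ^ 2)%:R / n'%:R.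

Hypotheses (m0 : (0 < m)%N) (n0 : (0 < n)%N) (n'0 : (0 < n')%N).

Lemma twist_gram ib :
  \sum_ib' `|\sum_jy twist_ker ib jy * twist_ker ib' jy| <=
  twist_eta * (2 * (n * n')%:R * (2 * (m * n')%:R)).
Proof.
case: ib => i b.
rewrite -(pair_bigA _ (fun i' b' => `|\sum_jy twist_ker (i, b) jy * twist_ker (i', b') jy|))/=.
rewrite (bigD1 i)//=.
have diag : \sum_b' `|\sum_jy twist_ker (i, b) jy * twist_ker (i, b') jy| <=
    4 * (n * n' ^ 2)%:R.
  apply: (@le_trans _ _ (\sum_jy `|twist_ker (i, b) jy| * (2 * n'%:R))).
    apply: (@le_trans _ _ (\sum_b' \sum_jy `|twist_ker (i, b) jy| *
        `|twist_ker (i, b') jy|)).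
      apply: ler_sum => b' _; apply: le_trans (ler_norm_sum _ _ _) _.
      by apply: ler_sum => jy _; rewrite normrM.
    rewrite exchange_big; apply: ler_sum => jy _ /=; rewrite -mulr_sumr.
    by rewrite ler_wpM2l// twist_col_sum.
  rewrite -mulr_suml; apply: (@le_trans _ _ (2 * (n * n')%:R * (2 * n'%:R))).
    by rewrite ler_wpM2r ?mulr_ge0// twist_row.
  by apply: le_of_eq; rewrite -mulnn !natrM; ring.
apply: (@le_trans _ _ (4 * (n * n' ^ 2)%:R +
    \sum_(i' < m) 4 * (D * n' ^ 2 + n * D ^ 2 * n')%:R)).
  rewrite lerD//.
  apply: (@le_trans _ _ (\sum_(i' | i' != i) 4 * (D * n' ^ 2 + n * D ^ 2 * n')%:R)).
    by apply: ler_sum => i' ni; apply: twist_gram_off; rewrite eq_sym.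
  by rewrite [leRHS](bigD1 i)//= lerDr mulr_ge0.
rewrite sumr_const card_ord -mulr_natr; apply: le_of_eq.
rewrite /twist_eta -!mulnn !natrD !natrM.
by field; rewrite !pnatr_eq0 -!lt0n m0 n0 n'0.
Qed.

End TwistedKernel.

Section UnipotentAverages.
Context (R : realType) (G : groupType).
Implicit Types (F P Q L w : G).
Local Open Scope group_scope.

Variables F P Q L : G.
Hypotheses (FL : F * L = L * Q * P * F) (FQ : F * Q = Q * (P * P) * F).
Hypotheses (PF : commute P F) (PQ : commute P Q) (PL : commute P L).
Hypothesis (QL : commute Q L).

Lemma unip_FX_QX j u : F ^+ j * Q ^+ u = Q ^+ u * P ^+ (2 * j * u)%N * F ^+ j.
Proof.
have F1 v : F * Q ^+ v = Q ^+ v * P ^+ (2 * v)%N * F.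
  elim: v => [|v IH]; first by rewrite muln0 !expg0 !mul1g mulg1.
  rewrite expgS mulgA FQ -!mulgA IH.
  rewrite (_ : (2 * v.+1 = (2 * v).+2)%N); last by lia.
  rewrite !(expgS P) -!mulgA; congr (_ * _).
  have c := commuteX v PQ.
  by rewrite (mulgA P (Q ^+ v)) c -mulgA (mulgA P (Q ^+ v)) c -mulgA.
elim: j => [|j IH]; first by rewrite muln0 mul0n !expg0 mul1g !mulg1.
rewrite expgS -mulgA IH !mulgA F1.
rewrite (_ : (2 * j.+1 * u = 2 * u + 2 * j * u)%N); last by lia.
move: (2 * u)%N (2 * j * u)%N => a b.
rewrite (expgnDr P a b) -!mulgA; congr (_ * (_ * _)).
by rewrite !mulgA (commuteX b (commute_sym PF)).
Qed.

(** The quadratic exponent builds up as [(j + 1) ^ 2 = j ^ 2 + 2 j + 1]: the next [F] has to cross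
    the [Q ^+ (i * j)] already produced, which creates [2 i j] factors [P]. *)
Lemma unip_FX_LX j i :
  F ^+ j * L ^+ i = L ^+ i * Q ^+ (i * j)%N * P ^+ (i * j ^ 2)%N * F ^+ j.
Proof.
have F1 v : F * L ^+ v = L ^+ v * Q ^+ v * P ^+ v * F.
  elim: v => [|v IH]; first by rewrite !expg0 !mul1g mulg1.
  rewrite expgS mulgA FL -!mulgA IH !expgS -!mulgA; congr (_ * _).
  have e1 : P * (L ^+ v * (Q ^+ v * (P ^+ v * F))) =
            L ^+ v * (Q ^+ v * (P * (P ^+ v * F))).
    rewrite (mulgA P) (commuteX v PL) -!mulgA; congr (_ * _).
    by rewrite (mulgA P) (commuteX v PQ) -!mulgA.
  by rewrite e1 (mulgA Q) (commuteX v QL) -!mulgA.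
elim: j => [|j IH]; first by rewrite exp0n// !muln0 !expg0 mul1g !mulg1.
rewrite expgS -mulgA IH !mulgA F1.
rewrite (_ : (i * j.+1 = i + i * j)%N); last by lia.
rewrite (_ : (i * j.+1 ^ 2 = i + (2 * 1 * (i * j) + i * j ^ 2))%N); last by lia.
have := unip_FX_QX 1 (i * j)%N; rewrite !expg1.
move: (i * j)%N (2 * 1 * (i * j))%N (i * j ^ 2)%N => a b c FQa.
rewrite -!mulgA (mulgA F) FQa.
rewrite (expgnDr Q i a) (expgnDr P i) (expgnDr P b c) -!mulgA.
congr (_ * (_ * _)).
rewrite (mulgA (P ^+ i)) (commuteX2 i a PQ) -!mulgA.
congr (_ * (_ * (_ * _))).
by rewrite !mulgA (commuteX c (commute_sym PF)).
Qed.

(** The left side is the order in which a row times the inverse of a column of the kernel comes out;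
    the right side is the word whose mean is wanted. *)
Lemma unip_reorder i j v D :
  L ^+ i * Q ^+ (D + i * j)%N * P ^+ (v + 2 * j * D + i * j ^ 2)%N * F ^+ j =
  F ^+ j * P ^+ v * Q ^+ D * L ^+ i.
Proof.
have -> : F ^+ j * P ^+ v * Q ^+ D * L ^+ i =
    P ^+ v * (F ^+ j * Q ^+ D) * L ^+ i.
  by rewrite (commuteX2 j v (commute_sym PF)) -!mulgA.
rewrite unip_FX_QX -!mulgA unip_FX_LX.
move: (i * j)%N (2 * j * D)%N (i * j ^ 2)%N => a b c.
rewrite (expgnDr Q D a) (expgnDr P (v + b)%N c) (expgnDr P v b).
have LQ := commuteX2 D i QL; have PQvD := commuteX2 v D PQ.
have e1 : P ^+ b * (L ^+ i * Q ^+ a * P ^+ c * F ^+ j) =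
    L ^+ i * (Q ^+ a * (P ^+ b * (P ^+ c * F ^+ j))).
  rewrite -!mulgA (mulgA (P ^+ b)) (commuteX2 b i PL) -!mulgA; congr (_ * _).
  by rewrite (mulgA (P ^+ b)) (commuteX2 b a PQ) -!mulgA.
rewrite e1.
have e2 z : P ^+ v * (Q ^+ D * (L ^+ i * (Q ^+ a * z))) =
    L ^+ i * (Q ^+ D * (Q ^+ a * (P ^+ v * z))).
  rewrite (mulgA (Q ^+ D)) LQ -!mulgA (mulgA (P ^+ v)) (commuteX2 v i PL).
  rewrite -!mulgA; congr (_ * _).
  rewrite (mulgA (P ^+ v)) PQvD -!mulgA; congr (_ * _).
  by rewrite (mulgA (P ^+ v)) (commuteX2 v a PQ) -!mulgA.
by rewrite e2 -!mulgA.
Qed.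

(** At a column reached from row [(i, b)], the element [s t^-1] does not depend on [b] any more.
    Summing [twist_ker] against [psi] thus gives the wanted sum [B1 * B2] times, and [schur] bounds
    it. *)
Lemma unip_average (th C : R) (psi : G -> R) (w : G) (m n n' D : nat) :
  (0 < m)%N -> (0 < n)%N -> (0 < n')%N ->
  (forall i, (0 < i < m)%N -> (i %| D)%N) -> schur th C psi ->
  (`|\sum_(i < m) \sum_(j < n) \sum_(v < n')
      (psi (w * (F ^+ j * P ^+ v * Q ^+ D * L ^+ i))%g -
       psi (w * (F ^+ j * P ^+ v * L ^+ i))%g)|
   <= 2 * C * twist_eta R m n n' D `^ th * (m * n * n')%:R)%R.
Proof.
move=> m0 n0 n'0 dvdD sch.
set O1 := (D + m * n)%N.
set O2 := (n' + 2 * n * D + m * n * n)%N.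
(* Columns need a margin [O] beyond the rows in both directions. With [B = 3 O] this enlarges the
   box by [(4 / 3) ^ 2 = 16 / 9], within the factor 2 that [schur] allows. *)
pose B1 := (3 * O1)%N; pose B2 := (3 * O2)%N.
have O10 : (0 < O1)%N by rewrite addn_gt0 muln_gt0 m0 n0 orbT.
have O20 : (0 < O2)%N by rewrite !addn_gt0 n'0.
pose I := ('I_m * ('I_B1 * 'I_B2))%type.
pose J := ('I_n * ('I_(B1 + O1) * 'I_(B2 + O2)))%type.
pose s (ib : I) := w * (L ^+ ib.1 * Q ^+ (ib.2.1 + O1)%N * P ^+ (ib.2.2 + O2)%N).
pose t (jy : J) := (F ^+ jy.1)^-1 * (Q ^+ jy.2.1 * P ^+ jy.2.2).
have nR k : (0 < k)%N -> (0 < k%:R :> R)%R by rewrite ltr0n.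
have r0 : (0 < 2 * (n * n')%:R :> R)%R by rewrite mulr_gt0// nR// muln_gt0 n0.
have c0 : (0 < 2 * (m * n')%:R :> R)%R by rewrite mulr_gt0// nR// muln_gt0 m0.
have eta0 : (0 < twist_eta R m n n' D)%R.
  by rewrite /twist_eta -addrA ltr_wpDr ?invr_gt0 ?nR// addr_ge0 ?divr_ge0.
have := sch I J s t (@twist_ker R m n n' D B1 B2) _ _ _ r0 c0 eta0
  (@twist_row R m n n' D B1 B2) (@twist_colsum R m n n' D B1 B2)
  (@twist_gram R m n n' D B1 B2 dvdD m0 n0 n'0).
have cardI : #|{: I}| = (m * (B1 * B2))%N by rewrite !card_prod !card_ord.
have cardJ : #|{: J}| = (n * ((B1 + O1) * (B2 + O2)))%N.
  by rewrite !card_prod !card_ord.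
rewrite cardI cardJ => /(_ _).
have st i b j v x : s (i, b) * (t (j, twist_col D x i b j v))^-1 =
    w * (F ^+ j * P ^+ v * Q ^+ (x * D)%N * L ^+ i).
  rewrite /s /t -unip_reorder invgM invgM invgK /= -!mulgA; congr (w * (_ * _)).
  set p1 := (x * D + i * j)%N; set p2 := (v + x * (2 * j * D) + i * j ^ 2)%N.
  rewrite (_ : v + 2 * j * (x * D) + i * j ^ 2 = p2)%N; last by rewrite /p2; lia.
  have h1 : (p1 <= O1)%N := @p1_le m n n' D x i j.
  have h2 : (p2 <= O2)%N := @p2_le m n n' D x i j v.
  have l1 : (p1 <= b.1 + O1)%N := leq_trans h1 (leq_addl _ _).
  have l2 : (p2 <= b.2 + O2)%N := leq_trans h2 (leq_addl _ _).
  rewrite -{1}(subnKC l1) -{1}(subnKC l2).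
  move: (b.1 + O1 - p1)%N (b.2 + O2 - p2)%N => y1 y2.
  rewrite (expgnDr Q p1 y1) (expgnDr P p2 y2) -!mulgA; congr (_ * _).
  have PQpy := commuteX2 p2 y1 PQ.
  rewrite (mulgA (Q ^+ y1)) -PQpy -!mulgA; congr (_ * _).
  by rewrite !mulVKg.
have Bnn : (0 < B1 * B2)%N by rewrite /B1 /B2 !muln_gt0 O10 O20.
have step : (\sum_(ib : I) \sum_(jy : J) twist_ker R ib jy *
    psi (s ib * (t jy)^-1)%g =
  (B1 * B2)%:R * \sum_(i < m) \sum_(j < n) \sum_(v < n')
      (psi (w * (F ^+ j * P ^+ v * Q ^+ D * L ^+ i))%g -
       psi (w * (F ^+ j * P ^+ v * L ^+ i))%g))%R.
  rewrite -(pair_bigA _ (fun i b => \sum_(jy : J) twist_ker R (i, b) jy *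
    psi (s (i, b) * (t jy)^-1)%g)%R)/= mulr_sumr; apply: eq_bigr => i _.
  rewrite (eq_bigr (fun=> \sum_(j < n) \sum_(v < n')
      (psi (w * (F ^+ j * P ^+ v * Q ^+ D * L ^+ i))%g -
       psi (w * (F ^+ j * P ^+ v * L ^+ i))%g))%R); last first.
    move=> b _; rewrite -(pair_bigA _ (fun j y => twist_ker R (i, b) (j, y) *
      psi (s (i, b) * (t (j, y))^-1)%g)%R)/=; apply: eq_bigr => j _.
    rewrite /twist_ker /=.
    under eq_bigr => y _ do rewrite mulr_suml.
    rewrite exchange_big; apply: eq_bigr => v _ /=.
    under eq_bigr => y _ do rewrite mulrBl.
    rewrite sumrB /=.
    rewrite (@sum_delta _ _ _ id _ (fun y => psi (s (i, b) * (t (j, y))^-1)%g))//.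
    rewrite (@sum_delta _ _ _ id _ (fun y => psi (s (i, b) * (t (j, y))^-1)%g))//.
    by rewrite !st mul1n mul0n expg0 mulg1.
  by rewrite sumr_const card_prod !card_ord mulr_natl.
rewrite step => H.
have {H} : ((B1 * B2)%:R * `|\sum_(i < m) \sum_(j < n) \sum_(v < n')
      (psi (w * (F ^+ j * P ^+ v * Q ^+ D * L ^+ i))%g -
       psi (w * (F ^+ j * P ^+ v * L ^+ i))%g)| <=
  C * twist_eta R m n n' D `^ th * (2 * (n * n')%:R * (m * (B1 * B2))%:R))%R.
  rewrite -[X in (X * _ <= _)%R]normr_nat -normrM; apply: H.
  have -> : (B1 + O1 = 4 * O1)%N by rewrite /B1; lia.
  have -> : (B2 + O2 = 4 * O2)%N by rewrite /B2; lia.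
  rewrite /B1 /B2 -!natrM ler_nat.
  by move: (O1) (O2) => a b; clear; nia.
move=> H; rewrite -(ler_pM2l (nR _ Bnn)); apply: le_trans H _.
by apply: le_of_eq; rewrite !natrM; ring.
Qed.

End UnipotentAverages.

(** * Averages over one-parameter groups *)

Section RiemannAverages.
Context (R : realType).
Implicit Types (f g : R -> R) (N : R).

Lemma cauchy_real_cvg (u : nat -> R) :
  (forall e : R, 0 < e ->
     exists n, forall m, (n <= m)%N -> `|u n - u m| <= e) ->
  cvg (u @ \oo).
Proof.
move=> h; apply/cauchy_cvgP/cauchyP => e e0.
have [|n hn] := h (e / 2); first by rewrite divr_gt0.
exists (u n), n => // m /= nm; rewrite /ball /=.
by apply: le_lt_trans (hn m nm) _; rewrite ltr_pdivrMr// ltr_pMr// ltr1n.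
Qed.

Lemma limr_dist_le (u : nat -> R) (x c : R) : cvg (u @ \oo) ->
  (\forall n \near \oo, `|u n - x| <= c) -> `|lim (u @ \oo) - x| <= c.
Proof.
move=> cu h; rewrite ler_distl; apply/andP; split.
- apply: limr_ge => //; apply: filterS h => n.
  by rewrite ler_distl => /andP[].
- apply: limr_le => //; apply: filterS h => n.
  by rewrite ler_distl => /andP[].
Qed.

Definition riemann_sum (n : nat) N f : R :=
  n%:R^-1 * \sum_(0 <= j < n) f (j%:R * (N / n%:R)).

(* [N^-1] times the integral of [f] over [[0, N]], by dyadic Riemann sums *)
Definition average N f : R := lim (riemann_sum (2 ^ k) N f @[k --> \oo]).

Definition oscillation (d e : R) f :=
  forall x h, 0 <= h <= d -> `|f (x + h) - f x| <= e.

Definition unif_cont f :=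
  forall e, 0 < e -> exists2 d, 0 < d & oscillation d e f.

Lemma riemann_sum_const (n : nat) N c :
  (0 < n)%N -> riemann_sum n N (fun=> c) = c.
Proof.
move=> n0; rewrite /riemann_sum sumr_const_nat subn0 -(mulr_natl c) mulKf//.
by rewrite pnatr_eq0 -lt0n.
Qed.

Lemma riemann_sum_dist (n : nat) N f g c : (0 < n)%N ->
  (forall j, (j < n)%N -> `|f (j%:R * (N / n%:R)) - g (j%:R * (N / n%:R))| <= c) ->
  `|riemann_sum n N f - riemann_sum n N g| <= c.
Proof.
move=> n0 h; rewrite /riemann_sum -mulrBr -sumrB normrM ger0_norm ?invr_ge0//.
rewrite ler_pdivrMl ?ltr0n//; apply: le_trans (ler_norm_sum _ _ _) _.
rewrite mulr_natl -[X in _ <= _ *+ X](subn0 n) -sumr_const_nat.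
by apply: ler_sum_nat => j /andP[_ jn]; exact: h.
Qed.

Lemma riemann_sum_mul (n l : nat) N f : (0 < n)%N -> (0 < l)%N ->
  riemann_sum (n * l) N f =
  riemann_sum n N (fun x => riemann_sum l (N / n%:R) (fun y => f (x + y))).
Proof.
move=> n0 l0; have nR : n%:R != 0 :> R by rewrite pnatr_eq0 -lt0n.
have lR : l%:R != 0 :> R by rewrite pnatr_eq0 -lt0n.
rewrite /riemann_sum big_nat_mul -mulr_sumr mulrA natrM invfM.
congr (_ * _); apply: eq_bigr => i _.
rewrite -{1}[(i * l)%N]add0n big_addn mulSn addnK.
apply: eq_big_nat => j _; congr f.
by rewrite natrD natrM; field; rewrite nR lR.
Qed.

Lemma riemann_sum_refine (n l : nat) N f e : 0 <= N -> (0 < n)%N -> (0 < l)%N ->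
  oscillation (N / n%:R) e f ->
  `|riemann_sum (n * l) N f - riemann_sum n N f| <= e.
Proof.
move=> N0 n0 l0 osc; rewrite riemann_sum_mul//; apply: riemann_sum_dist => // j jn.
move: (j%:R * _) => x.
have -> : f x = riemann_sum l (N / n%:R) (fun=> f x).
  by rewrite riemann_sum_const.
apply: riemann_sum_dist => // k kl; apply: osc.
have nR : 0 < n%:R :> R by rewrite ltr0n.
have lR : 0 < l%:R :> R by rewrite ltr0n.
rewrite mulr_ge0 ?divr_ge0//= mulrA ler_pdivrMr// mulrC ler_wpM2l ?divr_ge0//.
by rewrite ler_nat ltnW.
Qed.

Lemma oscillationW d d' e f : d' <= d -> oscillation d e f -> oscillation d' e f.
Proof.
by move=> dd h x y /andP[y0 yd]; apply: h; rewrite y0 (le_trans yd).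
Qed.

Lemma unif_cont_mesh N f e : 0 <= N -> unif_cont f -> 0 < e ->
  exists n0 : nat, forall n : nat, (n0 <= n)%N -> (0 < n)%N ->
    oscillation (N / n%:R) e f.
Proof.
move=> N0 uf e0; have [d d0 osc] := uf _ e0.
exists (Num.truncn (N / d)).+1 => n n0n n0; apply: oscillationW osc.
rewrite ler_pdivrMr ?ltr0n// mulrC -ler_pdivrMr//.
apply: ltW (lt_le_trans (truncnS_gt _) _).
by rewrite ler_nat.
Qed.

Lemma average_cvg N f : 0 <= N -> unif_cont f ->
  cvg (riemann_sum (2 ^ k) N f @[k --> \oo]).
Proof.
move=> N0 uf; apply: cauchy_real_cvg => e e0.
have [n0 h] := unif_cont_mesh N0 uf e0.
exists n0 => m n0m; rewrite distrC -(subnKC n0m) expnD.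
apply: riemann_sum_refine; rewrite ?expn_gt0//; apply: h; rewrite ?expn_gt0//.
exact/ltnW/ltn_expl.
Qed.

(** The sums of orders [n] and [2 ^ k] are compared through that of order [n * 2 ^ k], which refines
    both. *)
Lemma average_riemann (n : nat) N f e : 0 <= N -> (0 < n)%N -> unif_cont f ->
  oscillation (N / n%:R) e f -> `|average N f - riemann_sum n N f| <= e.
Proof.
move=> N0 n0 uf osc; apply/ler_addgt0Pr => e' e'0.
apply: limr_dist_le; first exact: average_cvg.
have [n1 h] := unif_cont_mesh N0 uf e'0.
near=> k.
have p2 : (0 < 2 ^ k)%N by rewrite expn_gt0.
have := @riemann_sum_refine n (2 ^ k) N f e N0 n0 p2 osc.
have := @riemann_sum_refine (2 ^ k) n N f e' N0 p2 n0.
rewrite mulnC => /(_ _) h1 h2.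
apply: le_trans (ler_distD (riemann_sum (n * 2 ^ k) N f) _ _) _.
rewrite addrC lerD// distrC; apply: h1; apply: h => //.
apply: leq_trans (ltnW (ltn_expl k _)) => //.
by near: k; exists n1.
Unshelve. all: by end_near. Qed.

Lemma average_dist N f g c : 0 <= N -> unif_cont f -> unif_cont g ->
  (forall x, 0 <= x <= N -> `|f x - g x| <= c) -> `|average N f - average N g| <= c.
Proof.
move=> N0 uf ug h; apply/ler_addgt0Pr => e e0.
have e20 : 0 < e / 2 by rewrite divr_gt0.
have [n1 h1] := unif_cont_mesh N0 uf e20.
have [n2 h2] := unif_cont_mesh N0 ug e20.
pose n := (n1 + n2).+1.
have a1 : `|average N f - riemann_sum n N f| <= e / 2.
  by apply: average_riemann => //; apply: h1 => //; rewrite /n -addnS leq_addr.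
have a2 : `|average N g - riemann_sum n N g| <= e / 2.
  by apply: average_riemann => //; apply: h2 => //; rewrite /n -addSn leq_addl.
have a3 : `|riemann_sum n N f - riemann_sum n N g| <= c.
  apply: riemann_sum_dist => // j jn; apply: h.
  have n0 : 0 < n%:R :> R by rewrite ltr0n.
  rewrite mulr_ge0 ?divr_ge0//= mulrA ler_pdivrMr// mulrC ler_wpM2l//.
  by rewrite ler_nat ltnW.
rewrite distrC in a2.
apply: le_trans (ler_distD (riemann_sum n N f) _ _) _.
apply: le_trans (lerD a1 (ler_distD (riemann_sum n N g) _ _)) _.
by move: a2 a3; lra.
Qed.

Lemma average_const N c : average N (fun=> c) = c.
Proof.
apply: (@lim_near_cst _ _ _ _ _ c) => //; near=> k.
by rewrite riemann_sum_const// expn_gt0.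
Unshelve. all: by end_near. Qed.

Lemma average_lin N (a : R) f g : 0 <= N -> unif_cont f -> unif_cont g ->
  average N (fun x => a * f x + g x) = a * average N f + average N g.
Proof.
move=> N0 uf ug; apply: cvg_lim => //.
have -> : (fun k => riemann_sum (2 ^ k) N (fun x => a * f x + g x)) =
    (fun k => a * riemann_sum (2 ^ k) N f + riemann_sum (2 ^ k) N g).
  apply/funext => k; rewrite /riemann_sum big_split -mulr_sumr mulrDr.
  by rewrite mulrCA.
by apply: cvgD; [apply: cvgMr|]; exact: average_cvg.
Qed.

Lemma average_tail (N n : nat) (B e : R) f : (0 < N)%N -> unif_cont f ->
  0 <= e -> (forall x, 0 <= x -> `|f x| <= B) ->
  (forall x, n%:R < x -> `|f x| <= e) ->
  `|average N%:R f| <= e + B * (n.+1%:R / N%:R).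
Proof.
move=> N0 uf e0 fB fe.
have B0 : 0 <= B by apply: le_trans (fB 0 (lexx _)).
apply/ler_addgt0Pr => d d0.
have [m0 hm] := unif_cont_mesh (ler0n R N) uf d0.
have [mk [mk0 m0k]] : exists mk, (0 < mk)%N /\ (m0 <= mk)%N by exists m0.+1.
have NR : N%:R != 0 :> R by rewrite pnatr_eq0 -lt0n.
have mkR : mk%:R != 0 :> R by rewrite pnatr_eq0 -lt0n.
(* With [mk] nodes per unit length the nodes are the [j / mk]; at most [n * mk + 1 <= (n + 1) * mk]
   of them do not exceed [n]. *)
pose m := (N * mk)%N.
have mm : (0 < m)%N by rewrite muln_gt0 N0.
have := average_riemann (ler0n R N) mm uf (hm m _ mm).
rewrite (leq_trans m0k) ?leq_pmull// => /(_ isT) h.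
have {}h : `|average N%:R f| <= d + `|riemann_sum m N%:R f|.
  have -> : average N%:R f = (average N%:R f - riemann_sum m N%:R f) +
    riemann_sum m N%:R f by ring.
  by apply: le_trans (ler_normD _ _) _; rewrite lerD2r.
apply: le_trans h _; rewrite addrC lerD2r /riemann_sum normrM ger0_norm ?invr_ge0//.
rewrite ler_pdivrMl ?ltr0n//.
apply: (@le_trans _ _ (\sum_(0 <= j < m) (e + (if (j < (n * mk).+1)%N then B else 0)))).
  apply: le_trans (ler_norm_sum _ _ _) _; apply: ler_sum_nat => j _.
  have -> : j%:R * (N%:R / m%:R) = j%:R / mk%:R :> R.
    by rewrite /m natrM; field; rewrite NR mkR.
  case: ifPn => jn.
    by rewrite (le_trans (fB _ _)) ?divr_ge0// lerDr.
  rewrite addr0; apply: fe; rewrite ltr_pdivlMr ?ltr0n// -natrM ltr_nat.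
  by rewrite -leqNgt in jn.
rewrite big_split sumr_const_nat subn0 /= mulrDr -(mulr_natl e) lerD2l.
rewrite -big_mkcond /=.
have le1 : (n * mk).+1%:R * B <= m%:R * (B * (n.+1%:R / N%:R)).
  have -> : m%:R * (B * (n.+1%:R / N%:R)) = (n.+1 * mk)%:R * B.
    by rewrite /m !natrM; field.
  by rewrite ler_wpM2r// ler_nat mulSn addnC -addn1 leq_add2l.
apply: le_trans le1; rewrite big_mkord sumr_const -(mulr_natl B).
rewrite ler_wpM2r// ler_nat.
rewrite -[X in (_ <= X)%N]card_ord.
apply: (@leq_card_in _ _ (fun j : 'I_m => inord j : 'I_((n * mk).+1))) => i j.
rewrite -!topredE /= => hi hj /(congr1 (@nat_of_ord _)); rewrite !inordK//.
exact: val_inj.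
Qed.

End RiemannAverages.

Lemma mulg_cvg (G : lcGroupType) (T : Type) (F : set_system T) (f g : T -> G)
    (a b : G) : Filter F -> f @ F --> a -> g @ F --> b ->
  (fun x => f x * g x)%g @ F --> (a * b)%g.
Proof.
move=> FF fa gb.
exact: (cvg_comp (fun x => (f x, g x)) (fun z : G * G => (z.1 * z.2)%g)
  (cvg_pair fa gb) (@mulg_continuous G (a, b))).
Qed.

Section OneParameterAverages.
Context (R : realType) (G : lcGroupType).
Implicit Types (psi : G -> R) (e : R -> G) (V : R -> set G).

(* A modulus of uniform continuity that is shared by a whole family of functions:
   the approximations by finite combinations of point masses have to be uniform
   on the unit ball of the multipliers. *)
Definition modulus V := forall eps, 0 < eps -> nbhs (1%g : G) (V eps).

Definition ruc V psi := forall eps, 0 < eps -> forall w u, V eps u ->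
  `|psi (w * u)%g - psi w| <= eps.

Definition one_param e :=
  continuous e /\ forall x y, e (x + y) = (e x * e y)%g.

Definition group_sum (n : nat) e (N : R) psi : G -> R :=
  fun w => riemann_sum n N (fun x => psi (w * e x)%g).

Definition group_avg e (N : R) psi : G -> R :=
  fun w => average N (fun x => psi (w * e x)%g).

(** Since [w u e(x) = w e(x) (e(x)^-1 u e(x))], a mean over right translates inherits the modulus
    conjugated by all the [e x]. These sets remain neighbourhoods of 1 because [[0, N]] is
    compact. *)
Definition conj_modulus e (N : R) V : R -> set G :=
  fun eps => [set u | forall x, 0 <= x <= N -> V eps ((e x)^-1 * u * e x)%g].

Lemma one_param0 e : one_param e -> e 0 = 1%g.
Proof.
by move=> [_ eD]; apply: (@mulgI _ (e 0)); rewrite -eD addr0 mulg1.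
Qed.

Lemma one_paramX e x n : one_param e -> (e x ^+ n)%g = e (n%:R * x).
Proof.
move=> he; elim: n => [|n IH]; first by rewrite mul0r (one_param0 he).
by rewrite expgS IH -he.2 -[in RHS]addn1 natrD mulrDl mul1r addrC.
Qed.

Lemma ruc_unif_cont e V : one_param e -> modulus V ->
  forall eps, 0 < eps -> exists2 d, 0 < d & forall phi, ruc V phi ->
    forall w, oscillation d eps (fun x => phi (w * e x)%g).
Proof.
move=> he mV eps eps0.
have : nbhs (0 : R) (e @^-1` V eps).
  by apply: he.1; rewrite (one_param0 he); exact: mV.
move=> /nbhs_ballP[d /= d0 hd]; exists (d / 2); first by rewrite divr_gt0.
move=> phi rphi w x h /andP[h0 hd2]; rewrite he.2 mulgA; apply: rphi => //.
apply: hd; rewrite /ball /= sub0r normrN ger0_norm//.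
by rewrite (le_lt_trans hd2)// ltr_pdivrMr// ltr_pMr// ltr1n.
Qed.

Lemma ruc_uc e V psi w : one_param e -> modulus V -> ruc V psi ->
  unif_cont (fun x => psi (w * e x)%g).
Proof.
move=> he mV rpsi eps eps0; have [d d0 h] := ruc_unif_cont he mV eps0.
by exists d => //; exact: h.
Qed.

Lemma conj_modulusP e N V : one_param e -> modulus V ->
  modulus (conj_modulus e N V).
Proof.
move=> he mV eps eps0; rewrite /conj_modulus.
have /compact_near_coveringP cov := @segment_compact R 0 N.
have : \forall u \near (1%g : G), `[0, N] `<=`
    (fun x => V eps ((e x)^-1 * u * e x)%g).
  apply: (cov G (nbhs (1%g : G)) (fun u x => V eps ((e x)^-1 * u * e x)%g)).
  move=> x _.
  have cx : e z.1 @[z --> (x, 1%g : G)] --> e x.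
    by apply: cvg_comp; [exact: cvg_fst|exact: he.1].
  have : ((e z.1)^-1 * z.2 * e z.1)%g @[z --> (x, 1%g : G)] -->
      ((e x)^-1 * 1 * e x)%g.
    apply: mulg_cvg => //; apply: mulg_cvg; last exact: cvg_snd.
    by apply: cvg_comp cx _; exact: invg_continuous.
  by rewrite mulg1 mulVg => /(_ _ (mV _ eps0)).
by apply: filterS => u h x hx; apply: h; rewrite /= in_itv.
Qed.

Lemma group_avg_approx e N V : one_param e -> modulus V -> 0 <= N ->
  forall eps, 0 < eps -> exists n0 : nat, forall phi, ruc V phi ->
    forall n, (n0 <= n)%N -> (0 < n)%N -> forall w,
    `|group_avg e N phi w - group_sum n e N phi w| <= eps.
Proof.
move=> he mV N0 eps eps0; have [d d0 h] := ruc_unif_cont he mV eps0.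
exists (Num.truncn (N / d)).+1 => phi rphi n n0n n0 w.
apply: average_riemann => //; first exact: ruc_uc rphi.
apply: oscillationW (h _ rphi w).
rewrite ler_pdivrMr ?ltr0n// mulrC -ler_pdivrMr//.
by apply: ltW (lt_le_trans (truncnS_gt _) _); rewrite ler_nat.
Qed.

Lemma group_avg_ruc e N V psi : one_param e -> modulus V -> 0 <= N ->
  ruc V psi -> ruc (conj_modulus e N V) (group_avg e N psi).
Proof.
move=> he mV N0 rpsi eps eps0 w u Vu.
apply: average_dist => //; [exact: ruc_uc rpsi|exact: ruc_uc rpsi|].
move=> x hx.
have -> : (w * u * e x = w * e x * ((e x)^-1 * u * e x))%g.
  by rewrite !mulgA mulgK.
exact/rpsi/Vu.
Qed.

Lemma group_sum_dist n e N psi psi' c w : (0 < n)%N ->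
  (forall w, `|psi w - psi' w| <= c) ->
  `|group_sum n e N psi w - group_sum n e N psi' w| <= c.
Proof. by move=> n0 h; apply: riemann_sum_dist. Qed.

Lemma group_avg_dist e N V V' psi psi' c w : one_param e -> modulus V ->
  modulus V' -> 0 <= N -> ruc V psi -> ruc V' psi' ->
  (forall w, `|psi w - psi' w| <= c) ->
  `|group_avg e N psi w - group_avg e N psi' w| <= c.
Proof.
move=> he mV mV' N0 r r' h; apply: average_dist => //.
- exact: ruc_uc r.
- exact: ruc_uc r'.
Qed.

Lemma schur_bounded th C psi : schur th C psi -> forall w, `|psi w| <= C.
Proof.
move=> sch w.
have := sch unit unit (fun=> w) (fun=> 1%g) (fun _ _ => 1) 1 1 1 ltr01 ltr01 ltr01.
rewrite !card_unit powR1 !mulr1 !mul1r => /(_ _ _ _ _).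
have s1 (F : unit -> R) : \sum_i F i = F tt.
  by rewrite (bigD1 tt)//= big1 ?addr0// => -[].
rewrite !s1 invg1 mulg1 ?mul1r; apply.
- by move=> i; rewrite ?s1 ?mulr1 ?normr1.
- by move=> i; rewrite ?s1 ?mulr1 ?normr1.
- by move=> i; rewrite ?s1 ?mulr1 ?normr1.
- by rewrite ler1n.
Qed.

(** Translating [psi] on the right by [e x] amounts to replacing [t j] by [(e x)^-1 * t j], and
    [schur] quantifies over all [t]; the property is then inherited by means. *)
Lemma schur_group_sum th C n e N psi : (0 < n)%N -> schur th C psi ->
  schur th C (group_sum n e N psi).
Proof.
move=> n0 sch I J s t T r c eta r0 c0 eta0 hr hc hg hIJ.
rewrite /group_sum /riemann_sum.
have -> : \sum_i \sum_j T i j * (n%:R^-1 *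
    \sum_(0 <= k < n) psi (s i * (t j)^-1 * e (k%:R * (N / n%:R))%R)%g) =
  n%:R^-1 * \sum_(0 <= k < n) \sum_i \sum_j
    T i j * psi (s i * ((e (k%:R * (N / n%:R))%R)^-1 * t j)^-1)%g.
  rewrite [in RHS]exchange_big mulr_sumr; apply: eq_bigr => i _.
  rewrite [in RHS]exchange_big mulr_sumr; apply: eq_bigr => j _.
  rewrite mulrCA; congr (_ * _); rewrite mulr_sumr; apply: eq_bigr => k _.
  by rewrite invgM invgK mulgA.
rewrite normrM ger0_norm ?invr_ge0// ler_pdivrMl ?ltr0n//.
apply: le_trans (ler_norm_sum _ _ _) _.
rewrite mulr_natl -[X in _ <= _ *+ X](subn0 n) -sumr_const_nat.
apply: ler_sum => k _.
exact: (sch I J s (fun j => (e (k%:R * (N / n%:R))%R)^-1 * t j)%g T r c eta).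
Qed.

Lemma schur_group_avg th C e N V psi : one_param e -> modulus V -> 0 <= N ->
  ruc V psi -> schur th C psi -> schur th C (group_avg e N psi).
Proof.
move=> he mV N0 rpsi sch I J s t T r c eta r0 c0 eta0 hr hc hg hIJ.
pose S := \sum_i \sum_j `|T i j|.
have S0 : 0 <= S by apply: sumr_ge0 => i _; apply: sumr_ge0.
apply/ler_addgt0Pr => d d0.
have dS : 0 < d / (S + 1) by rewrite divr_gt0// ltr_pwDr.
have [n0 h] := group_avg_approx he mV N0 dS.
have n1 : (0 < n0.+1)%N by [].
have := schur_group_sum e N n1 sch s t r0 c0 eta0 hr hc hg hIJ.
set X := \sum_i _; set Y := \sum_i _ => hX.
have hXY : `|Y - X| <= d.
  rewrite /X /Y -sumrB.
  apply: (@le_trans _ _ (\sum_i \sum_j `|T i j| * (d / (S + 1)))).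
    apply: le_trans (ler_norm_sum _ _ _) _; apply: ler_sum => i _.
    rewrite -sumrB; apply: le_trans (ler_norm_sum _ _ _) _; apply: ler_sum => j _.
    by rewrite -mulrBr normrM ler_wpM2l//; exact: h.
  under eq_bigr => i _ do rewrite -mulr_suml.
  rewrite -mulr_suml -/S mulrCA ler_piMr ?(ltW d0)// ler_pdivrMr ?ltr_pwDr//.
  by rewrite mul1r lerDl.
have -> : Y = X + (Y - X) by ring.
by apply: le_trans (ler_normD _ _) _; rewrite lerD.
Qed.

End OneParameterAverages.

(** * Inserting a factor into a mean *)

Section Insertion.
Context (R : realType) (G : lcGroupType).
Implicit Types (psi : G -> R) (V : R -> set G).

(* The commutation relations of four consecutive root groups of type C_2 *)
Definition unip_pattern (f p q l : R -> G) : Prop :=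
  [/\ [/\ one_param f, one_param p, one_param q & one_param l],
      forall x a, (f x * l a)%g = (l a * q (a * x)%R * p (a * x ^+ 2)%R * f x)%g,
      forall x u, (f x * q u)%g = (q u * p (2 * u * x)%R * f x)%g,
      [/\ forall x y, commute (p x) (f y), forall x y, commute (p x) (q y)
        & forall x y, commute (p x) (l y)]
    & forall x y, commute (q x) (l y)].

(** An upper bound of [twist_eta] from which the meshes have cancelled: for fixed ranges and fixed
    [m], the numbers of nodes of [f], [p] and [q] can grow. *)
Definition insertion_eta (Nf Np Nl M m : nat) : R :=
  m%:R^-1 + (M * m)%:R / (Nl * Nf)%:R + (M ^ 2 * m)%:R / (Nl * Np)%:R.

Variables (f p q l : R -> G).
Hypothesis pat : unip_pattern f p q l.

Variables (th C : R) (psi : G -> R).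
Hypotheses (th0 : 0 <= th) (sch : schur th C psi).
Variables (Nf Np Nl M m : nat).
Hypotheses (Nf0 : (0 < Nf)%N) (Np0 : (0 < Np)%N) (Nl0 : (0 < Nl)%N).
Hypothesis m0 : (0 < m)%N.

Lemma insertion_step (k X t kap n n' : nat) (w : G) :
  (0 < k)%N -> (0 < X)%N -> (t < k)%N -> kap = (k * m`! * X)%N ->
  n = (Nf * Nl * kap)%N -> n' = (Np * m * Nl * kap ^ 2)%N ->
  `|\sum_(i < m) \sum_(j < n) \sum_(v < n')
     (psi (w * f (j%:R * (Nf%:R / n%:R))%R * p (v%:R * (Np%:R / n'%:R))%R *
           q (t%:R * (M%:R / k%:R))%R * l (i%:R * (Nl%:R / m%:R))%R)%g -
      psi (w * f (j%:R * (Nf%:R / n%:R))%R * p (v%:R * (Np%:R / n'%:R))%R *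
           l (i%:R * (Nl%:R / m%:R))%R)%g)| <=
  2 * C * insertion_eta Nf Np Nl M m `^ th * (m * n * n')%:R.
Proof.
move=> k0 X0 tk kapE nE n'E.
have [[hf hp hq hl] fl fq [pf pq pl] ql] := pat.
have kap0 : (0 < kap)%N by rewrite kapE !muln_gt0 k0 fact_gt0.
have n0 : (0 < n)%N by rewrite nE !muln_gt0 Nf0 Nl0.
have n'0 : (0 < n')%N by rewrite n'E !muln_gt0 Np0 m0 Nl0 kap0.
have Rn (a : nat) : (0 < a)%N -> a%:R != 0 :> R by rewrite pnatr_eq0 -lt0n.
(* The steps [h] of [f] and [g] of [l] impose the step [g h] on [q] and [g h ^ 2] on [p]. The values
   of [n] and [n'] match these with the nodes of [p] and [q]; the factor [m!] makes [D] divisible by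
   every [i < m], and [X] is left free to refine the meshes. *)
pose h := Nf%:R / n%:R : R; pose g := Nl%:R / m%:R : R.
pose D := (t * M * m * (m`! * X))%N.
have FL : (f h * l g = l g * q (g * h)%R * p (g * h ^+ 2)%R * f h)%g by exact: fl.
have FQ : (f h * q (g * h)%R = q (g * h)%R *
    (p (g * h ^+ 2)%R * p (g * h ^+ 2)%R) * f h)%g.
  rewrite fq -hp.2.
  by have -> : 2 * (g * h) * h = g * h ^+ 2 + g * h ^+ 2 by ring.
have eP : g * h ^+ 2 = Np%:R / n'%:R.
  rewrite /g /h n'E nE -!mulnn !natrM; field.
  by rewrite !Rn.
have eQ : D%:R * (g * h) = t%:R * (M%:R / k%:R).
  rewrite /g /h /D nE kapE !natrM; field.
  by rewrite !Rn ?fact_gt0.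
have dvdD i : (0 < i < m)%N -> (i %| D)%N.
  by move=> im; apply: dvdn_mull; apply: dvdn_mulr; apply: dvdn_fact; lia.
have := unip_average FL FQ (pf _ _) (pq _ _) (pl _ _) (ql _ _) w m0 n0 n'0 dvdD sch.
have C0 : 0 <= C by apply: le_trans (schur_bounded sch 1%g).
have eta_le : twist_eta R m n n' D <= insertion_eta Nf Np Nl M m.
  rewrite /twist_eta /insertion_eta -!addrA lerD2l lerD//.
  - rewrite ler_pdivrMr ?ltr0n// mulrAC ler_pdivlMr ?ltr0n ?muln_gt0 ?Nl0//.
    rewrite -!natrM ler_nat nE /D kapE.
    have -> : (t * M * m * (m`! * X) * (Nl * Nf) =
      t * (M * m * (m`! * X) * (Nl * Nf)))%N by ring.
    have -> : (M * m * (Nf * Nl * (k * m`! * X)) =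
      k * (M * m * (m`! * X) * (Nl * Nf)))%N by ring.
    by rewrite leq_mul2r ltnW ?orbT.
  - rewrite ler_pdivrMr ?ltr0n// mulrAC ler_pdivlMr ?ltr0n ?muln_gt0 ?Nl0//.
    rewrite -!natrM ler_nat n'E /D kapE.
    have -> : ((t * M * m * (m`! * X)) ^ 2 * (Nl * Np) =
      (t * t) * (M * m * (m`! * X) * (M * m * (m`! * X)) * (Nl * Np)))%N by ring.
    have -> : (M ^ 2 * m * (Np * m * Nl * (k * m`! * X) ^ 2) =
      (k * k) * (M * m * (m`! * X) * (M * m * (m`! * X)) * (Nl * Np)))%N by ring.
    by rewrite leq_mul2r leq_mul ?orbT// ltnW.
have tw0 : 0 <= twist_eta R m n n' D.
  by rewrite /twist_eta !addr_ge0 ?divr_ge0 ?invr_ge0.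
have powle : twist_eta R m n n' D `^ th <= insertion_eta Nf Np Nl M m `^ th.
  by apply: ge0_ler_powR => //; rewrite nnegrE ?(le_trans tw0).
move=> H; apply: (le_trans _ (le_trans H _)); last first.
  by rewrite ler_wpM2r// ler_wpM2l// mulr_ge0.
rewrite le_eqVlt; apply/orP; left; apply/eqP; congr (`|_|).
apply: eq_bigr => i _; apply: eq_bigr => j _; apply: eq_bigr => v _.
rewrite !one_paramX//.
by rewrite eP eQ !mulgA.
Qed.

Lemma riemann_sum_exchange (n k : nat) (N N' : R) (F : R -> R -> R) :
  riemann_sum n N (fun x => riemann_sum k N' (F x)) =
  riemann_sum k N' (fun y => riemann_sum n N (F^~ y)).
Proof.
rewrite /riemann_sum -!mulr_sumr mulrCA; congr (_ * (_ * _)).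
exact: exchange_big.
Qed.

(** The mean over [q] is moved outside; [insertion_step] is uniform in the node [t] of [q]. *)
Lemma insertion_finite (k X kap n n' : nat) (w : G) :
  (0 < k)%N -> (0 < X)%N -> kap = (k * m`! * X)%N ->
  n = (Nf * Nl * kap)%N -> n' = (Np * m * Nl * kap ^ 2)%N ->
  `|group_sum n f Nf%:R (group_sum n' p Np%:R (group_sum k q M%:R
      (group_sum m l Nl%:R psi))) w -
    group_sum n f Nf%:R (group_sum n' p Np%:R (group_sum m l Nl%:R psi)) w| <=
  2 * C * insertion_eta Nf Np Nl M m `^ th.
Proof.
move=> k0 X0 kapE nE n'E.
have kap0 : (0 < kap)%N by rewrite kapE !muln_gt0 k0 fact_gt0.
have n0 : (0 < n)%N by rewrite nE !muln_gt0 Nf0 Nl0.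
have n'0 : (0 < n')%N by rewrite n'E !muln_gt0 Np0 m0 Nl0 kap0.
have Rn (a : nat) : (0 < a)%N -> a%:R != 0 :> R by rewrite pnatr_eq0 -lt0n.
pose phi := group_sum m l Nl%:R psi.
have -> : group_sum n f Nf%:R (group_sum n' p Np%:R (group_sum k q M%:R phi)) w =
  riemann_sum k M%:R (fun t =>
    group_sum n f Nf%:R (group_sum n' p Np%:R (fun u => phi (u * q t)%g)) w).
  rewrite /group_sum -[RHS]riemann_sum_exchange; congr (riemann_sum _ _ _).
  apply/funext => x; rewrite -[RHS]riemann_sum_exchange.
  by congr (riemann_sum _ _ _); apply/funext => y.
rewrite -[X in _ - X](@riemann_sum_const R k M%:R _ k0).
apply: riemann_sum_dist => // t tk.
have N0 : 0 < (m * n * n')%:R :> R by rewrite ltr0n !muln_gt0 m0 n0.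
rewrite -(ler_pM2r N0); apply: le_trans (insertion_step w k0 X0 tk kapE nE n'E).
rewrite -[X in _ * X]normr_nat -normrM le_eqVlt; apply/orP; left; apply/eqP.
congr (`|_|).
have trip (F : R -> R -> R -> R) : riemann_sum n Nf%:R (fun x =>
    riemann_sum n' Np%:R (fun y => riemann_sum m Nl%:R (F x y))) * (m * n * n')%:R =
  \sum_(i < m) \sum_(j < n) \sum_(v < n')
    F (j%:R * (Nf%:R / n%:R)) (v%:R * (Np%:R / n'%:R)) (i%:R * (Nl%:R / m%:R)).
  rewrite /riemann_sum; under eq_bigr => j _ do rewrite -mulr_sumr.
  rewrite -!mulr_sumr !natrM.
  have -> (S : R) : n%:R^-1 * (n'%:R^-1 * (m%:R^-1 * S)) *
      (m%:R * n%:R * n'%:R) = S.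
    by field; rewrite !Rn.
  rewrite [RHS]exchange_big big_mkord; apply: eq_bigr => j _.
  rewrite [RHS]exchange_big big_mkord; apply: eq_bigr => v _.
  by rewrite big_mkord.
rewrite mulrBl.
rewrite (trip (fun x y z => psi (w * f x * p y * q (t%:R * (M%:R / k%:R))%R * l z)%g)).
rewrite (trip (fun x y z => psi (w * f x * p y * l z)%g)).
rewrite -sumrB; apply: eq_bigr => i _; rewrite -sumrB; apply: eq_bigr => j _.
by rewrite -sumrB.
Qed.

End Insertion.

Section InsertionAverage.
Context (R : realType) (G : lcGroupType).
Variables (f p q l : R -> G).
Hypothesis pat : unip_pattern f p q l.

Lemma insertion (th C : R) (V : R -> set G) (psi : G -> R)
    (Nf Np Nl M m : nat) (w : G) :
  0 <= th -> modulus V -> ruc V psi -> schur th C psi ->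
  (0 < Nf)%N -> (0 < Np)%N -> (0 < Nl)%N -> (0 < m)%N ->
  `|group_avg f Nf%:R (group_avg p Np%:R (group_avg q M%:R
      (group_avg l Nl%:R psi))) w -
    group_avg f Nf%:R (group_avg p Np%:R (group_avg l Nl%:R psi)) w| <=
  2 * C * insertion_eta R Nf Np Nl M m `^ th.
Proof.
move=> th0 mV rpsi sch Nf0 Np0 Nl0 m0.
have [[hf hp hq hl] _ _ _ _] := pat.
pose phi := group_avg l Nl%:R psi; pose V1 := conj_modulus l Nl%:R V.
pose phi2 := group_avg q M%:R phi; pose V2 := conj_modulus q M%:R V1.
pose phi3 := group_avg p Np%:R phi2; pose V3 := conj_modulus p Np%:R V2.
pose phi3' := group_avg p Np%:R phi; pose V3' := conj_modulus p Np%:R V1.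
have mV1 : modulus V1 by exact: conj_modulusP.
have mV2 : modulus V2 by exact: conj_modulusP.
have mV3 : modulus V3 by exact: conj_modulusP.
have mV3' : modulus V3' by exact: conj_modulusP.
have r1 : ruc V1 phi by exact: group_avg_ruc.
have r2 : ruc V2 phi2 by exact: group_avg_ruc.
have r3 : ruc V3 phi3 by exact: group_avg_ruc.
have r3' : ruc V3' phi3' by exact: group_avg_ruc.
(* Four approximations for the word with [q], three for the word without. *)
apply/ler_addgt0Pr => e' e'0; pose e := e' / 7.
have e0 : 0 < e by rewrite divr_gt0.
have [al hal] := group_avg_approx hl mV (ler0n R Nl) e0.
have [aq haq] := group_avg_approx hq mV1 (ler0n R M) e0.
have [ap hap] := group_avg_approx hp mV2 (ler0n R Np) e0.
have [ap' hap'] := group_avg_approx hp mV1 (ler0n R Np) e0.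
have [af haf] := group_avg_approx hf mV3 (ler0n R Nf) e0.
have [af' haf'] := group_avg_approx hf mV3' (ler0n R Nf) e0.
pose k := aq.+1; pose mm := al.+1.
pose X := (ap + ap' + af + af').+1; pose kap := (k * m`! * X)%N.
pose n := (Nf * Nl * kap)%N; pose n' := (Np * m * Nl * kap ^ 2)%N.
have kapX : (X <= kap)%N by rewrite leq_pmull// muln_gt0 fact_gt0.
have nX : (X <= n)%N by rewrite (leq_trans kapX)// leq_pmull// muln_gt0 Nf0.
have n'X : (X <= n')%N.
  rewrite (leq_trans kapX)// /n' -mulnn mulnA leq_pmull//.
  by rewrite !muln_gt0 Np0 m0 Nl0 fact_gt0.
have n0 : (0 < n)%N by exact: leq_trans nX.
have n'0 : (0 < n')%N by exact: leq_trans n'X.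
(* The number [m] of nodes of [l] enters the bound and cannot be increased. The fine part of the
   mean over [l], on an interval of length [Nl / m], is therefore put into the function, which still
   satisfies [schur]. *)
pose psi' := group_sum mm l (Nl%:R / m%:R) psi.
pose phiS := group_sum m l Nl%:R psi'.
have phiSE : phiS = group_sum (m * mm) l Nl%:R psi.
  apply/funext => u; rewrite /group_sum riemann_sum_mul//.
  congr (riemann_sum _ _ _); apply/funext => x; rewrite /psi' /group_sum.
  by congr (riemann_sum _ _ _); apply/funext => y; rewrite hl.2 mulgA.
have tri (x y z a b : R) : `|x - y| <= a -> `|y - z| <= b -> `|x - z| <= a + b.
  by move=> h1 h2; rewrite (le_trans (ler_distD y _ _))// lerD.
have d1 u : `|phi u - phiS u| <= e.
  rewrite phiSE; apply: hal => //; last by rewrite muln_gt0 m0.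
  by apply: leq_trans (leqnSn _) _; rewrite leq_pmull.
have d2 u : `|phi2 u - group_sum k q M%:R phiS u| <= e + e.
  by apply: tri (haq _ r1 _ (leqnSn _) _ u) _ => //; exact: group_sum_dist.
have leX a : (a <= X)%N -> (a <= n)%N by move/leq_trans; exact.
have leX' a : (a <= X)%N -> (a <= n')%N by move/leq_trans; exact.
have d3 u : `|phi3 u - group_sum n' p Np%:R (group_sum k q M%:R phiS) u| <=
    e + (e + e).
  apply: tri (hap _ r2 n' _ n'0 u) _; last exact: group_sum_dist.
  by apply: leX'; rewrite /X; lia.
have d3' u : `|phi3' u - group_sum n' p Np%:R phiS u| <= e + e.
  apply: tri (hap' _ r1 n' _ n'0 u) _; last exact: group_sum_dist.
  by apply: leX'; rewrite /X; lia.
have d4 : `|group_avg f Nf%:R phi3 w - group_sum n f Nf%:R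
    (group_sum n' p Np%:R (group_sum k q M%:R phiS)) w| <= e + (e + (e + e)).
  apply: tri (haf _ r3 n _ n0 w) _; last exact: group_sum_dist.
  by apply: leX; rewrite /X; lia.
have d4' : `|group_sum n f Nf%:R (group_sum n' p Np%:R phiS) w -
    group_avg f Nf%:R phi3' w| <= e + (e + e).
  rewrite distrC; apply: tri (haf' _ r3' n _ n0 w) _; last exact: group_sum_dist.
  by apply: leX; rewrite /X; lia.
have sch' : schur th C psi' by exact: schur_group_sum.
have d5 := @insertion_finite R G f p q l pat th C psi' th0 sch' Nf Np Nl M m
  Nf0 Np0 Nl0 m0 k X kap n n' w isT isT erefl erefl erefl.
have := tri _ _ _ _ _ (tri _ _ _ _ _ d4 d5) d4'.
by move=> H; apply: le_trans H _; apply: le_of_eq; rewrite /e; field.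
Qed.

End InsertionAverage.

(** * Root groups of Sp(2,R) *)

Section RootGroups.
Context (R : realType).

Definition mx4 (a00 a01 a02 a03 a10 a11 a12 a13
    a20 a21 a22 a23 a30 a31 a32 a33 : R) : 'M[R]_(2 + 2) :=
  \matrix_(i, j) nth 0 (nth [::] [:: [:: a00; a01; a02; a03];
    [:: a10; a11; a12; a13]; [:: a20; a21; a22; a23];
    [:: a30; a31; a32; a33]] i) j.

Lemma mx4M a00 a01 a02 a03 a10 a11 a12 a13 a20 a21 a22 a23 a30 a31 a32 a33
    b00 b01 b02 b03 b10 b11 b12 b13 b20 b21 b22 b23 b30 b31 b32 b33 :
  mx4 a00 a01 a02 a03 a10 a11 a12 a13 a20 a21 a22 a23 a30 a31 a32 a33 *m
  mx4 b00 b01 b02 b03 b10 b11 b12 b13 b20 b21 b22 b23 b30 b31 b32 b33 =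
  mx4
    (a00 * b00 + a01 * b10 + a02 * b20 + a03 * b30)
    (a00 * b01 + a01 * b11 + a02 * b21 + a03 * b31)
    (a00 * b02 + a01 * b12 + a02 * b22 + a03 * b32)
    (a00 * b03 + a01 * b13 + a02 * b23 + a03 * b33)
    (a10 * b00 + a11 * b10 + a12 * b20 + a13 * b30)
    (a10 * b01 + a11 * b11 + a12 * b21 + a13 * b31)
    (a10 * b02 + a11 * b12 + a12 * b22 + a13 * b32)
    (a10 * b03 + a11 * b13 + a12 * b23 + a13 * b33)
    (a20 * b00 + a21 * b10 + a22 * b20 + a23 * b30)
    (a20 * b01 + a21 * b11 + a22 * b21 + a23 * b31)
    (a20 * b02 + a21 * b12 + a22 * b22 + a23 * b32)
    (a20 * b03 + a21 * b13 + a22 * b23 + a23 * b33)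
    (a30 * b00 + a31 * b10 + a32 * b20 + a33 * b30)
    (a30 * b01 + a31 * b11 + a32 * b21 + a33 * b31)
    (a30 * b02 + a31 * b12 + a32 * b22 + a33 * b32)
    (a30 * b03 + a31 * b13 + a32 * b23 + a33 * b33).
Proof.
apply/matrixP => i j; rewrite !mxE (big_ord_recl 3) (big_ord_recl 2).
rewrite (big_ord_recl 1) (big_ord_recl 0) big_ord0 !mxE addr0 !addrA.
by case: i => -[|[|[|[|//]]]] hi; case: j => -[|[|[|[|//]]]] hj.
Qed.

Lemma mx4T a00 a01 a02 a03 a10 a11 a12 a13 a20 a21 a22 a23 a30 a31 a32 a33 :
  (mx4 a00 a01 a02 a03 a10 a11 a12 a13 a20 a21 a22 a23 a30 a31 a32 a33)^T =
  mx4 a00 a10 a20 a30 a01 a11 a21 a31 a02 a12 a22 a32 a03 a13 a23 a33.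
Proof.
apply/matrixP => i j; rewrite !mxE.
by case: i => -[|[|[|[|//]]]] hi; case: j => -[|[|[|[|//]]]] hj.
Qed.

Lemma symJE : symJ R = mx4 0 0 1 0 0 0 0 1 (-1) 0 0 0 0 (-1) 0 0.
Proof.
apply/matrixP => i j; rewrite /symJ [in RHS]mxE.
case: (split_ordP i) => i' ->; case: (split_ordP j) => j' ->.
- rewrite block_mxEul mxE.
  by case: i' => -[|[|//]] hi; case: j' => -[|[|//]] hj.
- rewrite block_mxEur mxE.
  by case: i' => -[|[|//]] hi; case: j' => -[|[|//]] hj.
- rewrite block_mxEdl !mxE.
  by case: i' => -[|[|//]] hi; case: j' => -[|[|//]] hj; rewrite //= oppr0.
- rewrite block_mxEdr mxE.
  by case: i' => -[|[|//]] hi; case: j' => -[|[|//]] hj.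
Qed.

Local Ltac mx4_ring := rewrite ?mx4M; congr mx4; ring.

Lemma mx4_1 : 1%:M = mx4 1 0 0 0 0 1 0 0 0 0 1 0 0 0 0 1.
Proof.
apply/matrixP => i j; rewrite !mxE.
by case: i => -[|[|[|[|//]]]] hi; case: j => -[|[|[|[|//]]]] hj.
Qed.

(* The root groups of six roots in cyclic order: [x1 - x2], [2 x1], [x1 + x2],
   [2 x2], [x2 - x1], [- 2 x1]. *)
Definition eroot0_mx x := mx4 1 x 0 0 0 1 0 0 0 0 1 0 0 0 (- x) 1.
Definition eroot1_mx x := mx4 1 0 x 0 0 1 0 0 0 0 1 0 0 0 0 1.
Definition eroot2_mx x := mx4 1 0 0 x 0 1 x 0 0 0 1 0 0 0 0 1.
Definition eroot3_mx x := mx4 1 0 0 0 0 1 0 x 0 0 1 0 0 0 0 1.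
Definition eroot4_mx x := mx4 1 0 0 0 (- x) 1 0 0 0 0 1 x 0 0 0 1.
Definition eroot5_mx x := mx4 1 0 0 0 0 1 0 0 (- x) 0 1 0 0 0 0 1.

Lemma eroot0_symp x : (eroot0_mx x)^T *m symJ R *m eroot0_mx x = symJ R.
Proof. by rewrite symJE mx4T; mx4_ring. Qed.
Lemma eroot1_symp x : (eroot1_mx x)^T *m symJ R *m eroot1_mx x = symJ R.
Proof. by rewrite symJE mx4T; mx4_ring. Qed.
Lemma eroot2_symp x : (eroot2_mx x)^T *m symJ R *m eroot2_mx x = symJ R.
Proof. by rewrite symJE mx4T; mx4_ring. Qed.
Lemma eroot3_symp x : (eroot3_mx x)^T *m symJ R *m eroot3_mx x = symJ R.
Proof. by rewrite symJE mx4T; mx4_ring. Qed.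
Lemma eroot4_symp x : (eroot4_mx x)^T *m symJ R *m eroot4_mx x = symJ R.
Proof. by rewrite symJE mx4T; mx4_ring. Qed.
Lemma eroot5_symp x : (eroot5_mx x)^T *m symJ R *m eroot5_mx x = symJ R.
Proof. by rewrite symJE mx4T; mx4_ring. Qed.

Definition eroot0 x : Sp2 R := mkSp2 (eroot0_symp x).
Definition eroot1 x : Sp2 R := mkSp2 (eroot1_symp x).
Definition eroot2 x : Sp2 R := mkSp2 (eroot2_symp x).
Definition eroot3 x : Sp2 R := mkSp2 (eroot3_symp x).
Definition eroot4 x : Sp2 R := mkSp2 (eroot4_symp x).
Definition eroot5 x : Sp2 R := mkSp2 (eroot5_symp x).

Lemma Sp2_mxM (g h : Sp2 R) : Sp2_mx (g * h)%g = Sp2_mx g *m Sp2_mx h.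
Proof. by []. Qed.

Lemma mx4_cont (U : topologicalType) (a00 a01 a02 a03 a10 a11 a12 a13
    a20 a21 a22 a23 a30 a31 a32 a33 : U -> R) :
  continuous a00 -> continuous a01 -> continuous a02 -> continuous a03 ->
  continuous a10 -> continuous a11 -> continuous a12 -> continuous a13 ->
  continuous a20 -> continuous a21 -> continuous a22 -> continuous a23 ->
  continuous a30 -> continuous a31 -> continuous a32 -> continuous a33 ->
  continuous (fun x => mx4 (a00 x) (a01 x) (a02 x) (a03 x) (a10 x) (a11 x)
    (a12 x) (a13 x) (a20 x) (a21 x) (a22 x) (a23 x) (a30 x) (a31 x) (a32 x)
    (a33 x)).
Proof.
move=> *; apply: mx_continuousP => i j.
rewrite (_ : (fun x => _) = fun x => nth 0 (nth [::] [:: [:: a00 x; a01 x; a02 x; a03 x];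
    [:: a10 x; a11 x; a12 x; a13 x]; [:: a20 x; a21 x; a22 x; a23 x];
    [:: a30 x; a31 x; a32 x; a33 x]] i) j); last first.
  by apply/funext => x; rewrite mxE.
by case: i => -[|[|[|[|//]]]] hi; case: j => -[|[|[|[|//]]]] hj.
Qed.

Lemma id_cont : continuous (fun x : R => x). Proof. by move=> x; exact: cvg_id. Qed.
Lemma opp_cont : continuous (fun x : R => - x).
Proof. by move=> x; apply: cvgN; exact: cvg_id. Qed.

Local Ltac eroot_one_param :=
  split; [apply: Sp2_continuousP; apply: mx4_cont;
          solve [exact: cst_continuous | exact: id_cont | exact: opp_cont]
         |move=> x y; apply: Sp2_inj; rewrite Sp2_mxM /=; mx4_ring].

Lemma eroot0_one_param : one_param eroot0.
Proof. eroot_one_param. Qed.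
Lemma eroot1_one_param : one_param eroot1.
Proof. eroot_one_param. Qed.
Lemma eroot2_one_param : one_param eroot2.
Proof. eroot_one_param. Qed.
Lemma eroot3_one_param : one_param eroot3.
Proof. eroot_one_param. Qed.
Lemma eroot4_one_param : one_param eroot4.
Proof. eroot_one_param. Qed.
Lemma eroot5_one_param : one_param eroot5.
Proof. eroot_one_param. Qed.

Local Ltac eroot_rel :=
  move=> *; apply: Sp2_inj; rewrite !Sp2_mxM /=; mx4_ring.

Lemma const_one_param (G : lcGroupType) : one_param (fun _ : R => 1%g : G).
Proof. by split => [|x y]; [exact: cst_continuous|rewrite mulg1]. Qed.

Lemma half_one_param (G : lcGroupType) (e : R -> G) :
  one_param e -> one_param (fun x => e (x / 2)).
Proof.
move=> [ce eD]; split=> [x|x y]; last by rewrite mulrDl eD.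
by apply: continuous_comp; [apply: cvgMl; exact: cvg_id|exact: ce].
Qed.

Lemma pattern0123 : unip_pattern eroot0 eroot1 eroot2 eroot3.
Proof.
split; [split; [exact: eroot0_one_param|exact: eroot1_one_param
  |exact: eroot2_one_param|exact: eroot3_one_param] | | |split| ]; eroot_rel.
Qed.

Lemma pattern2345 : unip_pattern eroot2 eroot3 eroot4 eroot5.
Proof.
split; [split; [exact: eroot2_one_param|exact: eroot3_one_param
  |exact: eroot4_one_param|exact: eroot5_one_param] | | |split| ]; eroot_rel.
Qed.

(** [eroot0 x] and [eroot2 a] commute up to [eroot1 (2 a x)], whence the halved parameter. With the
    trivial group as [p], the pattern reduces to the Heisenberg relations. *)
Lemma pattern012 :
  unip_pattern eroot0 (fun=> 1%g) eroot1 (fun x => eroot2 (x / 2)).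
Proof.
split; [split; [exact: eroot0_one_param|exact: const_one_param
  |exact: eroot1_one_param|exact: half_one_param eroot2_one_param] | | |split| ].
- move=> x a; rewrite mulg1; apply: Sp2_inj; rewrite !Sp2_mxM /= !mx4M.
  by congr mx4; field.
- by move=> x u; rewrite mulg1; eroot_rel.
- by move=> x y; exact/commute_sym/commute1.
- by move=> x y; exact/commute_sym/commute1.
- by move=> x y; exact/commute_sym/commute1.
- eroot_rel.
Qed.

Lemma pattern234 :
  unip_pattern eroot2 (fun=> 1%g) eroot3 (fun x => eroot4 (x / 2)).
Proof.
split; [split; [exact: eroot2_one_param|exact: const_one_param
  |exact: eroot3_one_param|exact: half_one_param eroot4_one_param] | | |split| ].
- move=> x a; rewrite mulg1; apply: Sp2_inj; rewrite !Sp2_mxM /= !mx4M.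
  by congr mx4; field.
- by move=> x u; rewrite mulg1; eroot_rel.
- by move=> x y; exact/commute_sym/commute1.
- by move=> x y; exact/commute_sym/commute1.
- by move=> x y; exact/commute_sym/commute1.
- eroot_rel.
Qed.

End RootGroups.

(** * Word functionals *)

Section Words.
Context (R : realType).
Local Notation G := (Sp2 R).
Implicit Types (psi : G -> R) (V : R -> set G).

Lemma group_avg_trivial (N : R) psi : group_avg (fun=> 1%g) N psi = psi.
Proof.
apply/funext => w; rewrite /group_avg.
by rewrite (_ : (fun _ => _) = fun=> psi w) ?average_const// mulg1.
Qed.

Lemma group_avg_half (e : R -> G) (N : nat) psi :
  group_avg (fun x => e (x / 2)) (2 * N)%:R psi = group_avg e N%:R psi.
Proof.
apply/funext => w; rewrite /group_avg /average.
have -> : (fun k => riemann_sum (2 ^ k) (2 * N)%:R (fun x => psi (w * e (x / 2)%R)%g)) =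
    (fun k => riemann_sum (2 ^ k) N%:R (fun x => psi (w * e x)%g)).
  apply/funext => k; rewrite /riemann_sum; congr (_ * _); apply: eq_bigr => j _.
  congr (psi (w * e _)%g); move: (2 ^ k)%N (expn_gt0 2 k) => n n0.
  by rewrite natrM; field; rewrite pnatr_eq0 -lt0n n0.
by [].
Qed.

Definition word_functional (N1 N2 N3 N4 : nat) psi : R :=
  group_avg (@eroot0 R) 1%:R (group_avg (@eroot1 R) N1%:R
    (group_avg (@eroot2 R) N2%:R (group_avg (@eroot3 R) N3%:R
      (group_avg (@eroot4 R) N4%:R (group_avg (@eroot5 R) 1%:R psi))))) 1%g.

(* A variable rather than [20], so that [2 ^ c] in [nat] is never unfolded. *)
Definition scale_error (c : nat) (th : R) (k : nat) : R :=
  (2 ^+ (c + 2) / 2 ^+ k) `^ th.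

(** For [m = 2 ^ k], one factor [2 ^ k] of the hypotheses pays for the [m] inside [insertion_eta],
    the other one is the gain. *)
Lemma insertion_eta_le (c Nf Np Nl M k : nat) : (0 < Nf)%N -> (0 < Np)%N ->
  (0 < Nl)%N -> (M * 2 ^ k * 2 ^ k <= 2 ^ c * (Nl * Nf))%N ->
  (M ^ 2 * 2 ^ k * 2 ^ k <= 2 ^ c * (Nl * Np))%N ->
  insertion_eta R Nf Np Nl M (2 ^ k) <= 2 ^+ (c + 2) / 2 ^+ k.
Proof.
move=> Nf0 Np0 Nl0 h1 h2; rewrite /insertion_eta.
have p0 : 0 < 2 ^+ k :> R by rewrite exprn_gt0.
have quot (a b : nat) : (0 < b)%N -> (a * 2 ^ k <= 2 ^ c * b)%N ->
    a%:R / b%:R <= 2 ^+ c / 2 ^+ k :> R.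
  move=> b0 h; rewrite ler_pdivrMr ?ltr0n// mulrAC ler_pdivlMr//.
  by rewrite -!natrX -!natrM ler_nat.
have := quot _ _ _ h1; have := quot _ _ _ h2; rewrite !muln_gt0 Nl0 Np0 Nf0.
move=> /(_ isT) q2 /(_ isT) q1; rewrite natrX.
have q0 : (2 ^+ k)^-1 <= 2 ^+ c / 2 ^+ k :> R.
  by rewrite ler_peMl ?invr_ge0 ?(ltW p0)// exprn_ege1// ler1n.
have -> : 2 ^+ (c + 2) / 2 ^+ k = 2 ^+ c / 2 ^+ k + 2 ^+ c / 2 ^+ k +
    2 ^+ c / 2 ^+ k + 2 ^+ c / 2 ^+ k :> R.
  by rewrite -!mulrDl; congr (_ / _); rewrite (exprD _ c 2); ring.
have : 0 <= 2 ^+ c / 2 ^+ k :> R by rewrite divr_ge0// ?exprn_ge0// ltW.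
by move: q0 q1 q2; lra.
Qed.

Section Replace.
Variables (th C : R) (V : R -> set G) (psi : G -> R).
Hypotheses (th0 : 0 <= th) (mV : modulus V) (rpsi : ruc V psi)
  (sch : schur th C psi).

(** Both means are close to the mean without [q]; the conditions on [M'] imply those on the smaller
    [M]. *)
Lemma insertion_replace (f p q l : R -> G) (c Nf Np Nl M M' k : nat) w :
  unip_pattern f p q l -> (0 < Nf)%N -> (0 < Np)%N -> (0 < Nl)%N ->
  (M <= M')%N -> (M' * 2 ^ k * 2 ^ k <= 2 ^ c * (Nl * Nf))%N ->
  (M' ^ 2 * 2 ^ k * 2 ^ k <= 2 ^ c * (Nl * Np))%N ->
  `|group_avg f Nf%:R (group_avg p Np%:R (group_avg q M%:R
      (group_avg l Nl%:R psi))) w -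
    group_avg f Nf%:R (group_avg p Np%:R (group_avg q M'%:R
      (group_avg l Nl%:R psi))) w| <= 4 * C * scale_error c th k.
Proof.
move=> pat Nf0 Np0 Nl0 MM h1 h2.
have C0 : 0 <= C by apply: le_trans (schur_bounded sch 1%g).
have m0 : (0 < 2 ^ k)%N by rewrite expn_gt0.
have bound M0 : (M0 <= M')%N ->
    2 * C * insertion_eta R Nf Np Nl M0 (2 ^ k) `^ th <=
    2 * C * scale_error c th k.
  move=> MM0; rewrite ler_wpM2l ?mulr_ge0//.
  have pos : 0 <= insertion_eta R Nf Np Nl M0 (2 ^ k).
    by rewrite /insertion_eta !addr_ge0 ?divr_ge0 ?invr_ge0.
  apply: ge0_ler_powR => //; first by rewrite nnegrE divr_ge0 ?exprn_ge0.
  apply: insertion_eta_le => //.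
  - by apply: leq_trans h1; rewrite !leq_mul.
  - by apply: leq_trans h2; rewrite !leq_mul// leq_exp2r.
have i1 := @insertion R _ f p q l pat th C V psi Nf Np Nl M _ w th0 mV rpsi sch
  Nf0 Np0 Nl0 m0.
have i2 := @insertion R _ f p q l pat th C V psi Nf Np Nl M' _ w th0 mV rpsi sch
  Nf0 Np0 Nl0 m0.
apply: le_trans (ler_distD (group_avg f Nf%:R (group_avg p Np%:R
  (group_avg l Nl%:R psi)) w) _ _) _.
rewrite [X in _ + X]distrC.
apply: le_trans (lerD (le_trans i1 (bound _ MM)) (le_trans i2 (bound _ (leqnn _)))) _.
by apply: le_of_eq; ring.
Qed.

Lemma heisenberg_replace (f q e : R -> G) (c Nf Ne M M' k : nat) w :
  unip_pattern f (fun=> 1%g) q (fun x => e (x / 2)) -> (0 < Nf)%N ->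
  (0 < Ne)%N -> (M <= M')%N ->
  (M' * 2 ^ k * 2 ^ k <= 2 ^ c * (2 * Ne * Nf))%N ->
  `|group_avg f Nf%:R (group_avg q M%:R (group_avg e Ne%:R psi)) w -
    group_avg f Nf%:R (group_avg q M'%:R (group_avg e Ne%:R psi)) w| <=
  4 * C * scale_error c th k.
Proof.
(* A mean over the trivial group is the same for all ranges, so its range can be taken large enough
   for the quadratic condition. *)
move=> pat Nf0 Ne0 MM h; pose Np := (M' ^ 2 * 2 ^ k * 2 ^ k).+1.
have := @insertion_replace f (fun=> 1%g) q (fun x => e (x / 2)) c Nf Np
  (2 * Ne)%N M M' k w pat Nf0 isT.
rewrite !group_avg_trivial !group_avg_half; apply => //.
  by rewrite muln_gt0.
apply: leq_trans (leqnSn _) _; rewrite -/Np mulnA leq_pmull//.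
by rewrite !muln_gt0 expn_gt0.
Qed.

End Replace.

(* The exponents make each of the four changes of range from [k] to [k.+1] cost
   a power of [2^-k]: the range of a mean has to be small with respect to those
   of its neighbours in the word. *)
Definition word_seq (k : nat) psi : R :=
  word_functional (2 ^ (8 * k)) (2 ^ (10 * k)) (2 ^ (14 * k)) (2 ^ (6 * k)) psi.

(** Let [2 ^ (n_i k)] be the range of the mean over the root group [i]. Up to constants, the binding
    conditions for changing the ranges 2, 1, 3, 4 are [2 n_2 + 2 <= n_1 + n_3], [n_1 + 2 <= n_2],
    [n_3 + 2 <= n_2 + n_4] and [2 n_4 + 2 <= n_3]. The exponents 8, 10, 14, 6 are the solution of
    the four equalities. *)
Lemma word_seq_step (c : nat) (th C : R) V psi k : (20 <= c)%N -> 0 <= th -> modulus V -> ruc V psi ->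
  schur th C psi ->
  `|word_seq k psi - word_seq k.+1 psi| <= 16 * C * scale_error c th k.
Proof.
move=> c20 th0 mV rpsi sch.
have p0 a : (0 < 2 ^ a)%N by rewrite expn_gt0.
have r0 := @eroot0_one_param R; have r1 := @eroot1_one_param R.
have r2 := @eroot2_one_param R; have r3 := @eroot3_one_param R.
have r4 := @eroot4_one_param R; have r5 := @eroot5_one_param R.
have pw a b : (2 ^ a * 2 ^ b = 2 ^ (a + b))%N by rewrite expnD.
have two a : (2 * 2 ^ a = 2 ^ a.+1)%N by rewrite expnS.
have sq a : ((2 ^ a) ^ 2 = 2 ^ (a + a))%N by rewrite -mulnn expnD.
have step (e : R -> G) N (phi : G -> R) (W : R -> set G) : one_param e -> modulus W -> ruc W phi ->
    schur th C phi -> [/\ modulus (conj_modulus e N%:R W),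
      ruc (conj_modulus e N%:R W) (group_avg e N%:R phi) &
      schur th C (group_avg e N%:R phi)].
  move=> he mW rW sW; split; [exact: conj_modulusP|exact: group_avg_ruc|].
  exact: schur_group_avg rW sW.
have [mV5 rV5 sV5] := step _ 1%N _ _ r5 mV rpsi sch.
have lift (e : R -> G) N (phi phi' : G -> R) W W' (b : R) : one_param e -> modulus W -> modulus W' ->
    ruc W phi -> ruc W' phi' -> (forall u, `|phi u - phi' u| <= b) ->
    forall u, `|group_avg e N%:R phi u - group_avg e N%:R phi' u| <= b.
  by move=> he mW mW' rW rW' h u; exact: (@group_avg_dist _ _ e N%:R W W').
set N1 := (2 ^ (8 * k))%N; set N2 := (2 ^ (10 * k))%N.
set N3 := (2 ^ (14 * k))%N; set N4 := (2 ^ (6 * k))%N.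
set N1' := (2 ^ (8 * k.+1))%N; set N2' := (2 ^ (10 * k.+1))%N.
set N3' := (2 ^ (14 * k.+1))%N; set N4' := (2 ^ (6 * k.+1))%N.
have [mV4 rV4 sV4] := step _ N4 _ _ r4 mV5 rV5 sV5.
have [mV3 rV3 sV3] := step _ N3 _ _ r3 mV4 rV4 sV4.
have mono a : (a * k <= a * k.+1)%N by rewrite leq_mul2l leqnSn orbT.
(* Passing from [k] to [k.+1] costs constants, the largest one here:
   [20 (k + 1) + 2 k <= c + 14 k + 8 k] holds exactly when [20 <= c]. *)
have e1 : `|word_functional N1 N2 N3 N4 psi - word_functional N1 N2' N3 N4 psi|
    <= 4 * C * scale_error c th k.
  apply: (insertion_replace th0 mV4 rV4 sV4 _ (@pattern0123 R)); rewrite ?p0//.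
  - by rewrite /N2 /N2' leq_exp2l.
  - by rewrite /N2' /N3 muln1 !pw leq_exp2l//; lia.
  - by rewrite /N2' /N3 /N1 sq !pw leq_exp2l//; lia.
have e2 : `|word_functional N1 N2' N3 N4 psi - word_functional N1' N2' N3 N4 psi|
    <= 4 * C * scale_error c th k.
  apply: (heisenberg_replace th0 mV3 rV3 sV3 _ (@pattern012 R)); rewrite ?p0//.
  - by rewrite /N1 /N1' leq_exp2l.
  - by rewrite /N1' /N2' muln1 two !pw leq_exp2l//; lia.
have [mV2 rV2 sV2] := step _ N2' _ _ r2 mV3 rV3 sV3.
have e3 u : `|group_avg (@eroot2 R) N2'%:R (group_avg (@eroot3 R) N3%:R
      (group_avg (@eroot4 R) N4%:R (group_avg (@eroot5 R) 1%:R psi))) u -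
    group_avg (@eroot2 R) N2'%:R (group_avg (@eroot3 R) N3'%:R
      (group_avg (@eroot4 R) N4%:R (group_avg (@eroot5 R) 1%:R psi))) u|
    <= 4 * C * scale_error c th k.
  apply: (heisenberg_replace th0 mV5 rV5 sV5 _ (@pattern234 R)); rewrite ?p0//.
  - by rewrite /N3 /N3' leq_exp2l.
  - by rewrite /N3' /N4 /N2' two !pw leq_exp2l//; lia.
have e4 u : `|group_avg (@eroot2 R) N2'%:R (group_avg (@eroot3 R) N3'%:R
      (group_avg (@eroot4 R) N4%:R (group_avg (@eroot5 R) 1%:R psi))) u -
    group_avg (@eroot2 R) N2'%:R (group_avg (@eroot3 R) N3'%:R
      (group_avg (@eroot4 R) N4'%:R (group_avg (@eroot5 R) 1%:R psi))) u|
    <= 4 * C * scale_error c th k.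
  apply: (insertion_replace th0 mV rpsi sch _ (@pattern2345 R)); rewrite ?p0//.
  - by rewrite /N4 /N4' leq_exp2l.
  - by rewrite /N4' /N2' mul1n !pw leq_exp2l//; lia.
  - by rewrite /N4' /N3' sq mul1n !pw leq_exp2l//; lia.
have [mV3' rV3' sV3'] := step _ N3' _ _ r3 mV4 rV4 sV4.
have [mV2' rV2' sV2'] := step _ N2' _ _ r2 mV3' rV3' sV3'.
have [mW4 rW4 sW4] := step _ N4' _ _ r4 mV5 rV5 sV5.
have [mW3 rW3 sW3] := step _ N3' _ _ r3 mW4 rW4 sW4.
have [mW2 rW2 sW2] := step _ N2' _ _ r2 mW3 rW3 sW3.
(* Means do not increase uniform distances, so an estimate inside the word passes through the outer
   means. *)
have up (phi phi' : G -> R) W W' : modulus W -> modulus W' -> ruc W phi -> ruc W' phi' ->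
    schur th C phi -> schur th C phi' ->
    (forall u, `|phi u - phi' u| <= 4 * C * scale_error c th k) ->
    `|group_avg (@eroot0 R) 1%:R (group_avg (@eroot1 R) N1'%:R phi) 1%g -
      group_avg (@eroot0 R) 1%:R (group_avg (@eroot1 R) N1'%:R phi') 1%g| <=
    4 * C * scale_error c th k.
  move=> mW mW' rW rW' sW sW' h.
  have [ma ra _] := step _ N1' _ _ r1 mW rW sW.
  have [mb rb _] := step _ N1' _ _ r1 mW' rW' sW'.
  exact: (lift _ 1%N _ _ _ _ _ r0 ma mb ra rb
    (lift _ N1' _ _ _ _ _ r1 mW mW' rW rW' h) 1%g).
have e3' := up _ _ _ _ mV2 mV2' rV2 rV2' sV2 sV2' e3.
have e4' := up _ _ _ _ mV2' mW2 rV2' rW2 sV2' sW2 e4.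
have tri (x y z a b : R) : `|x - y| <= a -> `|y - z| <= b -> `|x - z| <= a + b.
  by move=> h1 h2; rewrite (le_trans (ler_distD y _ _))// lerD.
have -> : 16 * C * scale_error c th k = (4 * C * scale_error c th k +
    4 * C * scale_error c th k) + (4 * C * scale_error c th k +
    4 * C * scale_error c th k) by ring.
exact: tri (tri _ _ _ _ _ e1 e2) (tri _ _ _ _ _ e3' e4').
Qed.

End Words.

Section GroupAvg.
Context (R : realType) (G : lcGroupType).
Implicit Types (psi : G -> R) (V : R -> set G).

Lemma group_avg_const (e : R -> G) N c : group_avg e N (fun=> c) = (fun=> c : R).
Proof. by apply/funext => w; rewrite /group_avg average_const. Qed.

Lemma group_avg_le (e : R -> G) N V psi c w : one_param e -> modulus V -> 0 <= N ->
  ruc V psi -> (forall x, `|psi (w * e x)%g| <= c) -> `|group_avg e N psi w| <= c.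
Proof.
move=> he mV N0 rpsi h; rewrite -[group_avg _ _ _ _]subr0.
rewrite -[X in _ - X](@average_const R N 0) /group_avg.
apply: average_dist => //; first exact: ruc_uc rpsi.
- by move=> d d0; exists 1 => // x y _; rewrite subrr normr0 ltW.
- by move=> x _; rewrite subr0.
Qed.

Lemma group_avg_lin (e : R -> G) N V V' a psi psi' : one_param e -> modulus V ->
  modulus V' -> 0 <= N -> ruc V psi -> ruc V' psi' ->
  group_avg e N (fun w => a * psi w + psi' w) =
  (fun w => a * group_avg e N psi w + group_avg e N psi' w).
Proof.
move=> he mV mV' N0 r r'; apply/funext => w.
by rewrite /group_avg average_lin//; [exact: ruc_uc r|exact: ruc_uc r'].
Qed.

(* [combination s psi] for a finite signed measure [s] *)
Definition combination (s : seq (R * G)) psi : R := \sum_(x <- s) x.1 * psi x.2.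

(** The mass bound will give the norm of the limit functional. Choosing [s] before [psi] will give
    approximation in norm, not only pointwise. *)
Definition approximable (L : (G -> R) -> R) V := forall eps, 0 < eps ->
  exists2 s, \sum_(x <- s) `|x.1| <= 1 &
    forall psi, ruc V psi -> `|L psi - combination s psi| <= eps.

Lemma approximable_eval V : approximable (fun psi => psi 1%g) V.
Proof.
move=> eps eps0; exists [:: (1, 1%g)]; first by rewrite big_seq1 normr1.
by move=> psi _; rewrite /combination big_seq1 mul1r subrr normr0 ltW.
Qed.

Lemma approximable_avg (L : (G -> R) -> R) V (e : R -> G) N : one_param e ->
  modulus V -> 0 <= N ->
  approximable L (conj_modulus e N V) -> approximable (fun psi => L (group_avg e N psi)) V.
Proof.
move=> he mV N0 aL eps eps0.
have e20 : 0 < eps / 2 by rewrite divr_gt0.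
have [s s1 hs] := aL _ e20.
have [n0 hn] := group_avg_approx he mV N0 e20.
pose n := n0.+1.
exists [seq (x.1 / n%:R, (x.2 * e (j%:R * (N / n%:R))%R)%g) | x <- s, j <- index_iota 0 n].
  rewrite big_allpairs_dep /=; apply: le_trans s1; apply: ler_sum => x _.
  rewrite sumr_const_nat subn0 normrM normfV normr_nat -[leLHS]mulr_natr.
  by rewrite divfK// pnatr_eq0.
move=> psi rpsi.
have -> : combination [seq (x.1 / n%:R, (x.2 * e (j%:R * (N / n%:R))%R)%g) |
    x <- s, j <- index_iota 0 n] psi = combination s (group_sum n e N psi).
  rewrite /combination big_allpairs_dep /=; apply: eq_bigr => x _.
  by rewrite /group_sum /riemann_sum mulrA mulr_sumr.
have -> : eps = eps / 2 + eps / 2 by field.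
apply: le_trans (ler_distD (combination s (group_avg e N psi)) _ _) _.
apply: lerD; first exact/hs/group_avg_ruc.
rewrite /combination -sumrB; apply: le_trans (ler_norm_sum _ _ _) _.
apply: (@le_trans _ _ (\sum_(x <- s) `|x.1| * (eps / 2))).
  apply: ler_sum => x _; rewrite -mulrBr normrM ler_wpM2l//.
  exact: (hn _ rpsi n (leqnSn _) isT).
by rewrite -mulr_suml ler_piMl// ltW.
Qed.

End GroupAvg.

Section WordFunctional.
Context (R : realType).
Local Notation G := (Sp2 R).
Implicit Types (psi : G -> R) (V : R -> set G).

Lemma word_seq_const k (c : R) : word_seq k (fun=> c) = c.
Proof.
rewrite /word_seq /word_functional (group_avg_const (@eroot5 R)).
rewrite (group_avg_const (@eroot4 R)) (group_avg_const (@eroot3 R)).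
rewrite (group_avg_const (@eroot2 R)) (group_avg_const (@eroot1 R)).
by rewrite (group_avg_const (@eroot0 R)).
Qed.

Lemma word_seq_approximable k V : modulus V -> approximable (@word_seq R k) V.
Proof.
move=> mV; rewrite /word_seq /word_functional.
have n0 (n : nat) : 0 <= n%:R :> R by [].
have cm (e : R -> G) (n : nat) W : one_param e -> modulus W ->
    modulus (conj_modulus e n%:R W) by move=> *; exact: conj_modulusP.
have r0 := @eroot0_one_param R; have r1 := @eroot1_one_param R.
have r2 := @eroot2_one_param R; have r3 := @eroot3_one_param R.
have r4 := @eroot4_one_param R; have r5 := @eroot5_one_param R.
have m5 := cm _ 1%N _ r5 mV.
have m4 := cm _ (2 ^ (6 * k))%N _ r4 m5.
have m3 := cm _ (2 ^ (14 * k))%N _ r3 m4.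
have m2 := cm _ (2 ^ (10 * k))%N _ r2 m3.
have m1 := cm _ (2 ^ (8 * k))%N _ r1 m2.
have A := @approximable_eval R G.
have {A} A := approximable_avg r0 m1 (n0 1%N) (A _).
have {A} A := approximable_avg r1 m2 (n0 (2 ^ (8 * k))%N) A.
have {A} A := approximable_avg r2 m3 (n0 (2 ^ (10 * k))%N) A.
have {A} A := approximable_avg r3 m4 (n0 (2 ^ (14 * k))%N) A.
have {A} A := approximable_avg r4 m5 (n0 (2 ^ (6 * k))%N) A.
exact: (approximable_avg r5 mV (n0 1%N) A).
Qed.

Lemma word_seq_lin k V V' a psi psi' : modulus V -> modulus V' ->
  ruc V psi -> ruc V' psi' ->
  word_seq k (fun w => a * psi w + psi' w) = a * word_seq k psi + word_seq k psi'.
Proof.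
move=> mV mV' rpsi rpsi'; rewrite /word_seq /word_functional.
have step (e : R -> G) (N : nat) (phi : G -> R) (W : R -> set G) :
    one_param e -> modulus W -> ruc W phi ->
    modulus (conj_modulus e N%:R W) /\
    ruc (conj_modulus e N%:R W) (group_avg e N%:R phi).
  by move=> he mW rW; split; [exact: conj_modulusP|exact: group_avg_ruc].
have r0 := @eroot0_one_param R; have r1 := @eroot1_one_param R.
have r2 := @eroot2_one_param R; have r3 := @eroot3_one_param R.
have r4 := @eroot4_one_param R; have r5 := @eroot5_one_param R.
have [a5 b5] := step _ 1%N _ _ r5 mV rpsi.
have [a4 b4] := step _ (2 ^ (6 * k))%N _ _ r4 a5 b5.
have [a3 b3] := step _ (2 ^ (14 * k))%N _ _ r3 a4 b4.
have [a2 b2] := step _ (2 ^ (10 * k))%N _ _ r2 a3 b3.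
have [a1 b1] := step _ (2 ^ (8 * k))%N _ _ r1 a2 b2.
have [c5 d5] := step _ 1%N _ _ r5 mV' rpsi'.
have [c4 d4] := step _ (2 ^ (6 * k))%N _ _ r4 c5 d5.
have [c3 d3] := step _ (2 ^ (14 * k))%N _ _ r3 c4 d4.
have [c2 d2] := step _ (2 ^ (10 * k))%N _ _ r2 c3 d3.
have [c1 d1] := step _ (2 ^ (8 * k))%N _ _ r1 c2 d2.
rewrite (group_avg_lin _ r5 mV mV' _ rpsi rpsi')//.
rewrite (group_avg_lin _ r4 a5 c5 _ b5 d5)//.
rewrite (group_avg_lin _ r3 a4 c4 _ b4 d4)//.
rewrite (group_avg_lin _ r2 a3 c3 _ b3 d3)//.
rewrite (group_avg_lin _ r1 a2 c2 _ b2 d2)//.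
by rewrite (group_avg_lin _ r0 a1 c1 _ b1 d1).
Qed.

(** The steps decay like [2 ^ (- th k)], and summing them gives the [1 / (1 - rho)] in [K]. The
    constants are chosen before [V]: the rate does not depend on the modulus of continuity. *)
Lemma word_seq_cauchy (th : R) : 0 < th -> exists K rho : R,
  [/\ 0 <= K, 0 <= rho < 1 &
   forall (C : R) V psi, modulus V -> ruc V psi -> schur th C psi ->
   forall k m, (k <= m)%N ->
     `|word_seq k psi - word_seq m psi| <= C * K * rho ^+ k].
Proof.
move=> th0.
have [c c20] : exists c, (20 <= c)%N by exists 20%N.
pose rho := 2 `^ (- th) : R.
have rho0 : 0 < rho by rewrite powR_gt0.
have rho1 : rho < 1.
  rewrite /rho powRN invf_lt1 ?powR_gt0//.
  rewrite -[X in X < _](@powRr0 _ 2) /powR pnatr_eq0 /= ltr_expR ltr_pM2r ?ln_gt0//.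
  by rewrite ltr1n.
have om0 : 0 < 1 - rho by rewrite subr_gt0.
pose K := 16 * (2 ^+ (c + 2)) `^ th / (1 - rho).
have K0 : 0 <= K by rewrite /K divr_ge0 ?mulr_ge0 ?powR_ge0// ltW.
exists K, rho; split => //; first by rewrite ltW.
move=> C V psi mV rpsi sch.
have C0 : 0 <= C by apply: le_trans (schur_bounded sch 1%g).
have serr k : scale_error c th k = (2 ^+ (c + 2)) `^ th * rho ^+ k.
  rewrite /scale_error powRM ?exprn_ge0 ?invr_ge0 ?exprn_ge0//; congr (_ * _).
  rewrite /rho -powR_mulrn ?powR_ge0// -powRrM mulrC -powR_mulrn//.
  by rewrite -powRN -!powRrM; congr (_ `^ _); ring.
have step k := @word_seq_step R c th C V psi k c20 (ltW th0) mV rpsi sch.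
suff main d k : `|word_seq k psi - word_seq (k + d) psi| <= C * K * rho ^+ k.
  by move=> k m km; have := main (m - k)%N k; rewrite (subnKC km).
elim: d k => [|d IH] k.
  by rewrite addn0 subrr normr0 mulr_ge0 ?exprn_ge0 ?(ltW rho0)// mulr_ge0.
have tri (x y z a b : R) : `|x - y| <= a -> `|y - z| <= b -> `|x - z| <= a + b.
  by move=> h1 h2; rewrite (le_trans (ler_distD y _ _))// lerD.
rewrite addnS -addSn; apply: le_trans (tri _ _ _ _ _ (step k) (IH k.+1)) _.
apply: le_of_eq; rewrite serr exprS /K; move: (rho ^+ k) => z; field.
by rewrite gt_eqF.
Qed.

Definition entry (i j : nat) (w : G) : R :=
  Sp2_mx w (@inord (2 + 1) i) (@inord (2 + 1) j).

Lemma entryE i j a00 a01 a02 a03 a10 a11 a12 a13 a20 a21 a22 a23 a30 a31 a32 a33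
    (w : G) :
  Sp2_mx w = mx4 a00 a01 a02 a03 a10 a11 a12 a13 a20 a21 a22 a23 a30 a31 a32 a33 ->
  (i < 4)%N -> (j < 4)%N ->
  entry i j w = nth 0 (nth [::] [:: [:: a00; a01; a02; a03];
    [:: a10; a11; a12; a13]; [:: a20; a21; a22; a23];
    [:: a30; a31; a32; a33]] i) j.
Proof. by move=> wE i4 j4; rewrite /entry wE mxE !inordK. Qed.

Lemma Sp2_mx_entries (w : G) : Sp2_mx w = mx4
  (entry 0 0 w) (entry 0 1 w) (entry 0 2 w) (entry 0 3 w)
  (entry 1 0 w) (entry 1 1 w) (entry 1 2 w) (entry 1 3 w)
  (entry 2 0 w) (entry 2 1 w) (entry 2 2 w) (entry 2 3 w)
  (entry 3 0 w) (entry 3 1 w) (entry 3 2 w) (entry 3 3 w).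
Proof.
apply/matrixP => i j; rewrite [RHS]mxE /entry.
by case: i => -[|[|[|[|//]]]] hi; case: j => -[|[|[|[|//]]]] hj /=;
  congr (Sp2_mx w _ _); apply: val_inj; rewrite /= inordK.
Qed.

(* Words in [eroot0, ..., eroot3] fix the row [(0, 0, 1, 0)], so that the factor
   [eroot4 x] puts [x] in entry [(2, 3)]. *)
Definition std_row (w : G) :=
  [/\ entry 2 0 w = 0, entry 2 1 w = 0, entry 2 2 w = 1 & entry 2 3 w = 0].

Lemma std_row1 : std_row 1%g.
Proof.
have E : Sp2_mx (1%g : G) = 1%:M by [].
by rewrite mx4_1 in E; split; rewrite (entryE E).
Qed.

Lemma Sp2_mx_mul (w g : G) a00 a01 a02 a03 a10 a11 a12 a13 a20 a21 a22 a23
    a30 a31 a32 a33 :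
  Sp2_mx g = mx4 a00 a01 a02 a03 a10 a11 a12 a13 a20 a21 a22 a23 a30 a31 a32 a33 ->
  let r i := entry 2 i w in
  [/\ entry 2 0 (w * g)%g = r 0%N * a00 + r 1%N * a10 + r 2%N * a20 + r 3%N * a30,
      entry 2 1 (w * g)%g = r 0%N * a01 + r 1%N * a11 + r 2%N * a21 + r 3%N * a31,
      entry 2 2 (w * g)%g = r 0%N * a02 + r 1%N * a12 + r 2%N * a22 + r 3%N * a32 &
      entry 2 3 (w * g)%g = r 0%N * a03 + r 1%N * a13 + r 2%N * a23 + r 3%N * a33].
Proof.
move=> gE; have E := Sp2_mxM w g.
by rewrite (Sp2_mx_entries w) gE mx4M in E; split; rewrite (entryE E).
Qed.

Lemma std_row_eroot0 w x : std_row w -> std_row (w * eroot0 x)%g.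
Proof.
move=> [e0 e1 e2 e3]; have [] := @Sp2_mx_mul w (eroot0 x) _ _ _ _ _ _ _ _ _ _ _ _ _ _ _ _ erefl.
by rewrite e0 e1 e2 e3 => E0 E1 E2 E3; split; rewrite ?E0 ?E1 ?E2 ?E3; ring.
Qed.

Lemma std_row_eroot1 w x : std_row w -> std_row (w * eroot1 x)%g.
Proof.
move=> [e0 e1 e2 e3]; have [] := @Sp2_mx_mul w (eroot1 x) _ _ _ _ _ _ _ _ _ _ _ _ _ _ _ _ erefl.
by rewrite e0 e1 e2 e3 => E0 E1 E2 E3; split; rewrite ?E0 ?E1 ?E2 ?E3; ring.
Qed.

Lemma std_row_eroot2 w x : std_row w -> std_row (w * eroot2 x)%g.
Proof.
move=> [e0 e1 e2 e3]; have [] := @Sp2_mx_mul w (eroot2 x) _ _ _ _ _ _ _ _ _ _ _ _ _ _ _ _ erefl.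
by rewrite e0 e1 e2 e3 => E0 E1 E2 E3; split; rewrite ?E0 ?E1 ?E2 ?E3; ring.
Qed.

Lemma std_row_eroot3 w x : std_row w -> std_row (w * eroot3 x)%g.
Proof.
move=> [e0 e1 e2 e3]; have [] := @Sp2_mx_mul w (eroot3 x) _ _ _ _ _ _ _ _ _ _ _ _ _ _ _ _ erefl.
by rewrite e0 e1 e2 e3 => E0 E1 E2 E3; split; rewrite ?E0 ?E1 ?E2 ?E3; ring.
Qed.

Lemma entry23_eroot4 w x : std_row w -> entry 2 3 (w * eroot4 x)%g = x.
Proof.
move=> [e0 e1 e2 e3]; have [] := @Sp2_mx_mul w (eroot4 x) _ _ _ _ _ _ _ _ _ _ _ _ _ _ _ _ erefl.
by rewrite e0 e1 e2 e3 => _ _ _ ->; ring.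
Qed.

Lemma entry23_eroot5 w x : entry 2 3 (w * eroot5 x)%g = entry 2 3 w.
Proof.
have [_ _ _ ->] := @Sp2_mx_mul w (eroot5 x) _ _ _ _ _ _ _ _ _ _ _ _ _ _ _ _ erefl.
ring.
Qed.

(** Over a word with a standard row, the mean over [eroot4] spreads entry [(2, 3)] uniformly over
    [[0, 2 ^ (6 k)]], and [eroot5] leaves that entry alone. Hence [|psi| <= e] except on a
    proportion of about [n / 2 ^ (6 k)]. *)
Lemma word_seq_tail k n V (B e : R) psi : modulus V -> ruc V psi ->
  0 <= e -> (forall w, `|psi w| <= B) ->
  (forall w, n%:R < `|entry 2 3 w| -> `|psi w| <= e) ->
  `|word_seq k psi| <= e + B * (n.+1%:R / (2 ^ (6 * k))%:R).
Proof.
move=> mV rpsi e0 psiB psie; rewrite /word_seq /word_functional.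
have step (e' : R -> G) (N : nat) (phi : G -> R) (W : R -> set G) :
    one_param e' -> modulus W -> ruc W phi ->
    modulus (conj_modulus e' N%:R W) /\
    ruc (conj_modulus e' N%:R W) (group_avg e' N%:R phi).
  by move=> he mW rW; split; [exact: conj_modulusP|exact: group_avg_ruc].
have r0 := @eroot0_one_param R; have r1 := @eroot1_one_param R.
have r2 := @eroot2_one_param R; have r3 := @eroot3_one_param R.
have r4 := @eroot4_one_param R; have r5 := @eroot5_one_param R.
have [a5 b5] := step _ 1%N _ _ r5 mV rpsi.
have [a4 b4] := step _ (2 ^ (6 * k))%N _ _ r4 a5 b5.
have [a3 b3] := step _ (2 ^ (14 * k))%N _ _ r3 a4 b4.
have [a2 b2] := step _ (2 ^ (10 * k))%N _ _ r2 a3 b3.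
have [a1 b1] := step _ (2 ^ (8 * k))%N _ _ r1 a2 b2.
set phi5 := group_avg (@eroot5 R) _ _ in b5 *.
have phi5B w : `|phi5 w| <= B by apply: (group_avg_le r5 mV).
have phi5e w : n%:R < `|entry 2 3 w| -> `|phi5 w| <= e.
  move=> nw; apply: (group_avg_le r5 mV) => // x.
  by apply: psie; rewrite entry23_eroot5.
set bnd := _ + _.
have h4 w : std_row w -> `|group_avg (@eroot4 R) (2 ^ (6 * k))%:R phi5 w| <= bnd.
  move=> sw; apply: average_tail => //; first by rewrite expn_gt0.
    exact: (ruc_uc w r4 a5 b5).
  move=> x nx; apply: phi5e; rewrite entry23_eroot4//.
  by rewrite (lt_le_trans nx)// ler_norm.
have up (e' : R -> G) (N : nat) (phi : G -> R) (W : R -> set G) :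
    one_param e' -> modulus W -> ruc W phi ->
    (forall w x, std_row w -> std_row (w * e' x)%g) ->
    (forall w, std_row w -> `|phi w| <= bnd) ->
    forall w, std_row w -> `|group_avg e' N%:R phi w| <= bnd.
  move=> he mW rW stdP h w sw; apply: (group_avg_le he mW _ rW) => // x.
  exact/h/stdP.
have h3 := up _ (2 ^ (14 * k))%N _ _ r3 a4 b4 std_row_eroot3 h4.
have h2 := up _ (2 ^ (10 * k))%N _ _ r2 a3 b3 std_row_eroot2 h3.
have h1 := up _ (2 ^ (8 * k))%N _ _ r1 a2 b2 std_row_eroot1 h2.
exact: (up _ 1%N _ _ r0 a1 b1 std_row_eroot0 h1 _ std_row1).
Qed.

End WordFunctional.

(** * Multipliers with values in SQ_p spaces *)

Section RealNorm.
Context (R : realType).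

Lemma rnormE (E : normedZmodType R[i]) (x : E) : ((rnorm x)%:C)%C = `|x|.
Proof. exact/RRe_real/normr_real. Qed.

Lemma rnorm_ge0 (E : normedZmodType R[i]) (x : E) : 0 <= rnorm x.
Proof. by rewrite -lecR rnormE normr_ge0. Qed.

Lemma rnormD (E : normedZmodType R[i]) (x y : E) : rnorm (x + y) <= rnorm x + rnorm y.
Proof. by rewrite -lecR rmorphD /= !rnormE ler_normD. Qed.

Lemma rnorm0 (E : normedZmodType R[i]) : rnorm (0 : E) = 0.
Proof. by rewrite /rnorm normr0. Qed.

Lemma rnormN (E : normedZmodType R[i]) (x : E) : rnorm (- x) = rnorm x.
Proof. by rewrite /rnorm normrN. Qed.

Lemma rnorm_sum (E : normedZmodType R[i]) (I : finType) (F : I -> E) :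
  rnorm (\sum_i F i) <= \sum_i rnorm (F i).
Proof.
elim/big_rec2: _ => [|i y1 y2 _ h]; first by rewrite rnorm0.
by apply: le_trans (rnormD _ _) _; rewrite lerD2l.
Qed.

Lemma rnormZ (E : normedModType R[i]) (a : R[i]) (x : E) :
  rnorm (a *: x) = rnorm a * rnorm x.
Proof. by apply: complexI; rewrite rmorphM /= !rnormE normrZ. Qed.

Lemma rnormM (a b : R[i]) : rnorm (a * b) = rnorm a * rnorm b.
Proof. by apply: complexI; rewrite rmorphM /= !rnormE normrM. Qed.

Lemma rnormcE (z : R[i]) : rnorm z = Num.sqrt (complex.Re z ^+ 2 + complex.Im z ^+ 2).
Proof. by rewrite /rnorm normc_def. Qed.

Lemma rnorm_real (a : R) : rnorm (a%:C)%C = `|a|.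
Proof. by rewrite rnormcE /= expr0n addr0 sqrtr_sqr. Qed.

Lemma Re_le_rnorm (z : R[i]) : `|complex.Re z| <= rnorm z.
Proof. by rewrite rnormcE -sqrtr_sqr ler_wsqrtr// lerDl sqr_ge0. Qed.

Lemma Im_le_rnorm (z : R[i]) : `|complex.Im z| <= rnorm z.
Proof. by rewrite rnormcE -sqrtr_sqr ler_wsqrtr// lerDr sqr_ge0. Qed.

Lemma rnorm_le_ReIm (z : R[i]) : rnorm z <= `|complex.Re z| + `|complex.Im z|.
Proof.
rewrite rnormcE -[leRHS]ger0_norm ?addr_ge0// -sqrtr_sqr ler_wsqrtr//.
rewrite sqrrD !real_normK ?num_real// lerD2r lerDl.
by rewrite mulrn_wge0// mulr_ge0.
Qed.

Lemma Re_sum (I : finType) (F : I -> R[i]) :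
  complex.Re (\sum_i F i) = \sum_i complex.Re (F i).
Proof. by elim/big_rec2: _ => [|i y1 y2 _ <-]//; case: (F i) y2 => a b []. Qed.

Lemma Im_sum (I : finType) (F : I -> R[i]) :
  complex.Im (\sum_i F i) = \sum_i complex.Im (F i).
Proof. by elim/big_rec2: _ => [|i y1 y2 _ <-]//; case: (F i) y2 => a b []. Qed.

Lemma Re_realM (a : R) (z : R[i]) : complex.Re ((a%:C)%C * z) = a * complex.Re z.
Proof. by case: z => x y /=; rewrite mul0r subr0. Qed.

Lemma Im_realM (a : R) (z : R[i]) : complex.Im ((a%:C)%C * z) = a * complex.Im z.
Proof. by case: z => x y /=; rewrite mul0r addr0. Qed.

Lemma le_inf_lb (S : set R) (x : R) : S x -> (forall y, S y -> 0 <= y) -> inf S <= x.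
Proof. by move=> Sx S0; apply: inf_lbound => //; exists 0 => y /S0. Qed.

End RealNorm.

Section DualNorm.
Context (R : realType) (E : completeNormedModType R[i]).

Lemma banach_dual_bounded (l : E -> R[i]) : banach_dual l ->
  has_ubound [set rnorm (l x) | x in [set x : E | rnorm x <= 1]].
Proof.
move=> [sl cl].
have l0 : l 0 = 0 by have := sl (-1) 0 0; rewrite scaler0 addr0 mulN1r addNr.
have := cl 0; move=> /cvgrPdist_lt /(_ 1 ltr01) /nbhs_ballP[e /= e0 he].
have e2 : 0 < e / 2 by rewrite divr_gt0.
(* The radius [e] is a positive element of [R[i]], hence real; half of it provides a radius in
   [R]. *)
have [r [r0 re]] : exists r : R, 0 < r /\ (r%:C)%C < e.
  have er : e / 2 = ((complex.Re (e / 2))%:C)%C by rewrite RRe_real// gtr0_real.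
  exists (complex.Re (e / 2)); rewrite -ltcR -er; split => //.
  by rewrite ltr_pdivrMr// ltr_pMr// ltr1n.
exists r^-1 => _ [x /= x1 <-].
have : `|l ((r%:C)%C *: x)| < 1.
  have H : ball (0 : E) e ((r%:C)%C *: x).
    rewrite -ball_normE /= sub0r normrN normrZ; apply: le_lt_trans re.
    rewrite -(rnormE x) -(rnormE (r%:C)%C) rnorm_real -rmorphM /= lecR.
    by rewrite (gtr0_norm r0) ler_piMr// ltW.
  by have := he _ H; rewrite /= l0 sub0r normrN.
have -> : l ((r%:C)%C *: x) = (r%:C)%C * l x.
  by have := sl (r%:C)%C x 0; rewrite !addr0 l0 addr0.
rewrite normrM -!rnormE rnorm_real -rmorphM /= -[X in _ < X](_ : (1%:C)%C = 1)//.
rewrite ltcR (gtr0_norm r0) mulrC -ltr_pdivlMr// div1r.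
exact: ltW.
Qed.

Lemma dualnorm_le (l : E -> R[i]) (x : E) : banach_dual l ->
  rnorm (l x) <= dualnorm l * rnorm x.
Proof.
move=> dl; have hb := banach_dual_bounded dl; have [sl _] := dl.
have l0 : l 0 = 0 by have := sl (-1) 0 0; rewrite scaler0 addr0 mulN1r addNr.
have [x0|x0] := eqVneq (rnorm x) 0.
  have -> : x = 0 by apply/eqP; rewrite -normr_eq0 -rnormE x0.
  by rewrite l0 !rnorm0 mulr0.
have xp : 0 < rnorm x by rewrite lt_neqAle eq_sym x0 rnorm_ge0.
rewrite -ler_pdivrMr//; apply: sup_ubound => //.
exists ((((rnorm x)^-1)%:C)%C *: x) => /=.
  by rewrite rnormZ rnorm_real ger0_norm ?invr_ge0 ?(ltW xp)// mulVf.
have := sl (((rnorm x)^-1)%:C)%C x 0; rewrite !addr0 l0 addr0 => ->.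
by rewrite rnormM rnorm_real ger0_norm ?invr_ge0 ?(ltW xp)// mulrC.
Qed.

Lemma dualnorm_ge0 (l : E -> R[i]) : banach_dual l -> 0 <= dualnorm l.
Proof.
move=> dl; have [sl _] := dl.
have l0 : l 0 = 0 by have := sl (-1) 0 0; rewrite scaler0 addr0 mulN1r addNr.
apply: sup_ubound; first exact: banach_dual_bounded.
by exists 0; rewrite /= ?rnorm0 ?l0 ?rnorm0.
Qed.

Lemma banach_dual_sum (I : finType) (l : E -> R[i]) (a : I -> R[i]) (x : I -> E) :
  banach_dual l -> l (\sum_i a i *: x i) = \sum_i a i * l (x i).
Proof.
move=> [sl _].
have l0 : l 0 = 0 by have := sl (-1) 0 0; rewrite scaler0 addr0 mulN1r addNr.
by elim/big_rec2: _ => [//|i y1 y2 _ <-]; rewrite sl.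
Qed.

End DualNorm.

Lemma powR_add_le (R : realType) (x y p : R) : 0 <= x -> 0 <= y -> 0 <= p ->
  (x + y) `^ p <= 2 `^ p * (x `^ p + y `^ p).
Proof.
move=> x0 y0 p0.
wlog xy : x y x0 y0 / x <= y => [hw|].
  by case: (leP x y) => [/hw|/ltW /hw]; [apply|rewrite addrC [X in _ * X]addrC; apply].
apply: (@le_trans _ _ ((2 * y) `^ p)).
  by apply: ge0_ler_powR => //; rewrite ?nnegrE ?addr_ge0 ?mulr_ge0//; lra.
by rewrite powRM// ler_wpM2l ?powR_ge0// lerDr powR_ge0.
Qed.

(** * Finite matrices acting on vectors of L_p *)

Section MatrixOnLp.
Context (R : realType) (I J : finType) (T : I -> J -> R) (kappa N p : R).
Hypotheses (k0 : 0 < kappa) (N1 : 1 < N) (p1 : 1 < p).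
Hypothesis rowT : forall i, \sum_j `|T i j| <= 1.
Hypothesis colT : forall j, \sum_i `|T i j| <= kappa.
Hypothesis gram :
  forall i, \sum_i' `|\sum_j T i j * T i' j| <= kappa / N ^+ 8.

Local Notation K := (interp_const N p^-1 (1 - p^-1)).

(** A real matrix acts separately on real and imaginary parts; recombining them costs the factor
    [2 * 2 ^ p]. *)
Lemma interpolation_complex (z : J -> R[i]) :
  \sum_i rnorm (\sum_j ((T i j)%:C)%C * z j) `^ p <=
  2 * (4 * K) `^ p * kappa * \sum_j rnorm (z j) `^ p.
Proof.
have p0 : 0 <= p := ltW (lt_trans ltr01 p1).
have K0 := interp_const_gt0 p^-1 (1 - p^-1) N1.
have hR := interpolation_lp (fun j => complex.Re (z j)) k0 N1 p1 rowT colT gram.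
have hI := interpolation_lp (fun j => complex.Im (z j)) k0 N1 p1 rowT colT gram.
apply: (@le_trans _ _ (\sum_i 2 `^ p * (`|\sum_j T i j * complex.Re (z j)| `^ p +
    `|\sum_j T i j * complex.Im (z j)| `^ p))).
  apply: ler_sum => i _.
  apply: le_trans (powR_add_le (normr_ge0 _) (normr_ge0 _) p0).
  apply: ge0_ler_powR => //; rewrite ?nnegrE ?rnorm_ge0 ?addr_ge0//.
  apply: le_trans (rnorm_le_ReIm _) _; rewrite Re_sum Im_sum.
  under eq_bigr do rewrite Re_realM.
  by under [X in _ + `|X|]eq_bigr do rewrite Im_realM.
rewrite -mulr_sumr big_split /=.
have bR : \sum_j `|complex.Re (z j)| `^ p <= \sum_j rnorm (z j) `^ p.
  apply: ler_sum => j _; apply: ge0_ler_powR => //; rewrite ?nnegrE ?rnorm_ge0//.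
  exact: Re_le_rnorm.
have bI : \sum_j `|complex.Im (z j)| `^ p <= \sum_j rnorm (z j) `^ p.
  apply: ler_sum => j _; apply: ge0_ler_powR => //; rewrite ?nnegrE ?rnorm_ge0//.
  exact: Im_le_rnorm.
have -> : 4 * K = 2 * (2 * K) by ring.
rewrite (powRM p (_ : 0 <= 2))// ?mulr_ge0 ?(ltW K0)//.
move: hR hI bR bI; move: (\sum_j `|complex.Re (z j)| `^ p) (\sum_i _) (\sum_j rnorm _ `^ p) => ZR SR Z.
move: (\sum_j _) (\sum_i _) => ZI SI hR hI bR bI.
have := powR_ge0 2 p; have := powR_ge0 (2 * K) p.
move: hR hI; move: (2 `^ p) ((2 * K) `^ p) => x y hR hI y0 x0.
have -> : 2 * (x * y) * kappa * Z = x * (y * (kappa * Z) + y * (kappa * Z)) by ring.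
rewrite ler_wpM2l// lerD//.
- by apply: le_trans hR _; rewrite ler_wpM2l// ler_wpM2l// ltW.
- by apply: le_trans hI _; rewrite ler_wpM2l// ler_wpM2l// ltW.
Qed.

Context d (X : measurableType d) (mu : {measure set X -> \bar R}).
Implicit Types (f : X -> R[i]).

Lemma measurable_rnorm f : cmeasurable f -> measurable_fun setT (fun x => rnorm (f x)).
Proof.
move=> [mr mi].
rewrite (_ : (fun x => _) = fun x =>
  (complex.Re (f x) ^+ 2 + complex.Im (f x) ^+ 2) `^ (2^-1)).
  apply: (measurableT_comp (measurable_powR _)).
  by apply: measurable_funD; exact: measurable_funX.
by apply/funext => x; rewrite rnormcE powR12_sqrt// addr_ge0 ?sqr_ge0.
Qed.

Lemma measurable_rnormp f q : cmeasurable f ->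
  measurable_fun setT (fun x => (rnorm (f x) `^ q)%:E).
Proof.
move=> mf; apply/measurable_EFinP.
exact: (measurableT_comp (measurable_powR _) (measurable_rnorm mf)).
Qed.

Lemma Lpnorm_ge0 q f : 0 <= Lpnorm mu q f.
Proof. by apply: fine_ge0; exact: Lnorm_ge0. Qed.

Lemma Lpnorm_powR q f : 0 < q -> Lp mu q f ->
  ((Lpnorm mu q f) `^ q)%:E = (\int[mu]_x (rnorm (f x) `^ q)%:E)%E.
Proof.
move=> q0 [mf ff].
have fin : eLpnorm mu q f \is a fin_num.
  by rewrite ge0_fin_numE// Lnorm_ge0.
rewrite -poweR_EFin /Lpnorm fineK// /eLpnorm poweR_Lnorm ?gt_eqF//.
apply: eq_integral => x _ /=.
by rewrite ger0_norm ?rnorm_ge0.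
Qed.

(** The scalar inequality is integrated over [X], so the constant for vectors of L_p is the one for
    scalars. *)
Lemma matrix_Lp (f : J -> X -> R[i]) (a : R) :
  (forall j, Lp mu p (f j)) -> (forall j, Lpnorm mu p (f j) <= a) ->
  (forall i, Lp mu p (fun x => \sum_j ((T i j)%:C)%C * f j x)) ->
  \sum_i Lpnorm mu p (fun x => \sum_j ((T i j)%:C)%C * f j x) `^ p <=
  2 * (4 * K) `^ p * kappa * (#|J|%:R * a `^ p).
Proof.
move=> fL fa hL.
have p0 : 0 < p := lt_trans ltr01 p1.
have K0 := interp_const_gt0 p^-1 (1 - p^-1) N1.
have c0 : 0 <= 2 * (4 * K) `^ p * kappa by rewrite !mulr_ge0 ?powR_ge0// ltW.
apply: (@le_trans _ _ (2 * (4 * K) `^ p * kappa * \sum_j Lpnorm mu p (f j) `^ p)).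
  rewrite -lee_fin EFinM -!sumEFin.
  under eq_bigr do rewrite Lpnorm_powR//.
  under [X in (_ <= _ * X)%E]eq_bigr do rewrite Lpnorm_powR//.
  have mh i : measurable_fun setT
      (fun x => (rnorm (\sum_j ((T i j)%:C)%C * f j x) `^ p)%:E).
    by apply: (measurable_rnormp p (f := fun x => \sum_j ((T i j)%:C)%C * f j x));
      have [] := hL i.
  have mf j : measurable_fun setT (fun x => (rnorm (f j x) `^ p)%:E).
    by apply: measurable_rnormp; have [] := fL j.
  rewrite -ge0_integral_sum//; last by move=> *; rewrite lee_fin powR_ge0.
  rewrite -ge0_integral_sum//; last by move=> *; rewrite lee_fin powR_ge0.
  rewrite -ge0_integralZl_EFin//; last 2 first.
  - by move=> x _; apply: sume_ge0 => j _; rewrite lee_fin powR_ge0.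
  - exact: emeasurable_sum.
  apply: ge0_le_integral => //.
  - by move=> x _; apply: sume_ge0 => j _; rewrite lee_fin powR_ge0.
  - exact: emeasurable_sum.
  - by apply: measurable_funeM; exact: emeasurable_sum.
  - by move=> x _; rewrite !sumEFin -EFinM lee_fin; exact: interpolation_complex.
rewrite ler_wpM2l// mulr_natl -sumr_const; apply: ler_sum => j _.
apply: ge0_ler_powR; rewrite ?nnegrE ?Lpnorm_ge0 ?(ltW p0)//.
exact: le_trans (Lpnorm_ge0 _ _) (fa j).
Qed.

(** First powers are recovered from [x <= t + x ^ p t ^ (1 - p)]. For [t = 4 K a] the two
    contributions are at most [t] and [4 t] per row, whence 20. *)
Lemma matrix_Lp_sum (f : J -> X -> R[i]) (a : R) :
  0 < a -> kappa * #|J|%:R <= 2 * #|I|%:R ->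
  (forall j, Lp mu p (f j)) -> (forall j, Lpnorm mu p (f j) <= a) ->
  (forall i, Lp mu p (fun x => \sum_j ((T i j)%:C)%C * f j x)) ->
  \sum_i Lpnorm mu p (fun x => \sum_j ((T i j)%:C)%C * f j x) <=
  20 * K * a * #|I|%:R.
Proof.
move=> a0 kJ fL fa hL; have H := matrix_Lp fL fa hL.
have K0 := interp_const_gt0 p^-1 (1 - p^-1) N1.
have p0 : 0 < p := lt_trans ltr01 p1.
pose t := 4 * K * a.
have t0 : 0 < t by rewrite !mulr_gt0.
have young x : 0 <= x -> x <= t + x `^ p * t `^ (1 - p).
  move=> x0; have [xt|tx] := leP x t.
    by rewrite (le_trans xt)// lerDl mulr_ge0 ?powR_ge0.
  have x0' : 0 < x by exact: lt_trans tx.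
  have -> : x `^ p * t `^ (1 - p) = x * (x `^ (p - 1) * t `^ (1 - p)).
    by rewrite mulrA mulr_powRB1// ltW.
  apply: (@le_trans _ _ (x * (x `^ (p - 1) * t `^ (1 - p)))); last by rewrite lerDr ltW.
  rewrite ler_peMr ?(ltW x0')//.
  have -> : 1 - p = - (p - 1) by ring.
  rewrite powRN ler_pdivlMr ?powR_gt0// mul1r.
  by apply: ge0_ler_powR; rewrite ?nnegrE ?(ltW t0) ?(ltW x0') ?(ltW tx)// subr_ge0 ltW.
apply: (@le_trans _ _ (\sum_(i : I) t +
  (\sum_i Lpnorm mu p (fun x => \sum_j ((T i j)%:C)%C * f j x) `^ p) * t `^ (1 - p))).
  rewrite mulr_suml -big_split; apply: ler_sum => i _ /=.
  exact/young/Lpnorm_ge0.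
rewrite sumr_const -(mulr_natr t).
apply: (@le_trans _ _ (t * #|I|%:R +
  2 * (4 * K) `^ p * kappa * (#|J|%:R * a `^ p) * t `^ (1 - p))).
  by rewrite lerD2l ler_wpM2r ?powR_ge0.
have -> : 2 * (4 * K) `^ p * kappa * (#|J|%:R * a `^ p) * t `^ (1 - p) =
  2 * (kappa * #|J|%:R) * t.
  have E : (4 * K) `^ p * a `^ p * t `^ (1 - p) = t.
    rewrite -powRM ?mulr_ge0 ?(ltW K0) ?(ltW a0)// -/t.
    rewrite -powRDp// addrC subrK powRr1//; exact: ltW.
  by rewrite -[X in _ = _ * X]E; ring.
have -> : 20 * K * a * #|I|%:R = t * #|I|%:R + 2 * (2 * #|I|%:R) * t.
  by rewrite /t; ring.
by rewrite lerD2l ler_wpM2r ?(ltW t0)// ler_wpM2l.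
Qed.

End MatrixOnLp.

Section SQquotient.
Context (R : realType) (p : R) (E : completeNormedModType R[i]).
Context d (S : measurableType d) (mu : {measure set S -> \bar R}).
Variables (X Y : set (S -> R[i])) (q : (S -> R[i]) -> E).
Hypothesis p1 : 1 < p.
Hypotheses (HX : Lp_closed_subspace mu p X) (HY : Lp_closed_subspace mu p Y).
Hypothesis YX : Y `<=` X.
Hypothesis qlin : forall (a : R[i]) f g, X f -> X g ->
  q (fun x => a * f x + g x) = a *: q f + q g.
Hypothesis qsurj : forall x : E, exists2 f, X f & q f = x.
Hypothesis qnorm : forall f, X f ->
  rnorm (q f) = inf [set Lpnorm mu p (fun x => f x - g x) | g in Y].

Lemma quotient_norm_le f : X f -> rnorm (q f) <= Lpnorm mu p f.
Proof.
move=> Xf; rewrite qnorm//; apply: le_inf_lb.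
  exists (fun=> 0); first by have [_] := HY.
  by congr (Lpnorm _ _ _); apply/funext => x; rewrite subr0.
by move=> _ [g _ <-]; exact: Lpnorm_ge0.
Qed.

Lemma quotient_lift (x : E) (e : R) : 0 < e ->
  exists f, [/\ X f, q f = x & Lpnorm mu p f <= rnorm x + e].
Proof.
move=> e0; have [f Xf qf] := qsurj x.
have [_ Y0 _ _] := HY; have [_ _ Xl _] := HX.
have [] := @inf_lt R [set Lpnorm mu p (fun x => f x - g x) | g in Y] (rnorm x + e).
- by exists (Lpnorm mu p (fun x => f x - 0)), (fun=> 0).
- by rewrite -qnorm// qf ltrDl.
move=> _ [g Yg <-] /ltW h.
(* The norm of [q g] is the distance from [g] to [Y], and [g] lies in [Y]. *)
have qg : q g = 0.
  apply/eqP; rewrite -normr_eq0 -rnormE.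
  have -> : rnorm (q g) = 0; last by [].
  apply/eqP; rewrite eq_le rnorm_ge0 andbT qnorm; last exact: YX.
  have z : Lpnorm mu p (fun=> 0) = 0.
    transitivity (fine (Lnorm mu p%:E (cst 0%E))).
      by congr fine; apply: eq_Lnorm => u; rewrite rnorm0.
    by rewrite Lnorm0// eqe gt_eqF// (lt_trans ltr01).
  apply: le_inf_lb; last by move=> _ [g' _ <-]; exact: Lpnorm_ge0.
  exists g => //; rewrite -[RHS]z; congr Lpnorm.
  by apply/funext => u; rewrite subrr.
have gf : (fun x => f x - g x) = (fun x => (-1) * g x + f x).
  by apply/funext => u; rewrite mulN1r addrC.
exists (fun x => f x - g x); split => //.
- by rewrite gf; apply: Xl => //; exact: YX.
- by rewrite gf qlin//; [rewrite qg scaler0 add0r|exact: YX].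
Qed.

Lemma quotient_sum (J : finType) (a : J -> R[i]) (f : J -> S -> R[i]) :
  (forall j, X (f j)) ->
  X (fun x => \sum_j a j * f j x) /\
  q (fun x => \sum_j a j * f j x) = \sum_j a j *: q (f j).
Proof.
move=> Xf; have [_ X0 Xl _] := HX.
have q0 : q (fun=> 0) = 0.
  have := qlin (-1) X0 X0; rewrite scaleN1r addNr => <-.
  by congr q; apply/funext => x; rewrite mulr0 addr0.
elim: (index_enum J) => [|j s [IH1 IH2]].
  have -> : (fun x => \sum_(j <- [::]) a j * f j x) = (fun=> 0).
    by apply/funext => x; rewrite big_nil.
  by rewrite big_nil.
have -> : (fun x => \sum_(j <- j :: s) a j * f j x) =
    (fun x => a j * f j x + (fun x => \sum_(j <- s) a j * f j x) x).
  by apply/funext => x; rewrite big_cons.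
by split; [exact: Xl|rewrite qlin// IH2 big_cons].
Qed.

End SQquotient.

Definition rate (R : realType) (p : R) : R := Num.min p^-1 (1 - p^-1) / 4.

Lemma rate_gt0 (R : realType) (p : R) : 1 < p -> 0 < rate p.
Proof.
move=> p1; have p0 : 0 < p := lt_trans ltr01 p1.
by rewrite divr_gt0// lt_min invr_gt0 p0 subr_gt0 invf_lt1.
Qed.

(** The choice [N = eta ^ (- 1/8)] turns the Gram condition [N ^ -8] into [eta]. The three terms
    become powers [(1 - 1/p) / 4], [1 / (4 p)] and [1/8] of [eta], the last with coefficient [3/2];
    the minimum in [rate] is at most [1/2], so [rate] is below all three, and
    [7/2 = 1 + 1 + 3/2]. *)
Lemma interp_const_rate (R : realType) (p eta : R) : 1 < p -> 0 < eta < 1 ->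
  interp_const (eta `^ (- 8^-1)) p^-1 (1 - p^-1) <= 7 / 2 * eta `^ rate p.
Proof.
move=> p1 /andP[eta0 eta1]; have p0 : 0 < p := lt_trans ltr01 p1.
have hp : 0 < p^-1 < 1 by rewrite invr_gt0 p0 invf_lt1.
have [r1 r2 r3] : [/\ rate p <= p^-1 / 4, rate p <= (1 - p^-1) / 4 & rate p <= 8^-1].
  by rewrite /rate; split; case: (leP p^-1 (1 - p^-1)); lra.
have pw x : rate p <= x -> eta `^ x <= eta `^ rate p.
  by move=> h; apply: ger_powR => //; rewrite eta0 ltW.
rewrite /interp_const -powR_mulrn ?powR_ge0// -!powRrM.
have -> : - 8^-1 * (2 * - (1 - p^-1)) = (1 - p^-1) / 4 :> R by field; lra.
have -> : - 8^-1 * (2 * - p^-1) = p^-1 / 4 :> R by field; lra.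
have -> : 3 / (2 * eta `^ (- 8^-1)) = 3 / 2 * eta `^ (8^-1) :> R.
  by rewrite powRN; field; rewrite gt_eqF ?powR_gt0.
have := pw _ r1; have := pw _ r2; have := pw _ r3; lra.
Qed.

Section FactorSchur.
Context (R : realType) (G : lcGroupType) (p : R).
Hypothesis p1 : 1 < p.
Variables (phi : G -> R[i]) (E : completeNormedModType R[i]).
Variables (alpha : G -> E) (beta : G -> E -> R[i]).
Hypothesis fac : Mpcb_factor p phi alpha beta.

Local Notation A := (sup (range (fun t => rnorm (alpha t)))).
Local Notation B := (sup (range (fun s => dualnorm (beta s)))).

Lemma factor_alpha t : rnorm (alpha t) <= A.
Proof. by case: fac => _ [_ ub] _ _ _; apply: sup_ubound => //; exists t. Qed.

Lemma factor_beta s : dualnorm (beta s) <= B.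
Proof. by case: fac => _ _ _ [_ ub] _; apply: sup_ubound => //; exists s. Qed.

Lemma factor_alpha_ge0 : 0 <= A.
Proof. exact: le_trans (rnorm_ge0 _) (factor_alpha 1%g). Qed.

Lemma factor_beta_ge0 : 0 <= B.
Proof.
apply: le_trans (factor_beta 1%g); apply: dualnorm_ge0.
by case: fac => _ _ + _ _; apply.
Qed.

Lemma factor_bounded g : rnorm (phi g) <= A * B.
Proof.
have [_ _ bd _ fE] := fac.
have -> : phi g = beta g (alpha 1%g) by rewrite -fE invg1 mulg1.
apply: le_trans (dualnorm_le _ (bd g)) _; rewrite mulrC.
by rewrite ler_pM ?rnorm_ge0 ?dualnorm_ge0 ?factor_alpha ?factor_beta.
Qed.

(** The [alpha (t j)] are lifted to the L_p space with hardly any increase of norm; the matrix acts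
    on the lifts, and the results are sent back to [E] and paired with the [beta (s i)]. The
    constant is [70 = 20 * 7 / 2]. *)
Lemma factor_rnorm (I J : finType) (s : I -> G) (t : J -> G) (T : I -> J -> R)
    (r c eta : R) :
  0 < r -> 0 < c -> 0 < eta ->
  (forall i, \sum_j `|T i j| <= r) -> (forall j, \sum_i `|T i j| <= c) ->
  (forall i, \sum_i' `|\sum_j T i j * T i' j| <= eta * (r * c)) ->
  c * #|J|%:R <= 2 * (r * #|I|%:R) ->
  rnorm (\sum_i \sum_j ((T i j)%:C)%C * phi (s i * (t j)^-1)%g) <=
    70 * (A * B) * eta `^ rate p * (r * #|I|%:R).
Proof.
move=> r0 c0 eta0 rowT colT gram hJ.
have AB0 : 0 <= A * B by rewrite mulr_ge0 ?factor_alpha_ge0 ?factor_beta_ge0.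
(* Interpolation needs [N > 1], that is [eta < 1]. Otherwise the row sums and the bound of [phi] are
   enough. *)
have [eta1|eta1] := leP 1 eta.
  apply: (@le_trans _ _ (\sum_(i : I) r * (A * B))).
    apply: le_trans (rnorm_sum _) _; apply: ler_sum => i _.
    apply: le_trans (rnorm_sum _) _.
    apply: (@le_trans _ _ (\sum_j `|T i j| * (A * B))).
      apply: ler_sum => j _; rewrite rnormM rnorm_real ler_wpM2l//.
      exact: factor_bounded.
    by rewrite -mulr_suml ler_wpM2r.
  have x1 : 1 <= eta `^ rate p.
    by rewrite -[leLHS](powRr0 eta) ler_powR// ltW// rate_gt0.
  have zy : 0 <= A * B * (r * #|I|%:R) by rewrite !mulr_ge0 ?factor_alpha_ge0 ?factor_beta_ge0 ?(ltW r0).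
  rewrite sumr_const -[leLHS](mulr_natr (r * _)) [leLHS](_ : _ = A * B * (r * #|I|%:R)); last by ring.
  rewrite [leRHS](_ : _ = A * B * (r * #|I|%:R) * (70 * eta `^ rate p)); last by ring.
  by rewrite ler_peMr//; move: x1; move: (eta `^ _) => x; lra.
have [[d [S [mu [X [Y [q [[HX HY YX] qlin qsurj qnorm]]]]]]] _ bd _ fE] := fac.
pose T' i j := T i j / r; pose N := eta `^ (- 8^-1).
have N1 : 1 < N.
  rewrite /N powRN invf_gt1 ?powR_gt0//.
  have h8 : 0 < 8^-1 :> R by rewrite invr_gt0.
  have := gt0_ltr_powR h8 _ _ eta1; rewrite powR1; apply; first by rewrite nnegrE ltW.
  by rewrite nnegrE.
have N8 : N ^+ 8 = eta^-1.
  rewrite /N -powR_mulrn ?powR_ge0// -powRrM.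
  by rewrite (_ : - 8^-1 * 8%:R = -1) ?powR_inv1 ?(ltW eta0)//; field.
have nT i j : `|T' i j| = `|T i j| / r by rewrite normrM normfV (gtr0_norm r0).
have rowT' i : \sum_j `|T' i j| <= 1.
  under eq_bigr do rewrite nT.
  by rewrite -mulr_suml ler_pdivrMr// mul1r.
have colT' j : \sum_i `|T' i j| <= c / r.
  under eq_bigr do rewrite nT.
  by rewrite -mulr_suml ler_pM2r ?invr_gt0.
have gram' i : \sum_i' `|\sum_j T' i j * T' i' j| <= c / r / N ^+ 8.
  rewrite N8 invrK.
  have -> : \sum_i' `|\sum_j T' i j * T' i' j| =
      (\sum_i' `|\sum_j T i j * T i' j|) / (r * r).
    rewrite mulr_suml; apply: eq_bigr => i' _.
    rewrite -[r * r]gtr0_norm ?mulr_gt0// -normfV -normrM mulr_suml.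
    congr (`|_|); apply: eq_bigr => j _; rewrite /T'; field.
    by rewrite gt_eqF.
  rewrite ler_pdivrMr ?mulr_gt0//; apply: le_trans (gram i) _.
  by apply: le_of_eq; field; rewrite gt_eqF.
have cJ : c / r * #|J|%:R <= 2 * #|I|%:R.
  by rewrite mulrAC ler_pdivrMr// (le_trans hJ)// -mulrA (mulrC r).
have K0 := interp_const_gt0 p^-1 (1 - p^-1) N1.
set K := interp_const _ _ _ in K0.
have main e : 0 < e -> rnorm (\sum_i \sum_j ((T i j)%:C)%C * phi (s i * (t j)^-1)%g) <=
    r * (B * (20 * K * (A + e) * #|I|%:R)).
  move=> e0.
  have /choice [f hf] : forall j, exists f, [/\ X f, q f = alpha (t j) &
      Lpnorm mu p f <= rnorm (alpha (t j)) + e].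
    by move=> j; exact: (quotient_lift p1 HX HY YX qlin qsurj qnorm).
  have fX j : X (f j) by have [] := hf j.
  have XL g : X g -> Lp mu p g by have [+ _ _ _] := HX; apply.
  pose h i := fun x => \sum_j ((T' i j)%:C)%C * f j x.
  have hX i : X (h i) /\ q (h i) = \sum_j ((T' i j)%:C)%C *: q (f j).
    exact: (quotient_sum HX qlin (fun j => ((T' i j)%:C)%C) fX).
  have Ae : 0 < A + e by rewrite ltr_wpDl// factor_alpha_ge0.
  have cr : 0 < c / r by rewrite divr_gt0.
  have H := @matrix_Lp_sum R I J T' (c / r) N p cr N1 p1 rowT' colT' gram' _ S mu f
    (A + e) Ae cJ (fun j => XL _ (fX j)) _ (fun i => XL _ (hX i).1).
  apply: (@le_trans _ _ (r * \sum_i (B * rnorm (q (h i))))).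
    rewrite mulr_sumr; apply: le_trans (rnorm_sum _) _; apply: ler_sum => i _.
    have -> : \sum_j ((T i j)%:C)%C * phi (s i * (t j)^-1)%g =
        (r%:C)%C * beta (s i) (q (h i)).
      rewrite (hX i).2 banach_dual_sum// mulr_sumr; apply: eq_bigr => j _.
      have [_ -> _] := hf j; rewrite -fE mulrA -rmorphM /=.
      by rewrite /T' [r * _]mulrC divfK// gt_eqF.
    rewrite rnormM rnorm_real (gtr0_norm r0) ler_wpM2l ?(ltW r0)//.
    apply: le_trans (dualnorm_le _ (bd _)) _.
    by rewrite ler_wpM2r ?rnorm_ge0 ?factor_beta.
  rewrite ler_wpM2l ?(ltW r0)// -mulr_sumr ler_wpM2l ?factor_beta_ge0//.
  apply: (le_trans _ (H _)); last first.
    by move=> j; have [_ _ /le_trans] := hf j; apply; rewrite lerD2r factor_alpha.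
  by apply: ler_sum => i _; apply: (quotient_norm_le HY qnorm); exact: (hX i).1.
have {main} : rnorm (\sum_i \sum_j ((T i j)%:C)%C * phi (s i * (t j)^-1)%g) <=
    r * (B * (20 * K * A * #|I|%:R)).
  apply/ler_addgt0Pr => e e0.
  pose D := r * (B * (20 * K * #|I|%:R)).
  have D0 : 0 <= D by rewrite !mulr_ge0 ?factor_beta_ge0 ?(ltW r0) ?(ltW K0).
  have De : 0 < e / (D + 1) by rewrite divr_gt0// ltr_wpDl.
  apply: le_trans (main _ De) _.
  have -> : r * (B * (20 * K * (A + e / (D + 1)) * #|I|%:R)) =
    r * (B * (20 * K * A * #|I|%:R)) + D * (e / (D + 1)) by rewrite /D; ring.
  rewrite lerD2l mulrCA ler_piMr ?(ltW e0)// ler_pdivrMr ?ltr_wpDl//.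
  by rewrite mul1r lerDl.
move/le_trans; apply.
have KR : K <= 7 / 2 * eta `^ rate p.
  by apply: interp_const_rate => //; rewrite eta0.
have -> : r * (B * (20 * K * A * #|I|%:R)) = 20 * (A * B) * (r * #|I|%:R) * K by ring.
have -> : 70 * (A * B) * eta `^ rate p * (r * #|I|%:R) =
  20 * (A * B) * (r * #|I|%:R) * (7 / 2 * eta `^ rate p) by field.
by rewrite ler_wpM2l// !mulr_ge0 ?factor_alpha_ge0 ?factor_beta_ge0 ?(ltW r0).
Qed.

Lemma factor_schur_Re : schur (rate p) (70 * (A * B)) (fun g => complex.Re (phi g)).
Proof.
move=> I J s t T r c eta r0 c0 eta0 rowT colT gram hJ.
apply: le_trans (factor_rnorm s t r0 c0 eta0 rowT colT gram hJ).
apply: le_trans (Re_le_rnorm _); rewrite Re_sum; apply: le_of_eq; congr (`|_|).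
by apply: eq_bigr => i _; rewrite Re_sum; apply: eq_bigr => j _; rewrite Re_realM.
Qed.

Lemma factor_schur_Im : schur (rate p) (70 * (A * B)) (fun g => complex.Im (phi g)).
Proof.
move=> I J s t T r c eta r0 c0 eta0 rowT colT gram hJ.
apply: le_trans (factor_rnorm s t r0 c0 eta0 rowT colT gram hJ).
apply: le_trans (Im_le_rnorm _); rewrite Im_sum; apply: le_of_eq; congr (`|_|).
by apply: eq_bigr => i _; rewrite Im_sum; apply: eq_bigr => j _; rewrite Im_realM.
Qed.

Lemma factor_continuous : forall (g : G) (e : R), 0 < e ->
  \forall g' \near g, rnorm (phi g' - phi g) < e.
Proof.
move=> g e e0; have [_ _ bd [bc _] fE] := fac.
have A1 : 0 < A + 1 by rewrite ltr_wpDl ?factor_alpha_ge0.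
have eA : 0 < e / (A + 1) by rewrite divr_gt0.
have phiE x : phi x = beta x (alpha 1%g) by rewrite -fE invg1 mulg1.
apply: filterS (bc g _ eA) => g' h.
have dl : banach_dual (fun x => beta g' x - beta g x).
  have [l1 c1] := bd g'; have [l2 c2] := bd g; split.
    by move=> a x y; rewrite l1 l2 /=; ring.
  by move=> x; apply: (@cvgB _ R[i]^o); [exact: c1|exact: c2].
rewrite !phiE; apply: le_lt_trans (dualnorm_le (alpha 1%g) dl) _.
apply: (@le_lt_trans _ _ (dualnorm (fun x => beta g' x - beta g x) * (A + 1))).
  by rewrite ler_wpM2l ?dualnorm_ge0// ler_wpDr// factor_alpha.
by rewrite -ltr_pdivlMr.
Qed.

End FactorSchur.

(** * Haar means *)

Section BorelGroup.
Context (R : realType) (G : lcGroupType).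

Lemma open_borel (U : set G) : open U -> measurable (U : set (borel G)).
Proof. by move=> oU; exact: (@sub_sigma_algebra _ setT (@open G)). Qed.

Lemma closed_borel (A : set G) : closed A -> measurable (A : set (borel G)).
Proof.
move=> cA; rewrite -(setCK A); apply: (@measurableC _ (borel G)).
by apply: open_borel; exact: closed_openC.
Qed.

Lemma compact_borel (K : set G) : compact K -> measurable (K : set (borel G)).
Proof. 
move=> cK; apply: closed_borel; apply: compact_closed cK.
exact: (@lcgroup_hausdorff G). Qed.

Lemma continuous_mulgl (w : G) : continuous (fun t : G => (w * t)%g).
Proof. by move=> t; apply: mulg_cvg; [exact: cvg_cst|exact: cvg_id]. Qed.

Lemma measurable_mulgl (w : G) :
  measurable_fun [set: borel G] (fun t : borel G => (w * t)%g : borel G).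
Proof.
apply: (@measurability _ _ (borel G) (borel G) _ _ (@open G)) => //.
move=> _ [U oU <-]; rewrite setTI; apply: open_borel.
by apply: open_comp => // t _; exact: continuous_mulgl.
Qed.

Lemma continuous_borel (u : G -> R) : continuous u ->
  measurable_fun [set: borel G] (u : borel G -> R).
Proof.
move=> cu; apply: (measurability _ (RGenOpens.measurableE R)).
move=> _ [_ [a [b ->]] <-]; rewrite setTI; apply: open_borel.
by apply: open_comp => [t _|]; [exact: cu|exact: interval_open].
Qed.

Lemma image_mulgl (w : G) (A : set G) :
  [set (w * t)%g | t in A] = (fun t => (w^-1 * t)%g) @^-1` A.
Proof.
apply/seteqP; split => [_ [t At <-]|t At] /=; first by rewrite mulKg.
by exists (w^-1 * t)%g => //; rewrite mulVKg.
Qed.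

Lemma compact_mulgl_near (K U : set G) : compact K -> open U -> K `<=` U ->
  \forall h \near (1%g : G), forall b, K b -> U (h * b)%g.
Proof.
move=> cK oU KU; apply: (proj1 (compact_near_coveringP K) cK).
move=> b Kb; apply: (@mulg_cvg G (G * G) (filter_prod (nbhs b) (nbhs 1%g))
  (fun z => z.2) (fun z => z.1) 1%g b) => //=.
- exact: cvg_snd.
- exact: cvg_fst.
- by rewrite mul1g; apply: open_nbhs_nbhs; split => //; exact: KU.
Qed.

End BorelGroup.

Section Haar.
Context (R : realType) (G : lcGroupType) (mu : {measure set (borel G) -> \bar R}).
Hypothesis hmu : left_haar mu.

Lemma haar_preimage (w : G) (A : set G) : measurable (A : set (borel G)) ->
  mu ((fun t => (w * t)%g) @^-1` A) = mu A.
Proof.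
move=> mA; have [_ inv _ _ _] := hmu; rewrite -(inv w^-1%g _ mA) image_mulgl.
by rewrite invgK.
Qed.

Lemma haar_integral (w : G) (D : set G) (f : G -> \bar R) :
  measurable (D : set (borel G)) -> measurable_fun [set: borel G] f ->
  (\int[mu]_(x in D) f x)%E =
  (\int[mu]_(x in (fun t => (w * t)%g) @^-1` D) f (w * x)%g)%E.
Proof.
move=> mD mf.
have ge0 g : measurable_fun [set: borel G] g -> (forall x : G, (0 <= g x)%E) ->
    (\int[mu]_(x in D) g x)%E =
    (\int[mu]_(x in (fun t => (w * t)%g) @^-1` D) g (w * x)%g)%E.
  move=> mg g0.
  have /(_ R mu D g) := ge0_integral_pushforward (@measurable_mulgl G w).
  move=> /(_ mD (measurable_funTS mg) (fun x _ => g0 x)) <-.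
  apply: eq_measure_integral; first exact: measurable_mulgl.
  by move=> mw A mA _; rewrite -(haar_preimage w mA).
rewrite [LHS]integralE [RHS]integralE; congr (_ - _)%E.
- rewrite (ge0 _ (measurable_funepos mf)); last by [].
  by congr (integral _ _ _); apply/funext => x; rewrite !funeposE.
- rewrite (ge0 _ (measurable_funeneg mf)); last by [].
  by congr (integral _ _ _); apply/funext => x; rewrite !funenegE.
Qed.

Lemma haar_positive_compact : exists K : set G,
  compact K /\ (0 < mu K < +oo)%E.
Proof.
have [mu0 _ fin _ inn] := hmu.
have : (0 < mu [set: G])%E by rewrite lt0e mu0 measure_ge0.
rewrite (inn _ openT) => /ereal_sup_gt[_ [K [cK _] <-] K0].
by exists K; split => //; rewrite K0 fin.
Qed.

End Haar.

Lemma integrable_scale (R : realType) d (T : measurableType d)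
    (mu : {measure set T -> \bar R}) (D : set T) (a : R) (f : T -> R) :
  measurable D -> mu.-integrable D (EFin \o f) ->
  mu.-integrable D (EFin \o (fun x => a * f x)).
Proof.
move=> mD fi; rewrite (_ : _ \o _ = (fun x => (a%:E * (f x)%:E)%E)).
  exact: (integrableZl mD a fi).
by apply/funext => x; rewrite /= EFinM.
Qed.

Section HaarMean.
Context (R : realType) (G : lcGroupType) (mu : {measure set (borel G) -> \bar R}).
Hypothesis hmu : left_haar mu.
Variable K : set G.
Hypotheses (cK : compact K) (K0 : (0 < mu K < +oo)%E).
Implicit Types (u : G -> R) (C : R).

Definition bounded_by C u := continuous u /\ forall w, `|u w| <= C.

Lemma bounded_integrable C u w (D : set G) : bounded_by C u ->
  measurable (D : set (borel G)) -> (mu D < +oo)%E ->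
  mu.-integrable D (EFin \o (fun b : borel G => u (w * b)%g)).
Proof.
move=> [cu uC] mD fD; apply: measurable_bounded_integrable => //.
  apply: measurable_funTS; apply: continuous_borel => t.
  by apply: (continuous_comp (@continuous_mulgl G w t)); exact: cu.
by exists C; split => [|M CM x _ /=]; [exact: num_real|apply: le_trans (uC _) (ltW CM)].
Qed.

Let mK : measurable (K : set (borel G)) := compact_borel cK.
Let Kfin : (mu K < +oo)%E. Proof. by case/andP: K0. Qed.
Let m := fine (mu K).
Let m0 : 0 < m. Proof. by rewrite fine_gt0. Qed.

(* Convolution by the normalized indicator function of [K]: point evaluations of
   [haar_mean u] are integrals of [u] against functions in [L_1]. *)
Definition haar_mean u w := (\int[mu]_(b in K) u (w * b)%g) / fine (mu K).

Lemma Rintegral_bound C (D : set G) (f : G -> R) : measurable (D : set (borel G)) ->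
  (mu D < +oo)%E -> mu.-integrable D (EFin \o (f : borel G -> R)) ->
  (forall x, D x -> `|f x| <= C) -> `|\int[mu]_(x in D) f x| <= C * fine (mu D).
Proof.
move=> mD fD fi fC; apply: le_trans (le_normr_Rintegral mD fi) _.
rewrite -Rintegral_cst//; apply: le_Rintegral => //; first exact: integrable_norm.
apply: measurable_bounded_integrable => //.
by exists `|C|; split => [|M CM x _ /=]; [exact: num_real|exact: ltW].
Qed.

Lemma combination_integrable (s : seq (R * G)) C u : bounded_by C u ->
  mu.-integrable K (EFin \o (fun b : borel G => combination s (fun w => u (w * b)%g))).
Proof.
move=> uC; elim: s => [|[a w] s IH].
  rewrite (_ : _ \o _ = cst 0%E); first exact: integrable0.
  by apply/funext => b; rewrite /= /combination big_nil.
rewrite (_ : _ \o _ = ((EFin \o (fun b : borel G => a * u (w * b)%g)%R) \+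
    (EFin \o (fun b : borel G => combination s (fun w => u (w * b)%g))))%E).
  apply: integrableD => //; apply: integrable_scale => //.
  exact: (bounded_integrable w uC).
by apply/funext => b; rewrite /= /combination big_cons EFinD.
Qed.

Lemma combination_haar_mean (s : seq (R * G)) C u : bounded_by C u ->
  combination s (haar_mean u) =
  (\int[mu]_(b in K) combination s (fun w => u (w * b)%g)) / m.
Proof.
move=> uC; elim: s => [|[a w] s IH].
  rewrite /combination big_nil.
  under eq_Rintegral do rewrite big_nil.
  by rewrite Rintegral_cst// !mul0r.
rewrite {1}/combination big_cons /= -/(combination s (haar_mean u)) IH.
transitivity ((\int[mu]_(b in K) (a * u (w * b)%g + combination s (fun w => u (w * b)%g))) / m).
  have iw := bounded_integrable w uC mK Kfin.
  rewrite RintegralD//; last 2 first.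
  - exact: integrable_scale iw.
  - exact: combination_integrable uC.
  by rewrite (RintegralZl _ mK iw) mulrDl -/m mulrA.
congr (_ / _); apply: eq_Rintegral => b _.
by rewrite /combination big_cons.
Qed.

Lemma combination_haar_mean_le (s : seq (R * G)) C e u : bounded_by C u ->
  (forall b, K b -> `|combination s (fun w => u (w * b)%g)| <= e) ->
  `|combination s (haar_mean u)| <= e.
Proof.
move=> uC se; rewrite (combination_haar_mean _ uC) normrM normfV (gtr0_norm m0).
rewrite ler_pdivrMr//.
exact: (Rintegral_bound mK Kfin (combination_integrable s uC) se).
Qed.

Lemma haar_mean_le C e u w : bounded_by C u ->
  (forall b, K b -> `|u (w * b)%g| <= e) -> `|haar_mean u w| <= e.
Proof.
move=> uC ue; have := @combination_haar_mean_le [:: (1, w)] C e u uC.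
rewrite /combination big_seq1 mul1r; apply => b Kb.
by rewrite big_seq1 mul1r ue.
Qed.

Lemma haar_mean_lin C C' a u u' : bounded_by C u -> bounded_by C' u' ->
  haar_mean (fun x => a * u x + u' x) = (fun x => a * haar_mean u x + haar_mean u' x).
Proof.
move=> uC uC'; apply/funext => w; rewrite /haar_mean.
have iu := bounded_integrable w uC mK Kfin.
have iu' := bounded_integrable w uC' mK Kfin.
by rewrite RintegralD//; [rewrite (RintegralZl _ mK iu) mulrDl mulrA|exact: integrable_scale iu].
Qed.

Lemma haar_mean_cst c : haar_mean (fun=> c) = (fun=> c).
Proof. by apply/funext => w; rewrite /haar_mean Rintegral_cst// mulfK// gt_eqF. Qed.

(** As for one-parameter means, the right translation by [b] is absorbed in [t]. *)
Lemma schur_haar_mean th C B u : bounded_by B u -> schur th C u ->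
  schur th C (haar_mean u).
Proof.
move=> uB su I J s t T r c eta r0 c0 eta0 rowT colT gram hJ.
pose S := [seq (T x.1 x.2, (s x.1 * (t x.2)^-1)%g) | x <- index_enum (I * J)%type].
have SE psi : combination S psi = \sum_i \sum_j T i j * psi (s i * (t j)^-1)%g.
  by rewrite /combination big_map pair_big.
rewrite -SE; apply: (combination_haar_mean_le uB) => b _; rewrite SE.
have := su I J s (fun j => b^-1 * t j)%g T r c eta r0 c0 eta0 rowT colT gram hJ.
congr (`|_| <= _); apply: eq_bigr => i _; apply: eq_bigr => j _.
by rewrite invgM invgK mulgA.
Qed.

(* Quantifying over [u] makes this a common modulus by construction; the content is
   in [haar_modulusP]. *)
Definition haar_modulus C (eps : R) : set G :=
  [set h | forall u, bounded_by C u -> forall w,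
     `|haar_mean u (w * h)%g - haar_mean u w| <= eps].

Lemma haar_mean_ruc C u : bounded_by C u -> ruc (haar_modulus C) (haar_mean u).
Proof. by move=> uC eps _ w h; apply. Qed.

Lemma Rintegral_subset C (D U : set G) (f : G -> R) :
  measurable (D : set (borel G)) -> measurable (U : set (borel G)) ->
  D `<=` U -> (mu U < +oo)%E -> mu.-integrable U (EFin \o (f : borel G -> R)) ->
  (forall x, `|f x| <= C) ->
  `|\int[mu]_(x in U) f x - \int[mu]_(x in D) f x| <= C * (fine (mu U) - fine (mu D)).
Proof.
move=> mD mU DU fU fi fC.
have fD : (mu D < +oo)%E by apply: le_lt_trans fU; apply: le_measure; rewrite ?inE.
have mUD : measurable ((U `\` D) : set (borel G)) by exact: measurableD.
have UD : U = D `|` (U `\` D) by rewrite setDUK.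
have -> : fine (mu U) - fine (mu D) = fine (mu (U `\` D)).
  rewrite measureD// setIidr// fineB// ge0_fin_numE//.
rewrite {1}UD Rintegral_setU//; last 2 first.
- by rewrite -UD.
- by rewrite disj_set2E setDIK.
rewrite addrAC subrr add0r; apply: Rintegral_bound => //.
- apply: le_lt_trans fU; apply: le_measure; rewrite ?inE//; exact: subDsetl.
- by apply: (integrableS mU mUD) => //; exact: subDsetl.
Qed.

(** [haar_mean u (w h)] is the mean of [u (w b)] over [h K]. By outer regularity [K] lies in an open
    [U] of almost the same measure, which contains [h K] for [h] near 1. Both integrals differ from
    that over [U] by at most [C (mu U - mu K)], a bound that involves [u] only through [C]. *)
Lemma haar_modulusP C : modulus (haar_modulus C).
Proof.
move=> eps eps0.
pose del := eps * m / (2 * (`|C| + 1)).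
have c0 : 0 < 2 * (`|C| + 1) by rewrite mulr_gt0// ltr_wpDl.
have del0 : 0 < del by rewrite divr_gt0// mulr_gt0.
have [_ inv _ out _] := hmu.
have [|_ [U [oU KU] <-]] := @lb_ereal_inf_adherent R
  [set mu U | U in [set U : set G | open U /\ K `<=` U]] del del0.
  by rewrite -(out _ mK) ge0_fin_numE.
rewrite -(out _ mK) => Ulty.
have fU : (mu U < +oo)%E.
  by apply: lt_trans Ulty _; rewrite -[mu K]fineK ?ge0_fin_numE// ltry.
have Udel : fine (mu U) - m <= del.
  rewrite lerBlDl -lee_fin EFinD !fineK ?ge0_fin_numE//; exact: ltW.
have mU := open_borel oU.
apply: filterS (compact_mulgl_near cK oU KU) => h hU u uC w.
have C0 : 0 <= C by have [_ /(_ 1%g)] := uC; exact: le_trans (normr_ge0 _).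
pose hK := (fun t => (h^-1 * t)%g) @^-1` K.
have mhK : measurable (hK : set (borel G)).
  by rewrite -[hK]setTI; exact: (@measurable_mulgl G h^-1%g).
have hKU : hK `<=` U by move=> t /hU; rewrite mulVKg.
have iU := bounded_integrable w uC mU fU.
have hmK : mu hK = mu K by exact: haar_preimage.
have E1 : haar_mean u (w * h)%g = (\int[mu]_(b in hK) u (w * b)%g) / m.
  congr (_ / _); rewrite /Rintegral; congr fine.
  rewrite (@haar_integral _ _ _ hmu h hK (fun b => (u (w * b)%g)%:E) mhK); last first.
    apply/measurable_EFinP; apply: continuous_borel => t.
    by apply: (continuous_comp (@continuous_mulgl G w t)); exact: uC.1.
  have -> : (fun t => (h * t)%g) @^-1` hK = K.
    by apply/seteqP; split => t; rewrite /hK /= mulKg.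
  by congr integral; apply/funext => t; rewrite mulgA.
have B1 := Rintegral_subset mK mU KU fU iU (fun x => uC.2 (w * x)%g).
have B2 := Rintegral_subset mhK mU hKU fU iU (fun x => uC.2 (w * x)%g).
rewrite E1 /haar_mean -/m -mulrBl normrM normfV (gtr0_norm m0) ler_pdivrMr//.
rewrite hmK in B2; rewrite -/m in B1 B2.
have B3 : C * (fine (mu U) - m) <= C * del by rewrite ler_wpM2l.
have B4 : 2 * (C * del) <= eps * m.
  have -> : 2 * (C * del) = eps * m * (C / (`|C| + 1)).
    by rewrite /del; field; rewrite gt_eqF// ltr_wpDl.
  rewrite ler_piMr ?mulr_ge0 ?(ltW eps0) ?(ltW m0)//.
  by rewrite ler_pdivrMr ?ltr_wpDl// mul1r ger0_norm// lerDl.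
move: B1 B2; set x := Rintegral _ _ _; set y := Rintegral _ _ _; set z := Rintegral _ _ _.
move=> B1 B2; rewrite (_ : z - y = (x - y) - (x - z)); last by ring.
by apply: le_trans (ler_normB _ _) _; lra.
Qed.

End HaarMean.

Section HaarMeanDensity.
Context (R : realType) (G : lcGroupType) (mu : {measure set (borel G) -> \bar R}).
Hypothesis hmu : left_haar mu.
Variable K : set G.
Hypotheses (cK : compact K) (K0 : (0 < mu K < +oo)%E).
Implicit Types (u : G -> R) (C : R).

(** The density is the indicator of [w K] divided by [mu K]; being chosen before [u], it represents
    the evaluation at [w] for all [u] at once. *)
Lemma haar_mean_density (w : G) : exists F : G -> R,
  mu.-integrable setT (EFin \o (F : borel G -> R)) /\
  forall C u, bounded_by C u ->
    mu.-integrable setT (EFin \o (fun x : borel G => F x * u x)) /\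
    \int[mu]_x (F x * u x) = haar_mean mu K u w.
Proof.
have mK := compact_borel cK; have /andP[K00 Kfin] := K0.
pose wK := (fun t => (w^-1 * t)%g) @^-1` K.
have mwK : measurable (wK : set (borel G)).
  by rewrite -[wK]setTI; exact: (@measurable_mulgl G w^-1%g).
have fwK : mu wK = mu K by exact: haar_preimage.
have fwKoo : (mu wK < +oo)%E by rewrite fwK.
pose F := (cst (fine (mu K))^-1 : G -> R) \_ wK.
have FE u : (fun x => F x * u x) = (fun x => (fine (mu K))^-1 * u x) \_ wK.
  by apply/funext => x; rewrite /F !patchE; case: ifP => _ //; rewrite mul0r.
have iF C u : bounded_by C u ->
    mu.-integrable setT (EFin \o (fun x : borel G => F x * u x)).
  move=> uC; rewrite (FE u) -restrict_EFin; apply/(integrable_mkcond _ mwK).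
  apply: (@integrable_scale R _ (borel G) mu wK (fine (mu K))^-1 u mwK).
  have := bounded_integrable 1%g uC mwK fwKoo.
  by congr (_.-integrable _ _); apply/funext => x /=; rewrite mul1g.
exists F; split.
  have b1 : bounded_by 1 (fun _ : G => 1 : R).
    by split => [|w']; [exact: cst_continuous|rewrite normr1].
  by have := iF _ _ b1; congr (_.-integrable _ _); apply/funext => x /=; rewrite mulr1.
move=> C u uC; split; first exact: iF uC.
rewrite FE -Rintegral_mkcond.
have iu : mu.-integrable wK (EFin \o (u : borel G -> R)).
  have := bounded_integrable 1%g uC mwK fwKoo.
  by congr (_.-integrable _ _); apply/funext => x /=; rewrite mul1g.
rewrite (RintegralZl _ mwK iu) mulrC /haar_mean; congr (_ / _).
rewrite /Rintegral; congr fine.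
rewrite (@haar_integral _ _ _ hmu w wK (fun b => (u b)%:E) mwK); last first.
  by apply/measurable_EFinP; apply: continuous_borel; exact: uC.1.
by congr integral; apply/seteqP; split => t; rewrite /wK /= mulKg.
Qed.

Lemma combination_density (s : seq (R * G)) : exists F : G -> R,
  mu.-integrable setT (EFin \o (F : borel G -> R)) /\
  forall C u, bounded_by C u ->
    mu.-integrable setT (EFin \o (fun x : borel G => F x * u x)) /\
    \int[mu]_x (F x * u x) = combination s (haar_mean mu K u).
Proof.
elim: s => [|[a w] s [F [iF FE]]].
  have z u : EFin \o (fun x : borel G => 0 * u x) = cst 0%E.
    by apply/funext => x /=; rewrite mul0r.
  exists (fun=> 0); split; first by rewrite (_ : _ \o _ = cst 0%E)//; exact: integrable0.
  move=> C u uC; split; first by rewrite z; exact: integrable0.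
  rewrite /combination big_nil; under eq_Rintegral do rewrite mul0r.
  by rewrite Rintegral_cst// mul0r.
have [H [iH HE]] := haar_mean_density w.
exists (fun x => a * H x + F x); split.
  by apply: (integrableD measurableT (integrable_scale a measurableT iH) iF).
move=> C u uC; have [iHu HuE] := HE _ _ uC; have [iFu FuE] := FE _ _ uC.
have E : (fun x => (a * H x + F x) * u x) = (fun x => a * (H x * u x) + F x * u x).
  by apply/funext => x; rewrite mulrDl mulrA.
have iaHu := integrable_scale a measurableT iHu.
rewrite E; split; first exact: (integrableD measurableT iaHu iFu).
by rewrite RintegralD// (RintegralZl _ measurableT iHu) HuE FuE /combination big_cons.
Qed.

Lemma combination_Lp1 (s : seq (R * G)) : exists f : G -> R[i],
  Lp mu 1 f /\ forall C phi, bounded_by C (fun x : G => complex.Re (phi x)) ->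
    bounded_by C (fun x : G => complex.Im (phi x)) ->
    cintegral mu (fun t => f t * phi t) =
    Complex (combination s (haar_mean mu K (fun x => complex.Re (phi x))))
            (combination s (haar_mean mu K (fun x => complex.Im (phi x)))).
Proof.
have [F [iF FE]] := combination_density s.
exists (fun x => ((F x)%:C)%C); split; first split.
- split => /=; last exact: measurable_cst.
  by apply/measurable_EFinP; exact: measurable_int iF.
- rewrite /eLpnorm Lnorm1; have /integrableP[_] := iF.
  by congr (_ < _)%E; apply: eq_integral => x _ /=; rewrite rnorm_real normr_id.
move=> C phi rC iC; rewrite /cintegral; congr Complex.
- by have [_ <-] := FE _ _ rC; apply: eq_Rintegral => x _; rewrite Re_realM.
- by have [_ <-] := FE _ _ iC; apply: eq_Rintegral => x _; rewrite Im_realM.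
Qed.

Definition vanishing u := forall eps : R, 0 < eps ->
  exists2 L : set G, compact L & forall w, ~ L w -> `|u w| <= eps.

Lemma compact_mulgV (L M : set G) : compact L -> compact M ->
  compact [set (x.1 * x.2^-1)%g | x in L `*` M].
Proof.
move=> cL cM; apply: continuous_compact; last exact: compact_setX.
apply: continuous_subspaceT => -[x y].
apply: mulg_cvg => /=; first exact: cvg_fst.
by apply: cvg_comp; [exact: cvg_snd|exact: invg_continuous].
Qed.

(** For [w] outside [L K^-1], no [w b] with [b] in [K] lies in [L]. *)
Lemma haar_mean_vanishing C u : bounded_by C u -> vanishing u ->
  vanishing (haar_mean mu K u).
Proof.
move=> uC uv eps /uv[L cL Lu].
exists [set (x.1 * x.2^-1)%g | x in L `*` K]; first exact: compact_mulgV.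
move=> w nw; apply: (haar_mean_le cK K0 uC) => b Kb; apply: Lu => Lwb.
by apply: nw; exists ((w * b)%g, b) => //=; rewrite mulgK.
Qed.

End HaarMeanDensity.

(** * Vanishing at infinity of the Herz algebra *)

(** Dominated convergence: the restrictions to the complements tend to 0 pointwise, because every
    point eventually belongs to [L n]. *)
Lemma Lnorm_tail (R : realType) d (T : measurableType d)
    (mu : {measure set T -> \bar R}) (p : R) (f : T -> R) (L : nat -> set T) :
  0 < p -> measurable_fun setT f -> ('N[mu]_p%:E[EFin \o f] < +oo)%E ->
  (forall n, measurable (L n)) -> (forall x, \forall n \near \oo, L n x) ->
  forall e : R, 0 < e -> exists n, ('N[mu]_p%:E[EFin \o (f \_ (~` L n))] <= e%:E)%E.
Proof.
move=> p0 mf ff mL cL e e0.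
have pn0 : p != 0 by rewrite gt_eqF.
pose g n (x : T) := (`|(f \_ (~` L n)) x| `^ p)%:E.
have mg n : measurable_fun setT (g n).
  apply/measurable_EFinP; apply: (measurableT_comp (measurable_powR _)).
  apply: measurableT_comp => //; apply/(measurable_restrictT _ (measurableC (mL n))).
  exact: measurable_funTS.
pose G (x : T) := (`|f x| `^ p)%:E.
have Gge0 x : (0 <= G x)%E by rewrite lee_fin powR_ge0.
have iG : mu.-integrable setT G.
  apply/integrableP; split.
    by apply/measurable_EFinP; apply: (measurableT_comp (measurable_powR _)); exact: measurableT_comp.
  under eq_integral do rewrite gee0_abs//.
  have <- : ('N[mu]_p%:E[EFin \o f] `^ p)%E = (\int[mu]_x G x)%E.
    by rewrite poweR_Lnorm//; apply: eq_integral => x _; rewrite /= poweR_EFin.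
  by apply: poweR_lty.
have gG n x : (`|g n x| <= G x)%E.
  rewrite gee0_abs ?lee_fin ?powR_ge0//.
  rewrite patchE; case: ifP => _ //.
  by rewrite /point/= normr0 powR0 ?powR_ge0.
have g0 x : g n x @[n --> \oo] --> 0%E.
  apply: cvg_near_cst; apply: filterS (cL x) => n Lx.
  rewrite /g patchE ifF ?normr0 ?powR0//.
  by apply/negbTE/negP; rewrite inE.
have := @dominated_cvg _ _ _ mu setT measurableT g (cst 0%E) G mg
  (fun x _ => g0 x) (fun x _ => isT) iG (fun n x _ => gG n x).
rewrite integral0 => h.
have [|n _ /(_ n (leqnn n)) hn] := h [set y | (y < (e `^ p)%:E)%E].
  by apply: open_nbhs_nbhs; split; [exact: open_ereal_lt_ereal|rewrite /= lte_fin powR_gt0].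
exists n.
have E : ('N[mu]_p%:E[EFin \o (f \_ (~` L n))] `^ p)%E = (\int[mu]_x g n x)%E.
  by rewrite poweR_Lnorm//; apply: eq_integral => x _; rewrite /= poweR_EFin.
move: E hn => /= <-; have := Lnorm_ge0 mu p%:E (EFin \o (f \_ (~` L n))).
case: (Lnorm _ _ _) => [r| |] //=; last first.
  by rewrite (negbTE pn0).
rewrite !lee_fin lte_fin => r0 hr; rewrite leNgt; apply/negP => er.
have := gt0_ltr_powR p0 _ _ er; rewrite !nnegrE => /(_ (ltW e0) r0) /(lt_trans hr).
by rewrite ltxx.
Qed.

Section Translation.
Context (R : realType) (G : lcGroupType) (mu : {measure set (borel G) -> \bar R}).
Hypothesis hmu : left_haar mu.

Lemma measurable_translate (s : G) (f : G -> R) :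
  measurable_fun [set: borel G] (f : borel G -> R) ->
  measurable_fun [set: borel G] (fun t : borel G => f (s * t)%g).
Proof. by move=> mf; apply: (measurableT_comp mf); exact: measurable_mulgl. Qed.

Lemma Lnorm_translate (s : G) p (f : G -> R) : 0 < p ->
  measurable_fun [set: borel G] (f : borel G -> R) ->
  ('N[mu]_p%:E[EFin \o (fun t : borel G => f (s * t)%g)] =
   'N[mu]_p%:E[EFin \o (f : borel G -> R)])%E.
Proof.
move=> p0 mf; rewrite unlock /=.
rewrite (@haar_integral _ _ _ hmu s setT (fun t => (`|(f t)%:E| `^ p)%E)) //.
apply/measurable_EFinP => //.
apply: (measurableT_comp (measurable_powR _)); exact: measurableT_comp.
Qed.

End Translation.

Section ConvolutionVanishing.
Context (R : realType) (G : lcGroupType) (mu : {measure set (borel G) -> \bar R}).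
Hypothesis hmu : left_haar mu.
Variable L : nat -> set G.
Hypotheses (cL : forall n, compact (L n)) (covL : forall x, \forall n \near \oo, L n x).

Let mL n : measurable (L n : set (borel G)) := compact_borel (@cL n).

Let measurable_tail n (f : G -> R) : measurable_fun [set: borel G] (f : borel G -> R) ->
  measurable_fun [set: borel G] ((f : borel G -> R) \_ (~` L n)).
Proof.
move=> mf; apply/(measurable_restrictT _ (measurableC (mL n))).
exact: measurable_funTS.
Qed.

(** If [s] is outside [L n (L m)^-1], then for every [t] either [t] is outside [L n] or [s^-1 t] is
    outside [L m]. So the integrand is bounded by two products, each containing the tail of one
    factor, and Hölder's inequality concludes, translations being isometric. *)
Lemma convolution_vanishing (p q : R) (a b : G -> R) :
  0 < p -> 0 < q -> q^-1 + p^-1 = 1 ->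
  measurable_fun [set: borel G] (a : borel G -> R) ->
  measurable_fun [set: borel G] (b : borel G -> R) ->
  ('N[mu]_q%:E[EFin \o (a : borel G -> R)] < +oo)%E ->
  ('N[mu]_p%:E[EFin \o (b : borel G -> R)] < +oo)%E ->
  forall e : R, 0 < e -> exists2 M : set G, compact M & forall s, ~ M s ->
    (\int[mu]_t `|a t * b (s^-1 * t)%g|%:E <= e%:E)%E.
Proof.
move=> p0 q0 pq ma mb fa fb e e0.
pose A := fine (Lnorm mu q%:E (EFin \o (a : borel G -> R))).
pose B := fine (Lnorm mu p%:E (EFin \o (b : borel G -> R))).
have AE : Lnorm mu q%:E (EFin \o (a : borel G -> R)) = A%:E.
  by rewrite fineK// ge0_fin_numE// Lnorm_ge0.
have BE : Lnorm mu p%:E (EFin \o (b : borel G -> R)) = B%:E.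
  by rewrite fineK// ge0_fin_numE// Lnorm_ge0.
have A0 : 0 <= A by apply: fine_ge0; exact: Lnorm_ge0.
have B0 : 0 <= B by apply: fine_ge0; exact: Lnorm_ge0.
pose d := e / (A + B + 1).
have AB1 : 0 < A + B + 1 by rewrite ltr_wpDl// addr_ge0.
have d0 : 0 < d by rewrite divr_gt0.
have [n an] := Lnorm_tail q0 ma fa mL covL d0.
have [m bm] := Lnorm_tail p0 mb fb mL covL d0.
exists [set (x.1 * x.2^-1)%g | x in L n `*` L m]; first exact: compact_mulgV.
move=> s ns.
pose a' := (a : borel G -> R) \_ (~` L n).
pose b' := (b : borel G -> R) \_ (~` L m).
have ma' : measurable_fun [set: borel G] a' := measurable_tail n ma.
have mb' : measurable_fun [set: borel G] b' := measurable_tail m mb.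
have mbs := measurable_translate s^-1%g mb.
have mbs' := measurable_translate s^-1%g mb'.
have mprod (f g : borel G -> R) : measurable_fun setT f -> measurable_fun setT g ->
    measurable_fun setT (fun t => `|f t * g t|%:E).
  move=> mf mg; apply/measurable_EFinP; apply: measurableT_comp => //.
  exact: measurable_funM.
have H1 := hoelder mu ma mbs' q0 p0 pq.
have H2 := hoelder mu ma' mbs q0 p0 pq.
rewrite (Lnorm_translate hmu s^-1%g p0 mb') AE Lnorm1 in H1.
rewrite (Lnorm_translate hmu s^-1%g p0 mb) BE Lnorm1 in H2.
apply: (@le_trans _ _ (\int[mu]_t (`|a t * b' (s^-1 * t)%g|%:E +
    `|a' t * b (s^-1 * t)%g|%:E))%E).
  apply: ge0_le_integral => //.
  - exact: mprod.
  - by apply: emeasurable_funD; exact: mprod.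
  move=> t _; rewrite -EFinD lee_fin /a' /b' !patchE.
  case: ifPn => Lm; first by rewrite lerDl.
  case: ifPn => Ln; first by rewrite lerDr.
  exfalso; apply: ns; exists (t, s^-1 * t)%g => /=.
    by split => /=; apply: contrapT => h; [apply: (negP Ln)|apply: (negP Lm)]; rewrite inE.
  by rewrite invgM invgK mulVKg.
rewrite ge0_integralD//; [|exact: mprod|exact: mprod].
apply: (@le_trans _ _ (A%:E * d%:E + d%:E * B%:E)%E).
  apply: leeD.
    by apply: le_trans H1 _; rewrite lee_wpmul2l// lee_fin.
  by apply: le_trans H2 _; rewrite lee_wpmul2r// lee_fin.
rewrite -!EFinM -EFinD lee_fin (mulrC A) -mulrDr /d -mulrAC ler_pdivrMr//.
by rewrite ler_wpM2l ?(ltW e0)// lerDl.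
Qed.

End ConvolutionVanishing.

Lemma Rintegral_le_integral (R : realType) d (T : measurableType d)
    (mu : {measure set T -> \bar R}) (f : T -> R) (e : R) :
  measurable_fun setT f -> (\int[mu]_x `|f x|%:E <= e%:E)%E ->
  `|\int[mu]_x f x| <= e.
Proof.
move=> mf fe.
have fi : mu.-integrable setT (EFin \o f).
  apply/integrableP; split; first exact/measurable_EFinP.
  by apply: le_lt_trans fe _; rewrite ltry.
apply: le_trans (le_normr_Rintegral measurableT fi) _.
rewrite -lee_fin /Rintegral fineK// ge0_fin_numE; last exact: integral_ge0.
by apply: le_lt_trans fe _; rewrite ltry.
Qed.

Section HerzVanishing.
Context (R : realType) (G : lcGroupType) (mu : {measure set (borel G) -> \bar R}).
Hypothesis hmu : left_haar mu.
Variable L : nat -> set G.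
Hypotheses (cL : forall n, compact (L n)) (covL : forall x, \forall n \near \oo, L n x).
Variable p : R.
Hypothesis p1 : 1 < p.

Lemma tensor_vanishing (g f : G -> R[i]) : Lp mu (conj_exponent p) g -> Lp mu p f ->
  vanishing (fun s => rnorm (cintegral mu (fun t => g t * lambda s f t))).
Proof.
move=> [mg fg] [mf ff] e e0.
have p0 : 0 < p := lt_trans ltr01 p1.
have pi : p^-1 < 1 by rewrite invf_lt1.
have q0 : 0 < conj_exponent p by rewrite invr_gt0 subr_gt0.
have pq : (conj_exponent p)^-1 + p^-1 = 1 by rewrite invrK subrK.
have e2 : 0 < e / 2 by rewrite divr_gt0.
have [M cM HM] := convolution_vanishing hmu cL covL p0 q0 pq
  (measurable_rnorm mg) (measurable_rnorm mf) fg ff e2.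
exists M => // s /HM hs; rewrite ger0_norm ?rnorm_ge0//.
have [mg1 mg2] := mg; have [mf1 mf2] := mf.
have ms1 := measurable_translate s^-1%g mf1.
have ms2 := measurable_translate s^-1%g mf2.
pose h t := g t * lambda s f t.
have hE t : `|rnorm (g t) * rnorm (f (s^-1 * t)%g)| = rnorm (h t).
  by rewrite ger0_norm ?mulr_ge0 ?rnorm_ge0// /h rnormM.
have mRe : measurable_fun [set: borel G] (fun t : borel G => complex.Re (h t)).
  rewrite (_ : (fun t => _) = fun t : borel G => complex.Re (g t) * complex.Re (f (s^-1 * t)%g) -
      complex.Im (g t) * complex.Im (f (s^-1 * t)%g)).
    by apply: measurable_funB; exact: measurable_funM.
  by apply/funext => t; rewrite /h /lambda; case: (g t); case: (f _).
have mIm : measurable_fun [set: borel G] (fun t : borel G => complex.Im (h t)).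
  rewrite (_ : (fun t => _) = fun t : borel G => complex.Re (g t) * complex.Im (f (s^-1 * t)%g) +
      complex.Im (g t) * complex.Re (f (s^-1 * t)%g)).
    by apply: measurable_funD; exact: measurable_funM.
  by apply/funext => t; rewrite /h /lambda; case: (g t); case: (f _).
have mh : measurable_fun [set: borel G] (fun t : borel G => rnorm (h t)).
  exact: (@measurable_rnorm R _ (borel G) h (conj mRe mIm)).
have bound (r : borel G -> R) : measurable_fun setT r ->
    (forall t, `|r t| <= rnorm (h t)) -> `|\int[mu]_t r t| <= e / 2.
  move=> mr rh; apply: Rintegral_le_integral => //; apply: le_trans hs.
  apply: ge0_le_integral => //.
  - by apply/measurable_EFinP; exact: measurableT_comp.
  - apply/measurable_EFinP; under eq_fun do rewrite hE; exact: mh.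
  - by move=> t _; rewrite hE lee_fin.
rewrite (splitr e); apply: le_trans (rnorm_le_ReIm _) _.
by apply: lerD => /=; apply: bound => // t; [exact: Re_le_rnorm|exact: Im_le_rnorm].
Qed.

Lemma Lambda_vanishing u : tensors mu (conj_exponent p) p u ->
  vanishing (fun s => rnorm (Lambda mu u s)).
Proof.
elim: u => [_ e e0|x u IH tu e e0].
  exists set0; first exact: compact0.
  by move=> s _; rewrite /Lambda big_nil rnorm0 normr0 ltW.
have [|M cM HM] := IH _ _ (divr_gt0 e0 (@ltr0Sn R 1)).
  by move=> y yu; apply: tu; rewrite in_cons yu orbT.
have [gx fx] := tu x (mem_head _ _).
have [N cN HN] := tensor_vanishing gx fx (divr_gt0 e0 (@ltr0Sn R 1)).
exists (M `|` N); first exact: compactU.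
move=> s ns; rewrite /Lambda big_cons ger0_norm ?rnorm_ge0//.
apply: le_trans (rnormD _ _) _; rewrite (splitr e) lerD//.
  by apply: le_trans (ler_norm _) _; apply: HN => h; apply: ns; right.
by apply: le_trans (ler_norm _) _; apply: HM => h; apply: ns; left.
Qed.

Lemma Ap_vanishing phi : Ap mu p phi -> vanishing (fun s => rnorm (phi s)).
Proof.
move=> [u [tu _] lim] e e0.
have e2 : 0 < e / 2 by rewrite divr_gt0.
have [N /(_ N (leqnn N)) hN] := lim _ e2.
have [M cM HM] := Lambda_vanishing (tu N) e2.
exists M => // s ns; rewrite ger0_norm ?rnorm_ge0//.
rewrite (_ : phi s = Lambda mu (u N) s - (Lambda mu (u N) s - phi s)); last first.
  by rewrite opprB addrC subrK.
apply: le_trans (rnormD _ _) _; rewrite rnormN (splitr e) lerD//; last exact/ltW/hN.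
by apply: le_trans (ler_norm _) _; exact: HM.
Qed.

End HerzVanishing.

Section Exhaustion.
Context (R : realType).
Local Notation G := (Sp2 R).

Definition Sp2_box (n : nat) : set G :=
  [set w | forall i j, Sp2_mx w i j \in `[(- n%:R), n%:R]].

Lemma Sp2_box_compact n : compact (Sp2_box n).
Proof.
pose K := [set M : 'M[R]_(2 + 2) | forall i j, M i j \in `[(- n%:R), n%:R]].
have cK : compact K by exact: mx_box_compact.
have cKS : compact (K `&` [set g : 'M[R]_(2 + 2) | g^T *m symJ R *m g = symJ R]).
  by apply: compact_closedI => //; exact: Sp2_closed.
move=> F PF FK.
have FKS : F (@Sp2_mx R @^-1` (K `&`
    [set g : 'M[R]_(2 + 2) | g^T *m symJ R *m g = symJ R])).
  by apply: (@filterS _ F _ _ _ _ FK) => z Kz; split; [exact: Kz|exact: Sp2P].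
have [y [[Ky Sy] cly]] := cKS (@Sp2_mx R @ F) (fmap_proper_filter _ PF) FKS.
exists (mkSp2 Sy); split => // A B FA [_ [[V oV <-] Vy sVB]].
have FA' : F (@Sp2_mx R @^-1` (@Sp2_mx R @` A)).
  by apply: (@filterS _ F _ _ _ _ FA) => a Aa; exists a.
have [z [[a Aa <-] Vz]] := cly _ V FA' (open_nbhs_nbhs (conj oV Vy)).
by exists a; split => //; exact: sVB.
Qed.

Lemma Sp2_box_cover (w : G) : \forall n \near \oo, Sp2_box n w.
Proof.
exists (Num.bound `|Sp2_mx w|) => // n /= hn i j.
have h1 : `|Sp2_mx w i j| <= `|Sp2_mx w|.
  rewrite [leRHS](_ : _ = mx_norm (Sp2_mx w)) // mx_normrE.
  exact: (le_bigmax _ (fun ij => `|Sp2_mx w ij.1 ij.2|) (i, j)).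
rewrite in_itv/= -ler_norml; apply: le_trans h1 _.
apply: le_trans (ltW (archi_boundP _)) _ => //.
by rewrite ler_nat.
Qed.

Lemma entry_bounded (i j : nat) (L : set G) : compact L ->
  exists n : nat, forall w, L w -> `|entry i j w| <= n%:R.
Proof.
move=> cL.
have ce : continuous (@entry R i j).
  move=> w; exact: (continuous_comp (@Sp2_mx_cont R w)
    (@coord_continuous R (2 + 2) (2 + 2) (@inord (2 + 1) i) (@inord (2 + 1) j) _)).
have : compact [set entry i j w | w in L].
  by apply: continuous_compact cL; exact: continuous_subspaceT.
move=> /(@compact_bounded R R^o)[M [_ HM]].
exists (Num.bound (`|M| + 1)) => w Lw.
apply: (le_trans (HM (`|M| + 1) _ _ _)).
- by rewrite (le_lt_trans (ler_norm _))// ltrDl.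
- by exists w.
- by rewrite ltW// archi_boundP// addr_ge0.
Qed.

End Exhaustion.

(** * The limit functional *)

Lemma geometric_small (R : realType) (a rho e : R) : 0 <= a -> 0 <= rho < 1 -> 0 < e ->
  exists n, forall m, (n <= m)%N -> a * rho ^+ m <= e.
Proof.
move=> a0 /andP[r0 r1] e0.
have h : rho ^+ n @[n --> \oo] --> 0 by apply: cvg_expr; rewrite ger0_norm.
have d0 : 0 < e / (a + 1) by rewrite divr_gt0// ltr_wpDl.
have /cvgrPdist_lt /(_ _ d0) [n _ hn] := h.
exists n => m nm; have := hn m nm; rewrite sub0r normrN ger0_norm ?exprn_ge0// => hm.
apply: (@le_trans _ _ (a * (e / (a + 1)))); first by rewrite ler_wpM2l// ltW.
by rewrite mulrCA ler_piMr ?(ltW e0)// ler_pdivrMr ?ltr_wpDl// mul1r lerDl.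
Qed.

Lemma bounded_by_lin (R : realType) (G : lcGroupType) (C C' a : R) (u v : G -> R) :
  bounded_by C u -> bounded_by C' v ->
  bounded_by (`|a| * C + C') (fun x => a * u x + v x).
Proof.
move=> uC vC; split => [x|w].
  apply: (@continuousD _ R^o G (fun x => a * u x) v x); last exact: vC.1.
  by apply: (@continuousM _ G (fun=> a) u x); [exact: cst_continuous|exact: uC.1].
apply: le_trans (ler_normD _ _) _; rewrite normrM lerD ?vC.2//.
by rewrite ler_wpM2l// uC.2.
Qed.

Lemma bounded_by_cst (R : realType) (G : lcGroupType) (c : R) :
  bounded_by `|c| (fun _ : G => c).
Proof. by split => [|w]; [exact: cst_continuous|]. Qed.

Section WordLimit.
Context (R : realType) (mu : {measure set (borel (Sp2 R)) -> \bar R}).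
Hypothesis hmu : left_haar mu.
Variable K : set (Sp2 R).
Hypotheses (cK : compact K) (K0 : (0 < mu K < +oo)%E).
Local Notation G := (Sp2 R).
Implicit Types (u v : G -> R).

Definition word_value u k : R := word_seq k (haar_mean mu K u).

Definition settles u := (exists C, bounded_by C u) /\ cvgn (word_value u).

Definition word_limit u : R := limn (word_value u).

Lemma word_value_lin C C' a u v k : bounded_by C u -> bounded_by C' v ->
  word_value (fun x => a * u x + v x) k = a * word_value u k + word_value v k.
Proof.
move=> uC vC; rewrite /word_value (haar_mean_lin cK K0 a uC vC).
exact: (word_seq_lin k a (haar_modulusP hmu cK K0 C) (haar_modulusP hmu cK K0 C')
  (haar_mean_ruc uC) (haar_mean_ruc vC)).
Qed.

Lemma settles_lin a u v : settles u -> settles v ->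
  settles (fun x => a * u x + v x) /\
  word_limit (fun x => a * u x + v x) = a * word_limit u + word_limit v.
Proof.
move=> [[C uC] cu] [[C' vC] cv].
have E : word_value (fun x => a * u x + v x) = fun k => a * word_value u k + word_value v k.
  by apply/funext => k; exact: word_value_lin uC vC.
have lE : word_value (fun x => a * u x + v x) @ \oo --> a * word_limit u + word_limit v.
  rewrite E; apply: cvgD; last exact: cv.
  by apply: cvgM; [exact: cvg_cst|exact: cu].
split; last exact: cvg_lim lE.
split; last by apply/cvg_ex; eexists; exact: lE.
by exists (`|a| * C + C'); exact: bounded_by_lin.
Qed.

Lemma settles_cst c : settles (fun=> c) /\ word_limit (fun=> c) = c.
Proof.
have E : word_value (fun=> c) = fun=> c.
  apply/funext => k; rewrite /word_value haar_mean_cst//; exact: word_seq_const.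
split; last by rewrite /word_limit E lim_cst.
by split; [exists `|c|; exact: bounded_by_cst|rewrite E; exact: is_cvg_cst].
Qed.

Lemma schur_settles th : 0 < th -> exists L rho : R, [/\ 0 <= L, 0 <= rho < 1 &
  forall C D u, bounded_by C u -> schur th D u ->
    settles u /\ forall k, `|word_limit u - word_value u k| <= D * L * rho ^+ k].
Proof.
move=> th0; have [L [rho [L0 r01 H]]] := word_seq_cauchy th0.
exists L, rho; split => // C D u uC uD.
have D0 : 0 <= D := le_trans (normr_ge0 _) (schur_bounded uD 1%g).
have {}H := H D _ _ (haar_modulusP hmu cK K0 C) (haar_mean_ruc uC)
  (schur_haar_mean cK K0 uC uD).
have cv : cvgn (word_value u).
  apply: cauchy_real_cvg => e e0.
  have [n hn] := geometric_small (mulr_ge0 D0 L0) r01 e0.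
  by exists n => m nm; apply: le_trans (H _ _ nm) _; exact: hn.
split; first by split; [exists C|].
move=> k; apply: limr_dist_le => //; exists k => // m /= km.
by rewrite distrC; exact: H.
Qed.

(** Word functionals are limits of finite signed measures of mass at most 1, and [haar_mean] does
    not increase bounds. *)
Lemma word_limit_le C u : settles u -> bounded_by C u -> `|word_limit u| <= C.
Proof.
move=> [_ cu] uC; rewrite -[word_limit u]subr0; apply: limr_dist_le => //.
apply: nearW => k; rewrite subr0; apply/ler_addgt0Pr => e e0.
have C0 : 0 <= C := le_trans (normr_ge0 _) (uC.2 1%g).
have [s s1 hs] := word_seq_approximable k (haar_modulusP hmu cK K0 C) e0.
have := hs _ (haar_mean_ruc uC); rewrite -/(word_value u k) => h.
have c : `|combination s (haar_mean mu K u)| <= C.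
  apply: le_trans (ler_norm_sum _ _ _) _.
  apply: (@le_trans _ _ (\sum_(x <- s) `|x.1| * C)).
    apply: ler_sum => x _; rewrite normrM ler_wpM2l//.
    by apply: (haar_mean_le cK K0 uC) => b _; exact: uC.2.
  by rewrite -mulr_suml -[leRHS]mul1r ler_wpM2r.
rewrite -[word_value u k](subrK (combination s (haar_mean mu K u))) addrC.
by apply: le_trans (ler_normD _ _) _; rewrite lerD.
Qed.

Lemma word_limit_vanishing u : settles u -> vanishing u -> word_limit u = 0.
Proof.
move=> [[C uC] cu] uv; apply/eqP; rewrite -normr_le0; apply/ler_addgt0Pr => e e0.
rewrite add0r -[word_limit u]subr0; apply: limr_dist_le => //.
have C0 : 0 <= C := le_trans (normr_ge0 _) (uC.2 1%g).
have e2 : 0 < e / 2 by rewrite divr_gt0.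
have [L cL HL] := haar_mean_vanishing cK K0 uC uv e2.
have [n Hn] := entry_bounded 2 3 cL.
(* Once [k] exceeds [c], so does [2 ^ (6 k)], and the tail term [C (n + 1) / 2 ^ (6 k)] is at most
   [e / 2]. *)
pose c := C * n.+1%:R / (e / 2).
exists (Num.bound c) => // k /= ck; rewrite subr0.
have MC w : `|haar_mean mu K u w| <= C.
  by apply: (haar_mean_le cK K0 uC) => b _; exact: uC.2.
have tail w : n%:R < `|entry 2 3 w| -> `|haar_mean mu K u w| <= e / 2.
  by move=> nw; apply: HL => /Hn; rewrite leNgt nw.
apply: le_trans (word_seq_tail k (haar_modulusP hmu cK K0 C) (haar_mean_ruc uC)
  (ltW e2) MC tail) _.
rewrite {2}(splitr e) lerD2l mulrA.
have k2 : (k < 2 ^ (6 * k))%N.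
  by apply: leq_trans (ltn_expl k (ltnSn 1)) _; rewrite leq_exp2l// leq_pmull.
have p2 : 0 < (2 ^ (6 * k))%:R :> R by rewrite ltr0n; apply: leq_ltn_trans k2.
rewrite ler_pdivrMr// [leRHS]mulrC -ler_pdivrMr//.
have c0 : 0 <= c by rewrite divr_ge0 ?(ltW e2)// mulr_ge0.
have : c < k%:R by apply: lt_le_trans (archi_boundP c0) _; rewrite ler_nat.
move=> /ltW ck2; apply: (le_trans ck2); rewrite ler_nat; exact: (ltnW k2).
Qed.

End WordLimit.

Section FactorBounded.
Context (R : realType) (G : lcGroupType) (p : R) (phi : G -> R[i]).
Context (E : completeNormedModType R[i]) (alpha : G -> E) (beta : G -> E -> R[i]).
Hypothesis fac : Mpcb_factor p phi alpha beta.
Local Notation c := (sup (range (fun t => rnorm (alpha t))) *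
  sup (range (fun s => dualnorm (beta s)))).

Let factor_part (part : R[i] -> R) :
  (forall x y, part (x - y) = part x - part y) -> (forall z, `|part z| <= rnorm z) ->
  bounded_by c (fun x => part (phi x)).
Proof.
move=> pB ple; split => [x|w]; last by apply: le_trans (ple _) _; exact: factor_bounded fac w.
apply/cvgrPdist_lt => e e0; apply: filterS (factor_continuous fac x e0) => y.
by apply: le_lt_trans; rewrite distrC -pB.
Qed.

Lemma factor_bounded_Re : bounded_by c (fun x => complex.Re (phi x)).
Proof. by apply: factor_part => [[? ?] [? ?] //|z]; exact: Re_le_rnorm. Qed.

Lemma factor_bounded_Im : bounded_by c (fun x => complex.Im (phi x)).
Proof. by apply: factor_part => [[? ?] [? ?] //|z]; exact: Im_le_rnorm. Qed.

End FactorBounded.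

Lemma rnorm_sub_Complex (R : realType) (a b a' b' : R) :
  rnorm (Complex a b - Complex a' b') <= `|a - a'| + `|b - b'|.
Proof. exact: rnorm_le_ReIm. Qed.

Lemma bounded_by_le (R : realType) (G : lcGroupType) (C C' : R) (u : G -> R) :
  C <= C' -> bounded_by C u -> bounded_by C' u.
Proof. by move=> CC [cu uC]; split => // w; exact: le_trans CC. Qed.

(** * The functional that separates 1 from the Herz algebra *)

Section Main.
Context (R : realType) (p : R) (p1 : 1 < p).
Context (mu : {measure set (borel (Sp2 R)) -> \bar R}).
Hypothesis hmu : left_haar mu.
Variable K : set (Sp2 R).
Hypotheses (cK : compact K) (K0 : (0 < mu K < +oo)%E).
Local Notation G := (Sp2 R).
Local Notation settles := (settles mu K).
Local Notation wlim := (word_limit mu K).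
Implicit Types (phi : G -> R[i]).

Definition csettles phi := settles (fun x => complex.Re (phi x)) /\
  settles (fun x => complex.Im (phi x)).

(* The junk value 0 is what [word_mean_Ap] needs: an element of [Ap] is only known
   here to vanish at infinity, so the means may fail to converge on it. *)
Definition word_mean phi : R[i] := if `[< csettles phi >] then
  Complex (wlim (fun x => complex.Re (phi x))) (wlim (fun x => complex.Im (phi x)))
  else 0.

Lemma word_meanE phi : csettles phi -> word_mean phi =
  Complex (wlim (fun x => complex.Re (phi x))) (wlim (fun x => complex.Im (phi x))).
Proof. by move=> h; rewrite /word_mean asboolT. Qed.

Lemma word_mean_rate : exists L rho : R, [/\ 0 <= L, 0 <= rho < 1 &
  forall phi (E : completeNormedModType R[i]) (alpha : G -> E) (beta : G -> E -> R[i]),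
  Mpcb_factor p phi alpha beta ->
  csettles phi /\ forall k,
  rnorm (word_mean phi - Complex (word_value mu K (fun x => complex.Re (phi x)) k)
    (word_value mu K (fun x => complex.Im (phi x)) k)) <=
  sup (range (fun t => rnorm (alpha t))) * sup (range (fun s => dualnorm (beta s))) *
    L * rho ^+ k].
Proof.
have [L [rho [L0 r01 H]]] := schur_settles hmu cK K0 (rate_gt0 p1).
(* Twice the constant 70 of [factor_schur_Re] and [factor_schur_Im]. *)
exists (140 * L), rho; split; [by rewrite mulr_ge0|exact: r01|].
move=> phi E alpha beta fac.
have [s1 h1] := H _ _ _ (factor_bounded_Re fac) (factor_schur_Re p1 fac).
have [s2 h2] := H _ _ _ (factor_bounded_Im fac) (factor_schur_Im p1 fac).
have cs : csettles phi by split; [exact: s1|exact: s2].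
split; first exact: cs.
move=> k; rewrite (word_meanE cs).
apply: le_trans (rnorm_sub_Complex _ _ _ _) _.
apply: le_trans (lerD (h1 k) (h2 k)) _.
by apply: le_of_eq; ring.
Qed.

Lemma Mpcb_csettles phi : Mpcb p phi -> csettles phi.
Proof.
move=> [E [al [be fac]]]; have [L [rho [_ _ H]]] := word_mean_rate.
exact: (H _ _ _ _ fac).1.
Qed.

Lemma csettles_lin a phi psi : csettles phi -> csettles psi ->
  csettles (fun x => a * phi x + psi x) /\
  word_mean (fun x => a * phi x + psi x) = a * word_mean phi + word_mean psi.
Proof.
move=> [ru iu] [rv iv].
case: a => a b.
have ER : (fun x => complex.Re (Complex a b * phi x + psi x)) =
    (fun x => a * complex.Re (phi x) + (- b * complex.Im (phi x) + complex.Re (psi x))).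
  by apply/funext => x; case: (phi x) => ? ?; case: (psi x) => ? ? /=; ring.
have EI : (fun x => complex.Im (Complex a b * phi x + psi x)) =
    (fun x => a * complex.Im (phi x) + (b * complex.Re (phi x) + complex.Im (psi x))).
  by apply/funext => x; case: (phi x) => ? ?; case: (psi x) => ? ? /=; ring.
have [s1 l1] := settles_lin hmu cK K0 (- b) iu rv.
have [s2 l2] := settles_lin hmu cK K0 b ru iv.
have [s3 l3] := settles_lin hmu cK K0 a ru s1.
have [s4 l4] := settles_lin hmu cK K0 a iu s2.
have cs : csettles (fun x => Complex a b * phi x + psi x) by split; [rewrite ER; exact: s3|rewrite EI; exact: s4].
split; first exact: cs.
rewrite (word_meanE cs) (word_meanE (conj ru iu)) (word_meanE (conj rv iv)) ER EI l3 l4 l1 l2.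
move: (wlim (fun x => complex.Re (phi x))) (wlim (fun x => complex.Im (phi x))) => r1 i1.
move: (wlim (fun x => complex.Re (psi x))) (wlim (fun x => complex.Im (psi x))) => r2 i2.
by congr Complex => /=; ring.
Qed.

Lemma word_mean_le phi : Mpcb p phi -> rnorm (word_mean phi) <= 2 * Mpcb_norm p phi.
Proof.
move=> Mphi; have [ru iu] := Mpcb_csettles Mphi.
rewrite -ler_pdivrMl//; apply: lb_le_inf.
  by have [E [al [be fac]]] := Mphi; eexists; exists E, al, be; split; [exact: fac|].
move=> _ [E [al [be [fac ->]]]]; rewrite ler_pdivrMl//.
rewrite (word_meanE (conj ru iu)); apply: le_trans (rnorm_le_ReIm _) _; rewrite mulr_natl mulr2n.
apply: lerD => /=.
  exact: (word_limit_le hmu cK K0 ru (factor_bounded_Re fac)).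
exact: (word_limit_le hmu cK K0 iu (factor_bounded_Im fac)).
Qed.

(** Two approximations, both uniform on the unit ball: the limit by the word of index [k], then this
    word by a finite combination, which after [haar_mean] is integration against a function of
    L_1. *)
Lemma word_mean_Qpcb : Qpcb p mu word_mean.
Proof.
split.
  split; last by exists 2 => phi; exact: word_mean_le.
  move=> a phi psi Mphi Mpsi.
  exact: (csettles_lin a (Mpcb_csettles Mphi) (Mpcb_csettles Mpsi)).2.
move=> e e0.
have [L [rho [L0 r01 H]]] := word_mean_rate.
have e4 : 0 < e / 4 by rewrite divr_gt0.
(* The constant 2 leaves room: the multiplier norm is an infimum, so norm at most 1 only provides a
   factorization with constant below 2. *)
have [k /(_ k (leqnn k)) Hk] := geometric_small (mulr_ge0 (@ler0n R 2) L0) r01 e4.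
have e8 : 0 < e / 8 by rewrite divr_gt0.
have [s _ Hs] := word_seq_approximable k (haar_modulusP hmu cK K0 2) e8.
have [f [f1 Hf]] := combination_Lp1 hmu cK K0 s.
exists f => //; apply: (@le_lt_trans _ _ (e / 2)); last by rewrite ltr_pdivrMr// ltr_pMr// ltr1n.
rewrite /Mpcb_dualnorm; set S := [set _ | _ in _].
have ub x : S x -> x <= e / 2.
  move=> [phi [Mphi nphi] <-].
  have [_ [E [al [be [fac ->]]]] c2] : exists2 c, [set c | exists (E : completeNormedModType R[i])
      (alpha : G -> E) (beta : G -> E -> R[i]), Mpcb_factor p phi alpha beta /\
      c = sup (range (fun t => rnorm (alpha t))) *
          sup (range (fun s => dualnorm (beta s)))] c & c < 2.
    apply: inf_lt; last by apply: le_lt_trans nphi _; rewrite ltr1n.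
    by have [E [al [be fac]]] := Mphi; eexists; exists E, al, be; split; [exact: fac|].
  have rb := bounded_by_le (ltW c2) (factor_bounded_Re fac).
  have ib := bounded_by_le (ltW c2) (factor_bounded_Im fac).
  have [_ /(_ k) hk] := H _ _ _ _ fac.
  rewrite (Hf _ _ rb ib).
  set z := Complex (word_value _ _ _ _) _ in hk.
  rewrite -(subrKA z); apply: le_trans (rnormD _ _) _.
  have -> : e / 2 = e / 4 + (e / 8 + e / 8) by field.
  apply: lerD.
    apply: le_trans hk _; apply: le_trans Hk.
    by rewrite ler_wpM2r ?exprn_ge0 ?(andP r01).1// ler_wpM2r// ltW.
  apply: le_trans (rnorm_sub_Complex _ _ _ _) _; apply: lerD.
    exact: Hs (haar_mean_ruc rb).
  exact: Hs (haar_mean_ruc ib).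
have [->|/set0P S0] := eqVneq S set0; first by rewrite sup0 divr_ge0 ?(ltW e0).
by apply: ge_sup.
Qed.

Lemma word_mean1 : word_mean (fun=> 1) = 1.
Proof.
have [s1 l1] := settles_cst cK K0 1; have [s0 l0] := settles_cst cK K0 0.
have cs : csettles (fun=> 1) by split; [exact: s1|exact: s0].
by rewrite (word_meanE cs) /= l1 l0.
Qed.

Lemma word_mean_Ap phi : Ap mu p phi -> word_mean phi = 0.
Proof.
move=> /(Ap_vanishing hmu (@Sp2_box_compact R) (@Sp2_box_cover R) p1) van.
rewrite /word_mean; case: asboolP => // -[ru iu].
have part_van (part : R[i] -> R) : (forall z, `|part z| <= rnorm z) ->
    vanishing (fun x => part (phi x)).
  move=> ple e /van[L cL HL]; exists L => // w /HL; apply: le_trans.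
  by apply: le_trans (ple _) (ler_norm _).
rewrite !(word_limit_vanishing hmu cK K0)//; apply: part_van => z.
- exact: Im_le_rnorm.
- exact: Re_le_rnorm.
Qed.

End Main.

Theorem theorem1p4 (R : realType) (p : R) (hp : 1 < p)
    (mu : {measure set (borel (Sp2 R)) -> \bar R}) (hmu : left_haar mu) :
  ~ p_AP mu p.
Proof.
have [K [cK K0]] := haar_positive_compact hmu.
move=> [I [le [phi [[[i0] le_refl le_trans le_dir] phiAp]]]].
move=> /(_ _ (word_mean_Qpcb hp hmu cK K0)).
rewrite (word_mean1 cK K0).
have -> : (fun i => word_mean mu K (phi i)) = fun=> 0.
  by apply/funext => i; exact: (word_mean_Ap hp hmu cK K0).
move=> h.
have PF : ProperFilter (net_filter le).
  apply: filter_from_proper; last by move=> i _; exists i; exact: le_refl.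
  apply: filter_from_filter; first by exists i0.
  move=> i j _ _; have [k ik jk] := le_dir i j; exists k => // l kl.
  by split; [exact: le_trans ik kl|exact: le_trans jk kl].
have E : 1 = 0 :> R[i].
  exact: (@cvg_unique _ (@norm_hausdorff _ R[i]^o) _ _ _ _ h (cvg_cst (0 : R[i]^o))).
by have := oner_neq0 R[i]; rewrite E eqxx.
Qed.
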